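(* Let $M$ be a real algebraic CR-generic submanifold of $\mathbb{C}^n$, let $p\in M$, assume that the germ $(M,p)$ is contained in the Levi-flat hypersurface $\{z_n=\bar z_n\}$, and assume that $M$ possesses a nontrivial infinitesimal CR automorphism inducing an algebraic foliation. Then $M$ admits a local one-parameter family of nonalgebraic biholomorphic self-maps (near $p$).
   Context: An infinitesimal CR automorphism of $M$ is the real part $\mathcal{K}=\operatorname{Re}\mathcal{X}$ of a holomorphic $(1,0)$ vector field $\mathcal{X}$ (here with holomorphic algebraic coefficients) defined near $p$ that is tangent to $M$; it induces an algebraic foliation if the complex foliation by integral curves of $\mathcal{X}$ is complex algebraic, i.e. becomes the foliation by parallel lines in some local coordinates given by a biholomorphism with holomorphic algebraic components. A local biholomorphic self-map of $M$ is a biholomorphism defined near $p$ mapping $M$ into $M$; it is nonalgebraic if its components are not all algebraic. *)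

(* Defs.v *)
(* C := R[i] (complex numbers over a
   realType R, from mathcomp-real-closed), C^n := 'rV[R[i]]_n, which is a
   normed module over C, so that [differentiable] over C = holomorphic. *)
From HB Require Import structures.
From mathcomp Require Import all_boot all_order all_algebra.
From mathcomp Require Import all_classical all_reals all_analysis.
From mathcomp.real_closed Require Export complex.
Export Order.TTheory GRing.Theory Num.Theory.
Export numFieldNormedType.Exports.

Set Implicit Arguments.
Unset Strict Implicit.
Unset Printing Implicit Defensive.

Local Open Scope ring_scope.
Local Open Scope classical_set_scope.

Section CRDefs.
Variables (R : realType) (n : nat).

Local Notation C := (R[i]).
Local Notation Cn := ('rV[(R[i])^o]_n).

Definition coord (z : Cn) (j : 'I_n) : C := (z ord0 j : C).

Inductive realpoly : (Cn -> C) -> Prop :=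
| rp_const (c : C) : c \is Num.real -> realpoly (fun _ => c)
| rp_re (j : 'I_n) : realpoly (fun z => 'Re (coord z j))
| rp_im (j : 'I_n) : realpoly (fun z => 'Im (coord z j))
| rp_add f g : realpoly f -> realpoly g -> realpoly (fun z => f z + g z)
| rp_mul f g : realpoly f -> realpoly g -> realpoly (fun z => f z * g z).

Inductive holpoly : (Cn -> C) -> Prop :=
| hp_const (c : C) : holpoly (fun _ => c)
| hp_coord (j : 'I_n) : holpoly (fun z => coord z j)
| hp_add f g : holpoly f -> holpoly g -> holpoly (fun z => f z + g z)
| hp_mul f g : holpoly f -> holpoly g -> holpoly (fun z => f z * g z).

Definition rC (t : R) : C := (t%:C)%C.

Definition rdir (f : Cn -> C) (z v : Cn) : C :=
  lim ((fun t : R => ((f (z + rC t *: v) - f z) / rC t : (R[i])^o)) @ 0^').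

Definition dz (f : Cn -> C) (z : Cn) (j : 'I_n) : C :=
  (rdir f z (delta_mx ord0 j) - 'i * rdir f z ('i *: delta_mx ord0 j)) / 2.

(* M is, near q, a real algebraic generic submanifold: M is the common zero set
   of finitely many real polynomials rho_1..rho_d near q, with
   d rho_1 /\ ... /\ d rho_d <> 0 replaced by the genericity condition
   drho_1 /\ ... /\ drho_d <> 0 (the del-parts are C-linearly independent),
   at every point of M near q (Baouendi-Ebenfelt-Rothschild's definition). *)
Definition real_alg_generic_at (M : set Cn) (q : Cn) : Prop :=
  exists (d : nat) (rho : 'I_d -> Cn -> C) (U : set Cn),
    [/\ open U, U q, (forall k, realpoly (rho k)),
        M `&` U = [set z | U z /\ forall k, rho k z = 0] &
        forall z, M z -> U z ->
          \rank (\matrix_(k < d, j < n) dz (rho k) z j) = d].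

Definition real_alg_generic_submanifold (M : set Cn) : Prop :=
  forall q, M q -> real_alg_generic_at M q.

Definition tangent_vec (M : set Cn) (z v : Cn) : Prop :=
  exists (gamma : R -> Cn) (delta : R),
    [/\ 0 < delta, gamma 0 = z, (forall t, `|t| < delta -> M (gamma t)) &
        (fun t : R => rC t^-1 *: (gamma t - z)) @ 0^' --> v].

Definition holomorphic_on (U : set Cn) (F : Cn -> Cn) : Prop :=
  forall z, U z -> differentiable F z.

Definition alg_on (U : set Cn) (f : Cn -> C) : Prop :=
  exists (d : nat) (a : 'I_d.+1 -> Cn -> C),
    [/\ forall k, holpoly (a k), exists k z, a k z != 0 &
        forall z, U z -> \sum_(k < d.+1) a k z * f z ^+ k = 0].

Definition alg_map_on (U : set Cn) (F : Cn -> Cn) : Prop :=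
  forall j, alg_on U (fun z => coord (F z) j).

Definition alg_map_at (p : Cn) (F : Cn -> Cn) : Prop :=
  exists U : set Cn, [/\ open U, U p & alg_map_on U F].

Definition biholo_on (U : set Cn) (F : Cn -> Cn) : Prop :=
  [/\ open U, holomorphic_on U F,
      (forall z w, U z -> U w -> F z = F w -> z = w),
      open (F @` U) &
      exists G : Cn -> Cn, holomorphic_on (F @` U) G /\
        forall z, U z -> G (F z) = z].

(* X (holomorphic (1,0) vector field with algebraic coefficients, defined on
   the open neighbourhood U of p) is an infinitesimal CR automorphism of M:
   Re X is tangent to M at every point of M near p *)
Definition inf_CR_aut (M : set Cn) (p : Cn) (U : set Cn) (X : Cn -> Cn) :=
  [/\ open U, U p, holomorphic_on U X, alg_map_on U X &
      forall z, M z -> U z -> tangent_vec M z (X z)].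

Definition nontrivial_at (p : Cn) (X : Cn -> Cn) :=
  ~ (exists V : set Cn, [/\ open V, V p & forall z, V z -> X z = 0]).

(* the foliation by complex integral curves of X is algebraic: some
   algebraic biholomorphism Phi near p maps it to the foliation by lines
   parallel to a fixed nonzero vector v *)
Definition induces_alg_foliation (p : Cn) (X : Cn -> Cn) :=
  exists (V : set Cn) (Phi : Cn -> Cn) (v : Cn),
    [/\ V p, biholo_on V Phi, alg_map_on V Phi, v != 0 &
        forall z, V z -> exists c : C, 'd Phi z (X z) = c *: v].

Definition in_leviflat_at (M : set Cn) (p : Cn) :=
  exists V : set Cn, [/\ open V, V p &
    forall z, M z -> V z -> forall j : 'I_n, val j = n.-1 ->
      'Im (coord z j) = 0].

End CRDefs.

(* Main.v *)
(* Let Phi be the complex-time flow of X and g(s) = sum_(i >= 1) g_i s^i a power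
   series with real coefficients. The maps H_t(z) = Phi(t g(z_n - p_n), z) preserve
   M: on M the number z_n is real, so H_t moves z for a real time along Re X, which
   is tangent to M. Only the choice of g makes H_t nonalgebraic. Along a line
   p + x u one has Phi_j(tau, p + x u) = sum b_(k,i) tau^k x^i, where the terms with
   k >= 1 are divisible by x^m, m being the vanishing order of X along the line,
   and b_(1,m) <> 0 for a suitable component j. Hence the coefficient of x^(N+m) in
   H_t(p + x u)_j determines g_N from the b_(k,i), t, u_n and the g_i with i < N.
   Take the g_i algebraically independent over the countable field generated by
   the b_(k,i) and u_n for all u in a countable dense set of directions. If H_t
   were algebraic, the Taylor coefficients of H_t(p + x u)_j would lie in a
   finitely generated field, and then so would all the g_i: a contradiction. *)
Require Import Defs.
From HB Require Import structures.
From mathcomp Require Import all_boot all_order all_algebra.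
From mathcomp Require Import all_classical all_reals all_analysis.
From mathcomp.real_closed Require Import complex.
From mathcomp Require Import ring lra.
Import Order.TTheory GRing.Theory Num.Theory.
Import numFieldNormedType.Exports.
Set Implicit Arguments.
Unset Strict Implicit.
Unset Printing Implicit Defensive.
Local Open Scope ring_scope.
Local Open Scope classical_set_scope.

(** * Real-valued norms, and epsilon-delta forms of openness, continuity and differentiability *)

Section RealNorm.
Variable R : realType.
Local Notation C := (R[i]^o).

(** Tangency is known only at points of [M], through curves in [M], so that the flow keeps [M] is a
    Nagumo argument, relying on [M] being closed near [p]. The flow is a limit of Euler polygons
    because these are holomorphic jointly in the complex time and the starting point, and uniform
    limits keep this; the twisted map needs exactly that, since its time depends on z. The order of
    choices is forced: the equations of an algebraic H_t are known only after g is fixed, and they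
    may degenerate on a given line. So g has to suit a dense family of directions at once, and the
    line is selected afterwards. The family is countable so that its data generate a countable
    field; the real t, which may lie outside that field, joins the finitely many generators coming
    from the equation. All Taylor expansions derive from a Cauchy formula on a square, with explicit
    remainders; its constant, classically 2 i pi, enters only through a lower bound of its norm. *)

Definition nrm (V : normedModType R[i]) (v : V) : R := complex.Re `|v|.

Lemma realc (x : R[i]) : x \is Num.real -> x = (complex.Re x)%:C%C.
Proof.
by case: x => a b; rewrite complex_real => /eqP/= ->.
Qed.

Section Generic.
Variable V : normedModType R[i].
Implicit Types v w : V.

(** Norms over [R[i]] take values in [R[i]], although these values are real. Passing to [nrm] turns
    estimates into inequalities over [R], within reach of [lra] and [nra]. *)
Lemma nrmE v : `|v| = (nrm v)%:C%C.
Proof. by rewrite /nrm -realc // normr_real. Qed.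

Lemma nrm_ge0 v : 0 <= nrm v.
Proof. by have := normr_ge0 v; rewrite nrmE lecR. Qed.

Lemma nrmD v w : nrm (v + w) <= nrm v + nrm w.
Proof. by have := ler_normD v w; rewrite !nrmE -rmorphD /= lecR. Qed.

Lemma nrmN v : nrm (- v) = nrm v.
Proof. by rewrite /nrm normrN. Qed.

Lemma nrmC v w : nrm (v - w) = nrm (w - v).
Proof. by rewrite -nrmN opprB. Qed.

Lemma nrmB v w : nrm (v - w) <= nrm v + nrm w.
Proof. by rewrite -(nrmN w) nrmD. Qed.

Lemma nrm_tri u v w : nrm (v - w) <= nrm (v - u) + nrm (u - w).
Proof. by rewrite -(subrKA u) nrmD. Qed.

Lemma nrm0 : nrm (0 : V) = 0.
Proof. by rewrite /nrm normr0. Qed.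

Lemma nrm0_eq0 v : nrm v = 0 -> v = 0.
Proof. by move=> v0; apply/normr0_eq0; rewrite nrmE v0. Qed.

Lemma nrm_gt0 v : v != 0 -> 0 < nrm v.
Proof.
move=> v0; rewrite lt_neqAle nrm_ge0 andbT eq_sym.
by apply: contra_neq v0; exact: nrm0_eq0.
Qed.

Lemma nrm_sum (I : Type) (r : seq I) (P : pred I) (F : I -> V) :
  nrm (\sum_(i <- r | P i) F i) <= \sum_(i <- r | P i) nrm (F i).
Proof.
elim/big_rec2: _ => [|i x y _ h]; first by rewrite nrm0.
by apply: le_trans (nrmD _ _) _; rewrite lerD2l.
Qed.

Lemma eq_nrm_small v w : (forall e, 0 < e -> nrm (v - w) <= e) -> v = w.
Proof.
move=> h; apply/eqP; rewrite -subr_eq0; apply/eqP; apply: nrm0_eq0.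
apply/eqP; rewrite eq_le nrm_ge0 andbT.
by apply/ler_addgt0Pr => e /h; rewrite add0r.
Qed.

End Generic.

Lemma nrmZ (V : normedModType R[i]) (a : R[i]) (v : V) :
  nrm (a *: v) = nrm (a : C) * nrm v.
Proof.
have := normrZ a v; rewrite nrmE (nrmE v) (nrmE (a : C)) -rmorphM /=.
by move/complexI.
Qed.

Lemma nrmM (x y : C) : nrm (x * y : C) = nrm x * nrm y.
Proof. exact: nrmZ. Qed.

Lemma nrm1 : nrm (1 : C) = 1.
Proof. by rewrite /nrm normr1. Qed.

Lemma nrmX (x : C) k : nrm (x ^+ k : C) = nrm x ^+ k.
Proof. by elim: k => [|k IH]; rewrite ?expr0 ?nrm1 // !exprS nrmM IH. Qed.

Lemma nrmV (x : C) : nrm (x^-1 : C) = (nrm x)^-1.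
Proof.
have [->|x0] := eqVneq x 0; first by rewrite invr0 nrm0 invr0.
have nx := nrm_gt0 x0.
have nx0 := lt0r_neq0 nx; apply: (mulfI nx0); rewrite -nrmM.
by rewrite (divff nx0) (divff x0) nrm1.
Qed.

Lemma nrm_real (t : R) : nrm (t%:C%C : C) = `|t|.
Proof. by rewrite /nrm normc_def /= expr0n addr0 sqrtr_sqr. Qed.

Lemma nrm_c (x : C) : nrm x = Num.sqrt ((complex.Re x) ^+ 2 + (complex.Im x) ^+ 2).
Proof. by rewrite /nrm normc_def. Qed.

Lemma nrm_Re (x : C) : `|complex.Re x| <= nrm x.
Proof.
by rewrite nrm_c -sqrtr_sqr ler_wsqrtr // lerDl sqr_ge0.
Qed.

Lemma nrm_Im (x : C) : `|complex.Im x| <= nrm x.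
Proof.
by rewrite nrm_c -sqrtr_sqr ler_wsqrtr // lerDr sqr_ge0.
Qed.

Lemma nrm_i : nrm ('i%C : C) = 1.
Proof. by rewrite nrm_c /= expr0n add0r expr1n sqrtr1. Qed.

Lemma crectE (x : C) : x = (complex.Re x)%:C%C + 'i%C * (complex.Im x)%:C%C.
Proof. by rewrite {1}[x]complexE. Qed.

Lemma nrm_ReIm (x : C) : nrm x <= `|complex.Re x| + `|complex.Im x|.
Proof.
rewrite {1}[x]crectE; apply: le_trans (nrmD _ _) _.
by rewrite nrmM nrm_i mul1r !nrm_real.
Qed.

(** Rows carry the sup norm, so vector estimates reduce to scalar ones. The condition [0 <= e]
    covers the row without entries. *)
Lemma nrm_rV n (z : 'rV[C]_n) e : 0 <= e ->
  (forall j, nrm (z ord0 j : C) <= e) <-> nrm z <= e.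
Proof.
move=> e0; have e0' : (0 : R[i]) <= e%:C%C by rewrite lecR.
have -> : (nrm z <= e) = (`|z| <= (NngNum e0')%:num) by rewrite nrmE lecR.
rewrite [`|z|]mx_normE num_le; split=> [h|/bigmax_leP[_ h] j].
  apply/bigmax_leP; split=> [|[i j] _]; rewrite -num_le //=.
  by rewrite (ord1 i) (nrmE (z ord0 j : C)) lecR.
by have := h (ord0, j) isT; rewrite -num_le /= (nrmE (z ord0 j : C)) lecR.
Qed.

Lemma nrm_coord n (z : 'rV[C]_n) j : nrm (z ord0 j : C) <= nrm z.
Proof. by move: j; apply/nrm_rV => //; exact: nrm_ge0. Qed.

Section Neighborhoods.
Variable V : normedModType R[i].

Lemma posc (e : R[i]) : 0 < e -> exists2 r : R, 0 < r & e = r%:C%C.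
Proof.
move=> e0; have er : e = (complex.Re e)%:C%C by apply: realc; exact: gtr0_real.
by exists (complex.Re e) => //; move: e0; rewrite er ltcR.
Qed.

Lemma nbhs_nrmP (z : V) (A : set V) :
  nbhs z A <-> exists2 d : R, 0 < d & forall w, nrm (w - z) < d -> A w.
Proof.
split=> [/nbhs_ballP[e /posc[d d0 ->]] h|[d d0 h]].
  exists d => // w wz; apply: h.
  by rewrite -ball_normE /ball_ /= distrC nrmE ltcR.
apply/nbhs_ballP; exists (d%:C%C) => /=; first by rewrite ltcR.
move=> w; rewrite -ball_normE /ball_ /= distrC nrmE ltcR; exact: h.
Qed.

Lemma open_nrmP (U : set V) :
  open U <-> forall z, U z -> exists2 d : R, 0 < d & forall w, nrm (w - z) < d -> U w.
Proof.
rewrite openE; split=> h z Uz; first by apply/nbhs_nrmP; exact: h.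
by apply/nbhs_nrmP; exact: h.
Qed.

Lemma open_nrm_ball (z : V) r : open [set w | nrm (w - z) < r].
Proof.
apply/open_nrmP => w /= wr; exists (r - nrm (w - z)); first by lra.
by move=> u uw; have := nrm_tri w u z; lra.
Qed.

End Neighborhoods.

Section EpsDelta.
Variables V W : normedModType R[i].

Lemma nrm_continuousP (F : V -> W) z :
  {for z, continuous F} <->
  forall e : R, 0 < e -> exists2 d : R, 0 < d &
    forall w, nrm (w - z) < d -> nrm (F w - F z) < e.
Proof.
split=> [h e e0|h].
  have /h : nbhs (F z) [set y | nrm (y - F z) < e] by apply/nbhs_nrmP; exists e.
  by move/nbhs_nrmP.
move=> A /nbhs_nrmP[e e0 eA]; have [d d0 dh] := h e e0.
by apply/nbhs_nrmP; exists d => // w /dh /eA.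
Qed.

(** Continuity of the differential is encoded as an operator bound [A], so that a candidate [L] can
    be tested by real inequalities; uniqueness of the differential gives the converse direction. *)
Lemma differentiable_nrmP (F : V -> W) z :
  differentiable F z <->
  exists L : {linear V -> W}, [/\ exists A, forall w, nrm (L w) <= A * nrm w &
    forall e : R, 0 < e -> exists2 d : R, 0 < d & forall w, nrm w < d ->
      nrm (F (z + w) - F z - L w) <= e * nrm w].
Proof.
split.
  move=> /diff_locallyP [dc dF]; exists ('d F z); split.
    have /linear_boundedP [M [Mr h]] := (linear_bounded_continuous ('d F z)).2 (fun=> dc _).
    have [A [A0 AM]] : exists A : R, 0 < A /\ M < A%:C%C.
      exists (`|complex.Re M| + 1); split; first by rewrite ltr_wpDl.
      rewrite {1}(realc Mr) ltcR; have := ler_norm (complex.Re M); lra.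
    exists A => w; have := h _ AM w.
    by rewrite !nrmE -rmorphM /= lecR.
  move=> e e0; have : (0 : R[i]) < e%:C%C by rewrite ltcR.
  move/eqaddoP: dF => /[apply] /nbhs_nrmP[d d0 h]; exists d => // w wd.
  have := h w; rewrite subr0 => /(_ wd); rewrite /= !nrmE -rmorphM /= lecR.
  by rewrite !fctE /= opprD addrA [w + z]addrC.
move=> [L [[A LA] h]].
have Lc : continuous L.
  apply/linear_bounded_continuous/linear_boundedP; exists (`|A|)%:C%C; split.
    by rewrite complex_real.
  move=> B AB w; rewrite !nrmE.
  have Br : B = (complex.Re B)%:C%C.
    by apply/realc/gtr0_real; apply: le_lt_trans AB; rewrite lecR.
  move: AB; rewrite Br ltcR -rmorphM /= lecR => AB.
  apply: le_trans (LA w) _; apply: ler_wpM2r; first exact: nrm_ge0.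
  by have := ler_norm A; lra.
have dF : F \o shift z = cst (F z) + L +o_ 0 id.
  apply/eqaddoP => _ /posc[e e0 ->]; have [d d0 dh] := h e e0.
  apply/nbhs_nrmP; exists d => // w; rewrite subr0 => /dh.
  by rewrite /= !nrmE -rmorphM /= lecR !fctE /= opprD addrA [w + z]addrC.
by have := diff_unique Lc dF => dL; apply/diff_locallyP; rewrite dL.
Qed.

End EpsDelta.
End RealNorm.

(** * Integrals of continuous real functions on subintervals of [-1, 1] *)

Section Primitives.
Variable R : realType.
Implicit Types f g : R -> R.

(* All integrals are taken inside [-1, 1]; the base point -3 leaves room for
   two-sided derivatives on ]-2, 2[. *)
Lemma prim_ex f : exists F : R -> R,
  continuous f -> forall x : R, -2 < x < 2 -> is_derive x 1 F (f x).
Proof.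
exists (fun x => \int[lebesgue_measure]_(t in `[-3, x]) f t) => cf x /andP[x1 x2].
have fi : lebesgue_measure.-integrable `[(-3 : R), 3] (EFin \o f).
  apply: continuous_compact_integrable; first exact: segment_compact.
  by apply: continuous_subspaceT => y; exact: cf.
have [||h1 h2] := @continuous_FTC1_closed R f (-3) x 3 _ fi _ (cf x); try by lra.
by apply: (DeriveDef h1); rewrite -derive1E.
Qed.

(** Since continuity is a premise inside the existence statement, a primitive can be chosen for
    every [f]; it is meaningful for continuous [f] and on ]-2, 2[ only. *)
Definition prim f : R -> R := sval (cid (prim_ex f)).

Definition int f (a b : R) : R := prim f b - prim f a.

Lemma prim_derive f (x : R) : continuous f -> -2 < x < 2 -> is_derive x 1 (prim f) (f x).
Proof. by move=> cf x2; exact: (svalP (cid (prim_ex f)) cf x x2). Qed.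

(** Mean value inequality. With [K] = 0 it shows that two primitives differ by a constant, hence
    that an integral may be evaluated with any primitive. *)
Lemma derive_bound (F df : R -> R) (a b K : R) : a <= b ->
  (forall x : R, a <= x <= b -> is_derive x 1 F (df x)) ->
  (forall x : R, a <= x <= b -> `|df x| <= K) -> `|F b - F a| <= K * (b - a).
Proof.
move=> ab dF dK.
have [||c /[!in_itv]/= cab ->] := @MVT_segment R F df a b ab.
- by move=> x /[!in_itv]/= /andP[h1 h2]; apply: dF; rewrite !ltW.
- apply: derivable_within_continuous => x /[!in_itv]/= /dF h.
  exact: ex_derive.
- by rewrite normrM [`|b - a|]ger0_norm ?subr_ge0 // ler_wpM2r ?subr_ge0 ?dK.
Qed.

Lemma prim_int f (F : R -> R) (a b : R) : continuous f ->
  (forall x : R, -2 < x < 2 -> is_derive x 1 F (f x)) ->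
  -1 <= a -> a <= b -> b <= 1 -> int f a b = F b - F a.
Proof.
move=> cf dF a1 ab b1; apply/eqP; rewrite -subr_eq0 -normr_le0.
have := @derive_bound (prim f - F) (fun=> 0) a b 0 ab.
rewrite mul0r /int !fctE.
have -> : prim f b - F b - (prim f a - F a) = prim f b - prim f a - (F b - F a).
  by ring.
apply=> x /andP[xa xb]; last by rewrite normr0.
rewrite -(subrr (f x)).
by apply: is_deriveB; [apply: prim_derive|apply: dF] => //; apply/andP; split; lra.
Qed.

Lemma int_lin (k l : R) f g (a b : R) : continuous f -> continuous g ->
  -1 <= a -> a <= b -> b <= 1 ->
  int (fun x => k * f x + l * g x) a b = k * int f a b + l * int g a b.
Proof.
move=> cf cg a1 ab b1.
have -> : k * int f a b + l * int g a b =
   (k *: prim f + l *: prim g) b - (k *: prim f + l *: prim g) a.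
  by rewrite /int !fctE /GRing.scale /=; ring.
have dF (x : R) : -2 < x < 2 ->
    is_derive x 1 (k *: prim f + l *: prim g) (k *: f x + l *: g x).
  by move=> hx; apply: is_deriveD; apply: is_deriveZ; apply: prim_derive.
have c (x : R) : {for x, continuous (fun x => k * f x + l * g x)}.
  by apply: cvgD; apply: cvgM; try exact: cvg_cst; [exact: cf|exact: cg].
exact: (prim_int c dF a1 ab b1).
Qed.

Lemma int_bound f (a b K : R) : continuous f -> -1 <= a -> a <= b -> b <= 1 ->
  (forall x : R, a <= x <= b -> `|f x| <= K) -> `|int f a b| <= K * (b - a).
Proof.
move=> cf a1 ab b1 fK; apply: (derive_bound ab) fK => x /andP[xa xb].
by apply: prim_derive => //; apply/andP; split; lra.
Qed.

Lemma is_derive_eps f (x d : R) :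
  (forall e : R, 0 < e -> exists2 r : R, 0 < r & forall h : R, `|h| < r ->
     `|f (x + h) - f x - h * d| <= e * `|h|) -> is_derive x 1 f d.
Proof.
move=> H.
have L : (fun h : R => h^-1 *: ((f \o shift x) (h *: 1) - f x)) @ 0^' --> d.
  apply/cvgrPdist_le => e e0; have [r r0 rh] := H e e0.
  near=> h; rewrite /= -normrN opprB.
  have h0 : h != 0 by near: h; exact: nbhs_dnbhs_neq.
  have hr : `|h| < r.
    by near: h; apply: dnbhs0_lt.
  have := rh h hr; rewrite [h *: 1]mulr1 [h + x]addrC.
  have -> : h^-1 *: (f (x + h) - f x) - d = h^-1 * (f (x + h) - f x - h * d).
    by rewrite mulrBr mulrA mulVf // mul1r.
  move=> hh; rewrite normrM normfV mulrC ler_pdivrMr ?normr_gt0 //.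
by apply: DeriveDef; [apply/cvg_ex; exists d|apply/cvg_lim].
Unshelve. all: by end_near. Qed.

End Primitives.

(** * Integrals of complex-valued functions of a real variable *)

Section ComplexIntegral.
Variable R : realType.
Local Notation C := (R[i]^o).
Implicit Types (p q : R -> C).

Definition ccont p := continuous (fun x => complex.Re (p x)) /\ continuous (fun x => complex.Im (p x)).

Definition cint p (a b : R) : C :=
  (int (fun x => complex.Re (p x)) a b +i* int (fun x => complex.Im (p x)) a b)%C.

Lemma ReD (x y : C) : complex.Re (x + y : C) = complex.Re x + complex.Re y.
Proof. by case: x y => [? ?] [? ?]. Qed.
Lemma ImD (x y : C) : complex.Im (x + y : C) = complex.Im x + complex.Im y.
Proof. by case: x y => [? ?] [? ?]. Qed.
Lemma ReN (x : C) : complex.Re (- x : C) = - complex.Re x.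
Proof. by case: x. Qed.
Lemma ImN (x : C) : complex.Im (- x : C) = - complex.Im x.
Proof. by case: x. Qed.
Lemma ReM (x y : C) : complex.Re (x * y : C) =
  complex.Re x * complex.Re y - complex.Im x * complex.Im y.
Proof. by case: x y => [? ?] [? ?]. Qed.
Lemma ImM (x y : C) : complex.Im (x * y : C) =
  complex.Re x * complex.Im y + complex.Im x * complex.Re y.
Proof. by case: x y => [? ?] [? ?]. Qed.
Lemma complex_ext (x y : C) : complex.Re x = complex.Re y ->
  complex.Im x = complex.Im y -> x = y.
Proof. by case: x y => [? ?] [? ?] /= -> ->. Qed.

Lemma ccontP p : (forall x e : R, 0 < e -> exists2 r : R, 0 < r & forall y : R,
   `|y - x| < r -> nrm (p y - p x) < e) -> ccont p.
Proof.
move=> h; split=> x; apply/cvgrPdist_lt => e e0; have [r r0 rh] := h x e e0;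
  near=> y; rewrite distrC /=.
  rewrite -ReN -ReD; apply: le_lt_trans (nrm_Re _) _; apply: rh.
  by near: y; apply: cvgr_distC_lt.
rewrite -ImN -ImD; apply: le_lt_trans (nrm_Im _) _; apply: rh.
by near: y; apply: cvgr_distC_lt.
Unshelve. all: by end_near. Qed.

Lemma cint_lin (k l : C) p q (a b : R) : ccont p -> ccont q ->
  -1 <= a -> a <= b -> b <= 1 ->
  cint (fun x => k * p x + l * q x) a b = k * cint p a b + l * cint q a b.
Proof.
move=> [p1 p2] [q1 q2] a1 ab b1.
have cM (c : R) (f : R -> R) : continuous f -> continuous (fun x => c * f x).
  by move=> cf x; apply: cvgM; [exact: cvg_cst|exact: cf].
have cL (c d : R) (f g : R -> R) : continuous f -> continuous g ->
    continuous (fun x => c * f x + d * g x).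
  by move=> cf cg x; apply: cvgD; [exact: (cM c f cf x)|exact: (cM d g cg x)].
have E1 : (fun x => complex.Re (k * p x + l * q x)) = fun x =>
   1 * (complex.Re k * complex.Re (p x) + (- complex.Im k) * complex.Im (p x)) +
   1 * (complex.Re l * complex.Re (q x) + (- complex.Im l) * complex.Im (q x)).
  by apply/funext => x /=; rewrite ReD !ReM; ring.
have E2 : (fun x => complex.Im (k * p x + l * q x)) = fun x =>
   1 * (complex.Re k * complex.Im (p x) + (complex.Im k) * complex.Re (p x)) +
   1 * (complex.Re l * complex.Im (q x) + (complex.Im l) * complex.Re (q x)).
  by apply/funext => x /=; rewrite ImD !ImM; ring.
apply: complex_ext.
  rewrite ReD !ReM /cint E1 /=.
  rewrite [LHS](@int_lin R 1 1) //; try exact: cL.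
  by rewrite !(@int_lin R) //; ring.
rewrite ImD !ImM /cint E2 /=.
rewrite [LHS](@int_lin R 1 1) //; try exact: cL.
by rewrite !(@int_lin R) //; ring.
Qed.

(** The factor 2 is the price of bounding the real and imaginary parts separately. *)
Lemma cint_bound p (a b K : R) : ccont p -> -1 <= a -> a <= b -> b <= 1 ->
  (forall x : R, a <= x <= b -> nrm (p x) <= K) -> nrm (cint p a b) <= 2 * K * (b - a).
Proof.
move=> [p1 p2] a1 ab b1 pK; apply: le_trans (nrm_ReIm _) _ => /=.
have h1 := @int_bound R _ a b K p1 a1 ab b1 (fun x h => le_trans (nrm_Re _) (pK x h)).
have h2 := @int_bound R _ a b K p2 a1 ab b1 (fun x h => le_trans (nrm_Im _) (pK x h)).
by lra.
Qed.

Lemma cint_prim p (P : R -> C) (a b : R) : ccont p ->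
  (forall x e : R, -2 < x < 2 -> 0 < e -> exists2 r : R, 0 < r & forall h : R, `|h| < r ->
     nrm (P (x + h) - P x - h%:C%C * p x) <= e * `|h|) ->
  -1 <= a -> a <= b -> b <= 1 -> cint p a b = P b - P a.
Proof.
move=> [p1 p2] dP a1 ab b1; apply: complex_ext.
  rewrite ReD ReN /=; apply: (@prim_int R _ (fun x => complex.Re (P x))) => //.
  move=> x x2; apply: is_derive_eps => e e0; have [r r0 rh] := dP x e x2 e0.
  exists r => // h /rh; apply: le_trans; apply: le_trans (nrm_Re _).
  by rewrite !ReD !ReN ReM /= mul0r subr0.
rewrite ImD ImN /=; apply: (@prim_int R _ (fun x => complex.Im (P x))) => //.
move=> x x2; apply: is_derive_eps => e e0; have [r r0 rh] := dP x e x2 e0.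
exists r => // h /rh; apply: le_trans; apply: le_trans (nrm_Im _).
by rewrite !ImD !ImN ImM /= mul0r addr0.
Qed.

Lemma cint_split p a b c : cint p a b = cint p a c + cint p c b.
Proof. by apply: complex_ext; rewrite ?ReD ?ImD /= /int; ring. Qed.

End ComplexIntegral.

(** * Integrals around rectangles and Goursat's theorem *)

Section Goursat.
Variable R : realType.
Local Notation C := (R[i]^o).
Implicit Types (f g : C -> C).

Lemma itv_dist (a b x y : R) : a <= x -> x <= b -> a <= y -> y <= b -> `|x - y| <= b - a.
Proof. by move=> *; rewrite ler_norml; apply/andP; split; lra. Qed.

Lemma sum4_contra (N A B a b c d : R) : N <= A + B -> A <= a + b -> B <= c + d ->
  4 * a < N -> 4 * b < N -> 4 * c < N -> 4 * d < N -> False.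
Proof. by lra. Qed.

Lemma sum4_bound (A B a b c d k : R) : A <= a + b -> B <= c + d ->
  a <= 2 * k * 2 -> b <= 2 * k * 2 -> c <= 2 * k * 2 -> d <= 2 * k * 2 -> A + B <= 16 * k.
Proof. by lra. Qed.

Definition pt (x y : R) : C := (x +i* y)%C.

Lemma nrm_pt (x y x' y' : R) : nrm (pt x y - pt x' y') <= `|x - x'| + `|y - y'|.
Proof. exact: nrm_ReIm. Qed.

Definition hline f (y : R) : R -> C := fun x => f (pt x y).
Definition vline f (x : R) : R -> C := fun y => f (pt x y).

(** The integral of f(z) dz counterclockwise around the rectangle [a, b] x [c, d]: bottom minus top,
    plus 'i times right minus left. *)
Definition box f (a b c d : R) : C :=
  cint (hline f c) a b - cint (hline f d) a b +
  'i%C * (cint (vline f b) c d - cint (vline f a) c d).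

Definition in_unit (a b c d : R) := [/\ -1 <= a, a <= b, b <= 1, -1 <= c & c <= d /\ d <= 1].

Definition in_box (a b c d : R) (z : C) :=
  a <= complex.Re z <= b /\ c <= complex.Im z <= d.

Definition edges_cont f (a b c d : R) :=
  [/\ ccont (hline f c), ccont (hline f d), ccont (vline f a) & ccont (vline f b)].

Lemma cont_ccont_h f y : continuous f -> ccont (hline f y).
Proof.
move=> cf; apply: ccontP => x e e0.
have [r r0 rh] := (nrm_continuousP f (pt x y)).1 (cf _) e e0.
exists r => // x' xx'; apply: rh; apply: le_lt_trans (nrm_pt _ _ _ _) _.
by rewrite subrr normr0 addr0.
Qed.

Lemma cont_ccont_v f x : continuous f -> ccont (vline f x).
Proof.
move=> cf; apply: ccontP => y e e0.
have [r r0 rh] := (nrm_continuousP f (pt x y)).1 (cf _) e e0.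
exists r => // y' yy'; apply: rh; apply: le_lt_trans (nrm_pt _ _ _ _) _.
by rewrite subrr normr0 add0r.
Qed.

Lemma cont_edges f a b c d : continuous f -> edges_cont f a b c d.
Proof.
by move=> cf; split; [exact: cont_ccont_h| exact: cont_ccont_h|
  exact: cont_ccont_v|exact: cont_ccont_v].
Qed.

Lemma box_splitx f a b c d e : box f a b c d = box f a e c d + box f e b c d.
Proof.
rewrite /box (cint_split (hline f c) a b e) (cint_split (hline f d) a b e).
by ring.
Qed.

Lemma box_splity f a b c d e : box f a b c d = box f a b c e + box f a b e d.
Proof.
rewrite /box (cint_split (vline f a) c d e) (cint_split (vline f b) c d e).
by ring.
Qed.

Lemma box_lin (k l : C) f g a b c d : in_unit a b c d ->
  edges_cont f a b c d -> edges_cont g a b c d ->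
  box (fun z => k * f z + l * g z) a b c d = k * box f a b c d + l * box g a b c d.
Proof.
move=> [a1 ab b1 c1 [cd d1]] [f1 f2 f3 f4] [g1 g2 g3 g4]; rewrite /box.
have H y : hline (fun z => k * f z + l * g z) y =
  fun x => k * hline f y x + l * hline g y x by [].
have V x : vline (fun z => k * f z + l * g z) x =
  fun y => k * vline f x y + l * vline g x y by [].
by rewrite !H !V !cint_lin //; ring.
Qed.

Lemma box_bound f a b c d K : in_unit a b c d -> edges_cont f a b c d ->
  (forall z, in_box a b c d z -> nrm (f z) <= K) ->
  nrm (box f a b c d) <= 4 * K * ((b - a) + (d - c)).
Proof.
move=> [a1 ab b1 c1 [cd d1]] [f1 f2 f3 f4] fK; rewrite /box.
apply: le_trans (nrmD _ _) _.
rewrite nrmM nrm_i mul1r.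
have h1 : nrm (cint (hline f c) a b) <= 2 * K * (b - a).
  by apply: cint_bound => // x xab; apply: fK; split => //=; rewrite lexx.
have h2 : nrm (cint (hline f d) a b) <= 2 * K * (b - a).
  by apply: cint_bound => // x xab; apply: fK; split => //=; rewrite lexx andbT.
have h3 : nrm (cint (vline f a) c d) <= 2 * K * (d - c).
  by apply: cint_bound => // x xab; apply: fK; split => //=; rewrite lexx.
have h4 : nrm (cint (vline f b) c d) <= 2 * K * (d - c).
  by apply: cint_bound => // x xab; apply: fK; split => //=; rewrite lexx andbT.
have := nrmB (cint (hline f c) a b) (cint (hline f d) a b).
have := nrmB (cint (vline f b) c d) (cint (vline f a) c d).
by lra.
Qed.

Lemma cont_affine (u v : C) : continuous (fun z : C => u + v * z : C).
Proof.
move=> z; apply/nrm_continuousP => e e0.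
exists (e / (nrm v + 1)); first by rewrite divr_gt0 // ltr_wpDl ?nrm_ge0.
move=> w; rewrite ltr_pdivlMr ?ltr_wpDl ?nrm_ge0 // => h.
have -> : u + v * w - (u + v * z) = v * (w - z) by ring.
rewrite nrmM; apply: le_lt_trans h; rewrite mulrC ler_wpM2l ?nrm_ge0 //.
by rewrite lerDl.
Qed.

(** Each edge is integrated with an explicit quadratic antiderivative in its real parameter, and the
    four contributions cancel. *)
Lemma box_affine (u v : C) a b c d : in_unit a b c d ->
  box (fun z => u + v * z) a b c d = 0.
Proof.
move=> [a1 ab b1 c1 [cd d1]]; rewrite /box.
have H y : cint (hline (fun z => u + v * z) y) a b =
   (u + v * ('i%C * y%:C%C)) * (b%:C%C - a%:C%C) + v * (b ^+ 2 / 2 - a ^+ 2 / 2)%:C%C.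
  rewrite (@cint_prim R _ (fun x => (u + v * ('i%C * y%:C%C)) * x%:C%C + v * (x ^+ 2 / 2)%:C%C)) //.
  - by rewrite rmorphB /=; ring.
  - exact/cont_ccont_h/cont_affine.
  move=> x e _ e0; exists (e / (nrm v + 1)) => [|h].
    by rewrite divr_gt0 // ltr_wpDl ?nrm_ge0.
  rewrite ltr_pdivlMr ?ltr_wpDl ?nrm_ge0 // => hr.
  have -> : (u + v * ('i%C * y%:C%C)) * (x + h)%:C%C + v * ((x + h) ^+ 2 / 2)%:C%C -
       ((u + v * ('i%C * y%:C%C)) * x%:C%C + v * (x ^+ 2 / 2)%:C%C) -
       h%:C%C * hline (fun z => u + v * z) y x = v * (h ^+ 2 / 2)%:C%C.
    rewrite /hline /pt; have -> : (x +i* y)%C = x%:C%C + 'i%C * y%:C%C :> C.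
      exact: crectE.
    have -> : ((x + h) ^+ 2 / 2) = x ^+ 2 / 2 + h ^+ 2 / 2 + x * h by field.
    by rewrite !rmorphD !rmorphM /=; ring.
  rewrite nrmM nrm_real normrM normrX [`|2^-1|]ger0_norm //.
  have := nrm_ge0 v; have := normr_ge0 h; move: hr; set n := nrm v; set m := `|h|.
  by nra.
have V x : cint (vline (fun z => u + v * z) x) c d =
   (u + v * x%:C%C) * (d%:C%C - c%:C%C) + v * 'i%C * (d ^+ 2 / 2 - c ^+ 2 / 2)%:C%C.
  rewrite (@cint_prim R _ (fun y => (u + v * x%:C%C) * y%:C%C + v * 'i%C * (y ^+ 2 / 2)%:C%C)) //.
  - by rewrite rmorphB /=; ring.
  - exact/cont_ccont_v/cont_affine.
  move=> y e _ e0; exists (e / (nrm v + 1)) => [|h].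
    by rewrite divr_gt0 // ltr_wpDl ?nrm_ge0.
  rewrite ltr_pdivlMr ?ltr_wpDl ?nrm_ge0 // => hr.
  have -> : (u + v * x%:C%C) * (y + h)%:C%C + v * 'i%C * ((y + h) ^+ 2 / 2)%:C%C -
       ((u + v * x%:C%C) * y%:C%C + v * 'i%C * (y ^+ 2 / 2)%:C%C) -
       h%:C%C * vline (fun z => u + v * z) x y = v * 'i%C * (h ^+ 2 / 2)%:C%C.
    rewrite /vline /pt; have -> : (x +i* y)%C = x%:C%C + 'i%C * y%:C%C :> C.
      exact: crectE.
    have -> : ((y + h) ^+ 2 / 2) = y ^+ 2 / 2 + h ^+ 2 / 2 + y * h by field.
    by rewrite !rmorphD !rmorphM /=; ring.
  rewrite !nrmM nrm_i mulr1 nrm_real normrM normrX [`|2^-1|]ger0_norm //.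
  have := nrm_ge0 v; have := normr_ge0 h; move: hr; set n := nrm v; set m := `|h|.
  by nra.
rewrite !H !V.
by ring.
Qed.

Lemma cont_sub f g : continuous f -> continuous g -> continuous (fun z => f z - g z : C).
Proof.
move=> cf cg z; apply/nrm_continuousP => e e0.
have e2 : 0 < e / 2 by lra.
have [r r0 rh] := (nrm_continuousP f z).1 (cf z) _ e2.
have [s s0 sh] := (nrm_continuousP g z).1 (cg z) _ e2.
exists (Num.min r s) => [|w]; first by rewrite lt_min r0.
rewrite lt_min => /andP[/rh h1 /sh h2].
have -> : f w - g w - (f z - g z) = f w - f z - (g w - g z) by ring.
by have := nrmB (f w - f z) (g w - g z); lra.
Qed.

(** Differentiability relative to the closed box: only points of the box are tested. A function
    extended continuously outside the box by a retraction thus qualifies up to the boundary. *)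
Definition diff_in_box f (a b c d : R) (z : C) :=
  exists L : C, forall e : R, 0 < e -> exists2 r : R, 0 < r & forall w : C,
    in_box a b c d w -> nrm (w - z) < r ->
    nrm (f w - f z - L * (w - z)) <= e * nrm (w - z).

Definition rect := (R * R * R * R)%type.
Definition rbox f (r : rect) := box f r.1.1.1 r.1.1.2 r.1.2 r.2.
Definition quarter (r : rect) (h v : bool) : rect :=
  let: (a, b, c, d) := r in
  let m := (a + b) / 2 in let n := (c + d) / 2 in
  (if h then m else a, if h then b else m, if v then n else c, if v then d else n).

Lemma quarterP f r : exists h v, nrm (rbox f r) <= 4 * nrm (rbox f (quarter r h v)).
Proof.
move: r => [[[a b] c] d]; apply: contrapT => H.
have {}H h v : 4 * nrm (rbox f (quarter (a, b, c, d) h v)) < nrm (rbox f (a, b, c, d)).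
  by rewrite ltNge; apply/negP => K; apply: H; exists h, v.
have := H false false; have := H false true; have := H true false; have := H true true.
rewrite /rbox /=; set m := (a + b) / 2; set n := (c + d) / 2.
move=> h1 h2 h3 h4.
have E : box f a b c d = (box f a m c n + box f a m n d) + (box f m b c n + box f m b n d).
  by rewrite (box_splitx f a b c d m) (box_splity f a m c d n) (box_splity f m b c d n).
have e1 := nrmD (box f a m c n + box f a m n d) (box f m b c n + box f m b n d).
have e2 := nrmD (box f a m c n) (box f a m n d).
have e3 := nrmD (box f m b c n) (box f m b n d).
by rewrite -E in e1; exact: (sum4_contra e1 e2 e3 h4 h3 h2 h1).
Qed.

(** Bisection: always keeping a quarter that carries at least a fourth of the integral, the boxes
    shrink to a point. There [f] is affine up to a small error, and the affine part has integral
    zero. *)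
Theorem goursat f a b c d : in_unit a b c d -> continuous f ->
  (forall z, in_box a b c d z -> diff_in_box f a b c d z) -> box f a b c d = 0.
Proof.
move=> iu cf df; apply: nrm0_eq0; apply/eqP; rewrite eq_le nrm_ge0 andbT leNgt.
apply/negP => eta0; set eta := nrm _ in eta0.
have [nx nxP] : exists nx : rect -> rect, forall r, exists h v,
    nx r = quarter r h v /\ nrm (rbox f r) <= 4 * nrm (rbox f (nx r)).
  have : forall r, exists q, exists h v, q = quarter r h v /\
      nrm (rbox f r) <= 4 * nrm (rbox f q).
    by move=> r; have [h [v H]] := quarterP f r; exists (quarter r h v), h, v.
  by move/choice => -[nx H]; exists nx.
pose s := fix s n := if n is n'.+1 then nx (s n') else (a, b, c, d).
pose A n := (s n).1.1.1; pose B n := (s n).1.1.2; pose Cc n := (s n).1.2; pose D n := (s n).2.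
have sS n : exists h v, [/\ s n.+1 = quarter (s n) h v &
    nrm (rbox f (s n)) <= 4 * nrm (rbox f (s n.+1))].
  by have [h [v [H1 H2]]] := nxP (s n); exists h, v.
have wid n : [/\ B n - A n = (b - a) / 2 ^+ n & D n - Cc n = (d - c) / 2 ^+ n].
  elim: n => [|n [I1 I2]]; first by rewrite expr0 !divr1.
  have [h [v [E _]]] := sS n; rewrite /A /B /Cc /D E.
  move: I1 I2; rewrite /A /B /Cc /D; case: (s n) => [[[x1 x2] x3] x4] /= I1 I2.
  have -> : (b - a) / 2 ^+ n.+1 = (x2 - x1) / 2 by rewrite I1 exprS invfM; ring.
  have -> : (d - c) / 2 ^+ n.+1 = (x4 - x3) / 2 by rewrite I2 exprS invfM; ring.
  by clear E; split; [case: h|case: v]; field.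
have [a1 ab b1 c1 [cd d1]] := iu.
have ABn n : A n <= B n.
  rewrite -subr_ge0; have [-> _] := wid n; rewrite divr_ge0 ?exprn_ge0 //; lra.
have CDn n : Cc n <= D n.
  rewrite -subr_ge0; have [_ ->] := wid n; rewrite divr_ge0 ?exprn_ge0 //; lra.
have mono n : [/\ A n <= A n.+1, B n.+1 <= B n, Cc n <= Cc n.+1 & D n.+1 <= D n].
  have [h [v [E _]]] := sS n; have := ABn n; have := CDn n.
  rewrite /A /B /Cc /D E; case: (s n) => [[[x1 x2] x3] x4] /= I1 I2.
  by clear E; split; first [by case: h; lra|by case: v; lra].
have mono2 m n : (m <= n)%N ->
    [/\ A m <= A n, B n <= B m, Cc m <= Cc n & D n <= D m].
  elim: n => [|n IH]; first by rewrite leqn0 => /eqP->.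
  rewrite leq_eqVlt => /orP[/eqP->//|/IH[i1 i2 i3 i4]].
  have [j1 j2 j3 j4] := mono n.
  by split; [exact: le_trans i1 j1|exact: le_trans j2 i2|exact: le_trans i3 j3|exact: le_trans j4 i4].
have AB m n : A m <= B n.
  have [i1 i2 _ _] := mono2 m (maxn m n) (leq_maxl _ _).
  have [j1 j2 _ _] := mono2 n (maxn m n) (leq_maxr _ _).
  by have := ABn (maxn m n); lra.
have CD m n : Cc m <= D n.
  have [_ _ i1 i2] := mono2 m (maxn m n) (leq_maxl _ _).
  have [_ _ j1 j2] := mono2 n (maxn m n) (leq_maxr _ _).
  by have := CDn (maxn m n); lra.
have nested (P Q : nat -> R) : (forall m n, P m <= Q n) ->
    exists x, forall n, P n <= x <= Q n.
  move=> PQ; exists (sup (range P)) => n; apply/andP; split.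
    by apply: ub_le_sup; [exists (Q 0%N) => _ [m _ <-]|exists n].
  by apply: ge_sup; [exists (P 0%N), 0%N|move=> _ [m _ <-]].
have [x xP] := nested _ _ AB; have [y yP] := nested _ _ CD.
have inb n z : in_box (A n) (B n) (Cc n) (D n) z -> in_box a b c d z.
  have [i1 i2 i3 i4] := mono2 0%N n (leq0n n).
  move=> [/andP[h1 h2] /andP[h3 h4]]; split; apply/andP; split.
  - exact: le_trans i1 h1.
  - exact: le_trans h2 i2.
  - exact: le_trans i3 h3.
  - exact: le_trans h4 i4.
have zin n : in_box (A n) (B n) (Cc n) (D n) (pt x y).
  by split; [exact: xP|exact: yP].
have [L dL] := df (pt x y) (inb 0%N _ (zin 0%N)).
pose S := (b - a) + (d - c).
have S0 : 0 <= S by rewrite /S; lra.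
(* The n-th box carries an integral of norm at least eta / 4^n, whereas the affine approximation
   bounds it by 4 e S^2 / 4^n; this [e] makes 4 e S^2 < eta. The summand 8 avoids a division by zero
   for a degenerate box. *)
pose e := eta / (8 * S ^+ 2 + 8).
have e0 : 0 < e by rewrite divr_gt0 // ltr_wpDl // mulr_ge0 ?sqr_ge0.
have [r r0 rh] := dL e e0.
have [n nr] : exists n, S / 2 ^+ n < r.
  have [n _ /(_ n (leqnn n))] : \forall n \near \oo, S / 2 ^+ n < r.
    have : (fun n => geometric S (2^-1 : R) n) @ \oo --> (0 : R).
      by apply: cvg_geometric; rewrite ger0_norm ?invr_ge0 // invf_lt1 //; lra.
    move/cvgr_lt => /(_ r r0); apply: filterS => n.
    by rewrite /geometric /= exprVn.
  by exists n.
have big k : eta / 4 ^+ k <= nrm (rbox f (s k)).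
  elim: k => [|k IH]; first by rewrite expr0 divr1.
  have [h [v [_ H]]] := sS k.
  rewrite exprS invfM mulrCA [_ * (_ / _)]mulrC ler_pdivrMr //; lra.
have iun : in_unit (A n) (B n) (Cc n) (D n).
  have [i1 i2 i3 i4] := mono2 0%N n (leq0n n); split.
  - exact: le_trans a1 i1.
  - exact: ABn.
  - exact: le_trans i2 b1.
  - exact: le_trans c1 i3.
  - by split; [exact: CDn|exact: le_trans i4 d1].
pose aff := fun z : C => (f (pt x y) - L * pt x y) + L * z : C.
have caff : continuous aff by exact: cont_affine.
have Ee : box (fun z => f z - aff z) (A n) (B n) (Cc n) (D n) = rbox f (s n).
  have -> : (fun z => f z - aff z) = (fun z => 1 * f z + (-1) * aff z).
    by apply/funext => z; rewrite mul1r mulN1r.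
  rewrite (box_lin 1 (-1) iun (cont_edges _ _ _ _ cf) (cont_edges _ _ _ _ caff)).
  by rewrite /aff box_affine // mulr0 addr0 mul1r.
have cfa := cont_sub cf caff.
have := @box_bound _ _ _ _ _ (e * (S / 2 ^+ n)) iun (cont_edges _ _ _ _ cfa).
rewrite Ee; have [-> ->] := wid n.
have -> : (b - a) / 2 ^+ n + (d - c) / 2 ^+ n = S / 2 ^+ n by rewrite -mulrDl.
move=> H.
have {}H : nrm (rbox f (s n)) <= 4 * (e * (S / 2 ^+ n)) * (S / 2 ^+ n).
  apply: H => z zi.
  have zd : nrm (z - pt x y) <= S / 2 ^+ n.
    have -> : z = pt (complex.Re z) (complex.Im z) by case: (z).
    apply: le_trans (nrm_pt _ _ _ _) _.
    have [w1 w2] := wid n; rewrite /S [leRHS]mulrDl -w1 -w2.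
    case: zi => /andP[p1 p2] /andP[p3 p4]; have /andP[q1 q2] := xP n; have /andP[q3 q4] := yP n.
    by apply: lerD; exact: itv_dist.
  have -> : f z - aff z = f z - f (pt x y) - L * (z - pt x y) by rewrite /aff; ring.
  apply: le_trans (rh z (inb n z zi) (le_lt_trans zd nr)) _.
  by rewrite ler_wpM2l // ltW.
have := le_trans (big n) H.
have -> : 4 * (e * (S / 2 ^+ n)) * (S / 2 ^+ n) = 4 * e * S ^+ 2 / 4 ^+ n.
  have -> : (4 : R) = 2 ^+ 2 by rewrite -natrX.
  rewrite -exprM mulnC exprM expr2 invfM; ring.
rewrite ler_pM2r ?invr_gt0 ?exprn_gt0 //.
have : e * (8 * S ^+ 2 + 8) = eta.
  by rewrite /e divfK // lt0r_neq0 // ltr_wpDl // mulr_ge0 ?sqr_ge0.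
have : 0 <= e * S ^+ 2 by rewrite mulr_ge0 ?sqr_ge0 ?ltW.
by move=> i1 i2 i3; lra.
Qed.

End Goursat.

(** * Derivatives of functions of one complex variable *)

Section ComplexDerivative.
Variable R : realType.
Local Notation C := (R[i]^o).
Implicit Types (f g : C -> C) (z : C).

Definition cderiv f z (L : C) :=
  forall e : R, 0 < e -> exists2 r : R, 0 < r & forall w : C, nrm (w - z) < r ->
    nrm (f w - f z - L * (w - z)) <= e * nrm (w - z).

Lemma differentiable_cderiv f z : differentiable f z -> exists L, cderiv f z L.
Proof.
move=> /differentiable_nrmP[L [_ h]]; exists (L 1) => e /h[r r0 rh].
exists r => // w /rh; rewrite [z + _]addrC subrK.
have -> // : L (w - z) = L 1 * (w - z) :> C.
by rewrite -[w - z in LHS]mulr1 -[_ * 1]/(_ *: (1 : C)) linearZ mulrC.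
Qed.

(** Bundles a bare function with its linearity, since the characterisation of differentiability asks
    for a bundled linear map. *)
Lemma linear_ex (V W : normedModType R[i]) (l : V -> W) : linear l ->
  exists L : {linear V -> W}, forall w, L w = l w.
Proof.
move=> lin; pose m := GRing.isLinear.Build _ _ _ _ l lin.
by pose L : {linear _ -> _} := HB.pack l m; exists L.
Qed.

Lemma cderiv_cont f z L : cderiv f z L -> forall e : R, 0 < e ->
  exists2 r : R, 0 < r & forall w : C, nrm (w - z) < r -> nrm (f w - f z) < e.
Proof.
move=> h e e0; have [r r0 rh] := h 1 ltr01.
have n0 : 0 < nrm L + 2 by rewrite ltr_wpDl ?nrm_ge0.
exists (Num.min r (e / (nrm L + 2))) => [|w]; first by rewrite lt_min r0 divr_gt0.
rewrite lt_min => /andP[/rh h1]; rewrite ltr_pdivlMr // => h2.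
have := nrmD (f w - f z - L * (w - z)) (L * (w - z)); rewrite subrK nrmM.
by have := nrm_ge0 (w - z); lra.
Qed.

Lemma cderivM f g z (L M : C) : cderiv f z L -> cderiv g z M ->
  cderiv (fun w => f w * g w : C) z (L * g z + f z * M).
Proof.
move=> df dg e e0.
pose B := nrm L + nrm (g z) + nrm (f z) + 1.
have B0 : 1 <= B by rewrite /B; have := nrm_ge0 L; have := nrm_ge0 (g z);
  have := nrm_ge0 (f z); lra.
pose e' := Num.min (e / (4 * B)) 1.
have e'0 : 0 < e' by rewrite lt_min ltr01 andbT divr_gt0 //; lra.
have [r r0 rh] := df e' e'0; have [s s0 sh] := dg e' e'0.
have [t t0 th] := cderiv_cont dg e'0.
exists (Num.min r (Num.min s t)) => [|w]; first by rewrite !lt_min r0 s0.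
rewrite !lt_min => /and3P[/rh h1 /sh h2 /th h3].
have -> : f w * g w - f z * g z - (L * g z + f z * M) * (w - z) =
  (f w - f z - L * (w - z)) * (g w - g z) + (f w - f z - L * (w - z)) * g z +
  (L * (w - z)) * (g w - g z) + f z * (g w - g z - M * (w - z)) by ring.
apply: le_trans (nrmD _ _) _.
have := nrmD ((f w - f z - L * (w - z)) * (g w - g z) + (f w - f z - L * (w - z)) * g z)
  ((L * (w - z)) * (g w - g z)).
have := nrmD ((f w - f z - L * (w - z)) * (g w - g z)) ((f w - f z - L * (w - z)) * g z).
rewrite !nrmM => i1 i2.
have e1 : e' <= 1 by rewrite ge_min lexx orbT.
have e2 : e' * (4 * B) <= e.
  by rewrite -ler_pdivlMr ?ge_min ?lexx //; lra.
have d0 := nrm_ge0 (w - z); set d := nrm (w - z) in h1 h2 i1 i2 d0 *.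
set a := nrm (f w - _ - _) in h1 i1 i2 *; set b := nrm (g w - g z) in h3 i1 i2 *.
set c := nrm (g w - _ - _) in h2 *.
have a0 : 0 <= a := nrm_ge0 _. have b0 : 0 <= b := nrm_ge0 _.
have j1 : a * b <= e' * d.
  by apply: le_trans (_ : a * 1 <= _); [apply: ler_wpM2l => //; lra|lra].
have j2 : a * nrm (g z) <= e' * d * B.
  apply: ler_pM => //; rewrite ?nrm_ge0 // /B.
  by have := nrm_ge0 L; have := nrm_ge0 (f z); lra.
have j3 : nrm L * d * b <= B * d * e'.
  apply: ler_pM => //; rewrite ?mulr_ge0 ?nrm_ge0 // ?(ltW h3) //.
  apply: ler_wpM2r => //; rewrite /B.
  by have := nrm_ge0 (g z); have := nrm_ge0 (f z); lra.
have j4 : nrm (f z) * c <= B * (e' * d).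
  apply: ler_pM => //; rewrite ?nrm_ge0 // /B.
  by have := nrm_ge0 (g z); have := nrm_ge0 L; lra.
have j5 : e' * d <= B * (e' * d).
  by rewrite ler_peMl // mulr_ge0 // ltW.
have : e' * (4 * B) * d <= e * d by apply: ler_wpM2r.
by lra.
Qed.

Lemma cderiv_inv (a z : C) : z != a -> cderiv (fun w => (w - a)^-1 : C) z (- (z - a) ^- 2).
Proof.
move=> za e e0; set u := z - a.
have u0 : u != 0 by rewrite subr_eq0.
have nu := nrm_gt0 u0.
exists (Num.min (nrm u / 2) (e * nrm u ^+ 3 / 2)) => [|w].
  by rewrite lt_min; apply/andP; split; rewrite divr_gt0 ?mulr_gt0 ?exprn_gt0.
rewrite lt_min => /andP[h1 h2]; set h := w - z in h1 h2 *.
have E : w - a = u + h by rewrite /u /h; ring.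
have nuh : nrm u / 2 <= nrm (u + h).
  by have := nrmB (u + h) h; rewrite addrK; lra.
have uh0 : u + h != 0.
  by apply: contraPneq nuh => ->; rewrite nrm0; apply/negP; rewrite -ltNge divr_gt0.
rewrite E.
have -> : (u + h)^-1 - u^-1 - - u ^- 2 * h = h ^+ 2 * (u ^- 2 * (u + h)^-1).
  by field; rewrite uh0 u0.
rewrite nrmM nrmX nrmM !nrmV nrmX.
set x := nrm u in nu h1 h2 nuh *; set y := nrm (u + h) in nuh *; set d := nrm h in h1 h2 *.
have d0 : 0 <= d := nrm_ge0 _.
have y0 : 0 < y by apply: lt_le_trans nuh; rewrite divr_gt0.
rewrite expr2 -mulrA [e * d]mulrC ler_wpM2l //.
rewrite -invfM ler_pdivrMr ?mulr_gt0 ?exprn_gt0 //.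
apply: le_trans (ltW h2) _; rewrite -[e * x ^+ 3 / 2]mulrA -mulrA ler_wpM2l ?(ltW e0) //.
by have := ler_wpM2l (sqr_ge0 x) nuh; lra.
Qed.

End ComplexDerivative.

(** * The Cauchy kernel on the boundary of the square [-1, 1] x [-1, 1] *)

Section UnitSquare.
Variable R : realType.
Local Notation C := (R[i]^o).
Implicit Types (f g : C -> C) (z : C) (p q : R -> C).

Definition ubox f := box f (-1) 1 (-1) 1.
Definition econt f := edges_cont f (-1) 1 (-1) 1.
Definition edge z := in_box (-1) 1 (-1) 1 z /\
  (`|complex.Re z| = 1 \/ `|complex.Im z| = 1).

Lemma unit_in_unit : in_unit (-1 : R) 1 (-1) 1.
Proof. by split; [lra|lra|lra|lra|split; lra]. Qed.

Lemma ubox_lin (k l : C) f g : econt f -> econt g ->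
  ubox (fun z => k * f z + l * g z) = k * ubox f + l * ubox g.
Proof. exact: box_lin unit_in_unit. Qed.

(** In contrast with [box_bound], only boundary values are tested, because the Cauchy kernel is
    singular inside. The constant 16 is four edges of length 2, times the factor 2 of
    [cint_bound]. *)
Lemma ubox_bound f K : econt f -> (forall z, edge z -> nrm (f z) <= K) ->
  nrm (ubox f) <= 16 * K.
Proof.
move=> [f1 f2 f3 f4] fK; rewrite /ubox /box.
apply: le_trans (nrmD _ _) _; rewrite nrmM nrm_i mul1r.
have bnd p : ccont p -> (forall x : R, -1 <= x <= 1 -> nrm (p x) <= K) ->
    nrm (cint p (-1) 1) <= 2 * K * 2.
  move=> cp pK; have : (1 : R) - -1 = 2 by ring.
  by move=> {2}<-; apply: cint_bound => //; lra.
have h1 : nrm (cint (hline f (-1)) (-1) 1) <= 2 * K * 2.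
  apply: bnd => // x x1; apply: fK; split; last by right; rewrite /= normrN normr1.
  by split => //=; apply/andP; split; lra.
have h2 : nrm (cint (hline f 1) (-1) 1) <= 2 * K * 2.
  apply: bnd => // x x1; apply: fK; split; last by right; rewrite /= normr1.
  by split => //=; apply/andP; split; lra.
have h3 : nrm (cint (vline f (-1)) (-1) 1) <= 2 * K * 2.
  apply: bnd => // x x1; apply: fK; split; last by left; rewrite /= normrN normr1.
  by split => //=; apply/andP; split; lra.
have h4 : nrm (cint (vline f 1) (-1) 1) <= 2 * K * 2.
  apply: bnd => // x x1; apply: fK; split; last by left; rewrite /= normr1.
  by split => //=; apply/andP; split; lra.
exact: (sum4_bound (nrmB _ _) (nrmB _ _) h1 h2 h4 h3).
Qed.

Lemma ubox_ext f g : econt f -> econt g -> (forall z, edge z -> f z = g z) ->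
  ubox f = ubox g.
Proof.
move=> cf cg fg; apply/eqP; rewrite -subr_eq0.
have -> : ubox f - ubox g = 1 * ubox f + (-1) * ubox g by rewrite mul1r mulN1r.
rewrite -ubox_lin //; apply/eqP/nrm0_eq0/eqP; rewrite eq_le nrm_ge0 andbT.
have cE p q : ccont p -> ccont q -> ccont (fun x => 1 * p x + (-1) * q x).
  move=> [p1 p2] [q1 q2]; split => x.
    have -> : (fun x => complex.Re (1 * p x + -1 * q x)) =
      (fun x => complex.Re (p x) - complex.Re (q x)).
      by apply/funext => y; rewrite mul1r mulN1r ReD ReN.
    by apply: cvgB; [exact: p1|exact: q1].
  have -> : (fun x => complex.Im (1 * p x + -1 * q x)) =
      (fun x => complex.Im (p x) - complex.Im (q x)).
    by apply/funext => y; rewrite mul1r mulN1r ImD ImN.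
  by apply: cvgB; [exact: p2|exact: q2].
have [f1 f2 f3 f4] := cf; have [g1 g2 g3 g4] := cg.
have e : econt (fun z => 1 * f z + -1 * g z).
  by split; [exact: cE f1 g1|exact: cE f2 g2|exact: cE f3 g3|exact: cE f4 g4].
rewrite -[leRHS](mulr0 16); apply: ubox_bound e _ => z /fg ->.
by rewrite mul1r mulN1r subrr nrm0.
Qed.

Lemma ccontM p q : ccont p -> ccont q -> ccont (fun x => p x * q x : C).
Proof.
move=> [p1 p2] [q1 q2]; split => x.
  have -> : (fun x => complex.Re (p x * q x)) =
    (fun x => complex.Re (p x) * complex.Re (q x) - complex.Im (p x) * complex.Im (q x)).
    by apply/funext => y; rewrite ReM.
  by apply: cvgB; apply: cvgM; [exact: p1|exact: q1|exact: p2|exact: q2].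
have -> : (fun x => complex.Im (p x * q x)) =
  (fun x => complex.Re (p x) * complex.Im (q x) + complex.Im (p x) * complex.Re (q x)).
  by apply/funext => y; rewrite ImM.
by apply: cvgD; apply: cvgM; [exact: p1|exact: q2|exact: p2|exact: q1].
Qed.

Lemma ccontD p q : ccont p -> ccont q -> ccont (fun x => p x + q x : C).
Proof.
move=> [p1 p2] [q1 q2]; split => x.
  have -> : (fun x => complex.Re (p x + q x)) = (fun x => complex.Re (p x) + complex.Re (q x)).
    by apply/funext => y; rewrite ReD.
  by apply: cvgD; [exact: p1|exact: q1].
have -> : (fun x => complex.Im (p x + q x)) = (fun x => complex.Im (p x) + complex.Im (q x)).
  by apply/funext => y; rewrite ImD.
by apply: cvgD; [exact: p2|exact: q2].
Qed.

Lemma ccont_cst (k : C) : ccont (fun=> k).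
Proof. by split=> x; exact: cvg_cst. Qed.

Lemma econtM f g : econt f -> econt g -> econt (fun z => f z * g z : C).
Proof.
by move=> [f1 f2 f3 f4] [g1 g2 g3 g4]; split;
 [exact: ccontM f1 g1|exact: ccontM f2 g2|exact: ccontM f3 g3|exact: ccontM f4 g4].
Qed.

Lemma econtD f g : econt f -> econt g -> econt (fun z => f z + g z : C).
Proof.
by move=> [f1 f2 f3 f4] [g1 g2 g3 g4]; split;
 [exact: ccontD f1 g1|exact: ccontD f2 g2|exact: ccontD f3 g3|exact: ccontD f4 g4].
Qed.

Lemma econt_cst (k : C) : econt (fun=> k).
Proof. by split; exact: ccont_cst. Qed.

(** The Cauchy kernel with pole [a]. *)
Definition kap (a : C) : C -> C := fun z => (z - a)^-1.

Lemma pt_h (x h y : R) : pt (x + h) y = pt x y + h%:C%C.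
Proof. by apply: complex_ext; rewrite ?ReD ?ImD /= ?addr0. Qed.

Lemma pt_v (x h y : R) : pt x (y + h) = pt x y + 'i%C * h%:C%C.
Proof. by apply: complex_ext; rewrite ?ReD ?ImD ?ReM ?ImM /=; ring. Qed.

Lemma hline_far (a : C) (x y : R) : nrm a <= 1/2 -> `|y| = 1 -> 1/2 <= nrm (pt x y - a).
Proof.
move=> a2 y1; apply: le_trans (nrm_Im _); rewrite ImD ImN /=.
have := le_trans (nrm_Im a) a2; have := lerB_dist y (complex.Im a); rewrite y1; lra.
Qed.

Lemma vline_far (a : C) (x y : R) : nrm a <= 1/2 -> `|x| = 1 -> 1/2 <= nrm (pt x y - a).
Proof.
move=> a2 y1; apply: le_trans (nrm_Re _); rewrite ReD ReN /=.
have := le_trans (nrm_Re a) a2; have := lerB_dist x (complex.Re a); rewrite y1; lra.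
Qed.

Lemma edge_far (a z : C) : nrm a <= 1/2 -> edge z -> 1/2 <= nrm (z - a).
Proof.
move=> a2 [_]; have -> : z = pt (complex.Re z) (complex.Im z) by case: (z).
by move=> /= [h|h]; [exact: vline_far|exact: hline_far].
Qed.

Lemma far_neq0 (u : C) : 1/2 <= nrm u -> u != 0.
Proof. by apply: contraTneq => ->; rewrite nrm0 -ltNge; lra. Qed.

Lemma far_inv (u : C) : 1/2 <= nrm u -> nrm (u^-1 : C) <= 2.
Proof.
move=> u2; rewrite nrmV -[2]invrK lef_pV2 ?posrE ?invr_gt0 //; first lra.
by apply: lt_le_trans u2; lra.
Qed.

Lemma ccont_kap (l : R -> C) : (forall x y, nrm (l x - l y) <= `|x - y|) ->
  (forall x, 1/2 <= nrm (l x)) -> ccont (fun x => (l x)^-1 : C).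
Proof.
move=> lip far; apply: ccontP => x e e0; exists (e / 4) => [|y yx]; first lra.
have lx := far_neq0 (far x); have ly := far_neq0 (far y).
have -> : (l y)^-1 - (l x)^-1 = (l x - l y) * ((l x)^-1 * (l y)^-1) :> C.
  by field; rewrite lx ly.
rewrite !nrmM -nrmN opprB; have h1 := far_inv (far x); have h2 := far_inv (far y).
apply: (@le_lt_trans _ _ (nrm (l y - l x) * (2 * 2))).
  by apply: ler_wpM2l; [exact: nrm_ge0|apply: ler_pM => //; exact: nrm_ge0].
by have := lip y x; lra.
Qed.

Lemma econt_kap (a : C) : nrm a <= 1/2 -> econt (kap a).
Proof.
move=> a2.
have H (x x' y : R) : nrm (pt x y - a - (pt x' y - a)) <= `|x - x'|.
  have -> : pt x y - a - (pt x' y - a) = (x - x')%:C%C.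
    by apply: complex_ext; rewrite ?ReD ?ImD ?ReN ?ImN ?ReD ?ImD ?ReN ?ImN /=; ring.
  by rewrite nrm_real.
have V (x y y' : R) : nrm (pt x y - a - (pt x y' - a)) <= `|y - y'|.
  have -> : pt x y - a - (pt x y' - a) = 'i%C * (y - y')%:C%C.
    by apply: complex_ext; rewrite ?ReD ?ImD ?ReN ?ImN ?ReM ?ImM ?ReD ?ImD ?ReN ?ImN /=; ring.
  by rewrite nrmM nrm_i mul1r nrm_real.
split; apply: ccont_kap => *; (try exact: H); (try exact: V);
  try (by apply: (hline_far _ a2); rewrite ?normrN normr1);
  by apply: (vline_far _ a2); rewrite ?normrN normr1.
Qed.

(** The squared kernel has the primitive -1 / (z - a) along the boundary, which stays at distance at
    least 1/2 from the pole; the values at the corners cancel. *)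
Lemma ubox_kap2 (a : C) : nrm a <= 1/2 -> ubox (fun z => kap a z * kap a z) = 0.
Proof.
move=> a2.
have [k1 k2 k3 k4] := econtM (econt_kap a2) (econt_kap a2).
have alg (u h : C) : 1/2 <= nrm u -> 1/2 <= nrm (u + h) ->
    nrm (h ^+ 2 * (u^-1 * u^-1 * (u + h)^-1)) <= 8 * nrm h ^+ 2.
  move=> /far_inv u1 /far_inv u2.
  rewrite nrmM nrmX mulrC ler_wpM2r ?exprn_ge0 ?nrm_ge0 // !nrmM.
  have -> : (8 : R) = 2 * 2 * 2 by ring.
  by rewrite !ler_pM ?mulr_ge0 ?nrm_ge0.
have fin (e h X : R) : 0 < e -> `|h| < e / 8 -> X <= 8 * `|h| ^+ 2 -> X <= e * `|h|.
  by move=> e0 h8 XX; have := normr_ge0 h; nra.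
have H (y : R) : `|y| = 1 -> ccont (hline (fun z => kap a z * kap a z) y) ->
    cint (hline (fun z => kap a z * kap a z) y) (-1) 1 =
    - kap a (pt 1 y) + kap a (pt (-1) y).
  move=> y1 cc.
  rewrite (@cint_prim R _ (fun x => - kap a (pt x y))) ?opprK //; try lra.
  move=> x e _ e0; exists (e / 8) => [|h h8]; first lra.
  apply: (fin _ _ _ e0 h8).
  have u1 := hline_far x a2 y1; have u2 := hline_far (x + h) a2 y1.
  rewrite /hline /kap pt_h; rewrite pt_h in u2; set u := pt x y - a in u1 *.
  have E : pt x y + h%:C%C - a = u + h%:C%C by rewrite /u; ring.
  rewrite !E in u2 *.
  have n1 := far_neq0 u1; have n2 := far_neq0 u2.
  have -> : - (u + h%:C%C)^-1 - - u^-1 - h%:C%C * (u^-1 / u) =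
    - ((h%:C%C : C) ^+ 2 * (u^-1 * u^-1 * (u + h%:C%C)^-1)) by field; rewrite n1 n2.
  rewrite nrmN; apply: le_trans (alg _ _ u1 u2) _.
  by rewrite nrm_real.
have V (x : R) : `|x| = 1 -> ccont (vline (fun z => kap a z * kap a z) x) ->
    cint (vline (fun z => kap a z * kap a z) x) (-1) 1 =
    'i%C * kap a (pt x 1) - 'i%C * kap a (pt x (-1)).
  move=> y1 cc.
  rewrite (@cint_prim R _ (fun y => 'i%C * kap a (pt x y))) //; try lra.
  move=> y e _ e0; exists (e / 8) => [|h h8]; first lra.
  apply: (fin _ _ _ e0 h8).
  have u1 := vline_far y a2 y1; have u2 := vline_far (y + h) a2 y1.
  rewrite /vline /kap pt_v; rewrite pt_v in u2; set u := pt x y - a in u1 *.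
  set ih := 'i%C * h%:C%C in u2 *.
  have E : pt x y + ih - a = u + ih by rewrite /u; ring.
  rewrite !E in u2 *.
  have n1 := far_neq0 u1; have n2 := far_neq0 u2.
  have hE : h%:C%C = - 'i%C * ih :> C.
    by rewrite /ih mulrA mulNr -expr2 sqr_i opprK mul1r.
  have -> : 'i%C * (u + ih)^-1 - 'i%C * u^-1 - h%:C%C * (u^-1 / u) =
    'i%C * (ih ^+ 2 * (u^-1 * u^-1 * (u + ih)^-1)) by rewrite hE; field; rewrite n1 n2.
  rewrite nrmM nrm_i mul1r; apply: le_trans (alg _ _ u1 u2) _.
  by rewrite /ih nrmM nrm_i mul1r nrm_real.
rewrite /ubox /box !H ?V ?normrN ?normr1 //.
set A := kap a _; set B := kap a _; set D := kap a _; set E := kap a _.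
have ii : 'i%C * 'i%C = -1 :> R[i] by rewrite -expr2 sqr_i.
have -> : 'i%C * ('i%C * D - 'i%C * A - ('i%C * E - 'i%C * B)) =
   ('i%C * 'i%C) * (D - A - (E - B)) by ring.
by rewrite ii; ring.
Qed.

(** The derivative in the pole is the integral of the squared kernel, which is zero. Concretely, kap
    (b + h) = kap b + h (kap b)^2 + h^2 (kap b)^2 kap (b + h), so a move by h changes the integral
    by at most 128 |h|^2; going from 0 to [a] in N + 1 equal moves costs at most 128 / (N + 1). *)
Lemma ubox_kap_const (a : C) : nrm a <= 1/2 -> ubox (kap a) = ubox (kap 0).
Proof.
move=> a2.
have step (b h : C) : nrm b <= 1/2 -> nrm (b + h) <= 1/2 ->
    nrm (ubox (kap (b + h)) - ubox (kap b)) <= 128 * nrm h ^+ 2.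
  move=> b2 bh2.
  have c1 := econt_kap b2; have c2 := econt_kap bh2.
  have c3 := econtM c1 c1; have c4 := econtM c3 c2.
  have c5 := econtM (econt_cst h) c3; have c6 := econtM (econt_cst (h ^+ 2)) c4.
  have E : ubox (kap (b + h)) = 1 * ubox (kap b) + 1 * ubox (fun z =>
      h * (kap b z * kap b z) + h ^+ 2 * (kap b z * kap b z * kap (b + h) z)).
    rewrite -ubox_lin //; last exact: econtD.
    apply: ubox_ext => //.
      exact: (econtD (econtM (econt_cst 1) c1) (econtM (econt_cst 1) (econtD c5 c6))).
    move=> z ez; have n1 := far_neq0 (edge_far b2 ez).
    have n2 := far_neq0 (edge_far bh2 ez); rewrite /kap.
    by field; rewrite n1 n2.
  rewrite E !mul1r addrC addKr ubox_lin // ubox_kap2 // mulr0 add0r nrmM nrmX.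
  rewrite mulrC ler_wpM2r ?exprn_ge0 ?nrm_ge0 //.
  have -> : (128 : R) = 16 * (2 * 2 * 2) by ring.
  apply: ubox_bound => // z ez; rewrite !nrmM /kap.
  have := far_inv (edge_far b2 ez); have := far_inv (edge_far bh2 ez) => h1 h2.
  by rewrite !ler_pM ?mulr_ge0 ?nrm_ge0.
apply: eq_nrm_small => e e0.
have [N NP] : exists N : nat, 128 <= e * N.+1%:R.
  exists (Num.truncn (128 / e)); rewrite mulrC -ler_pdivrMr //.
  by apply/ltW/truncnS_gt.
pose b (j : nat) : C := (j%:R / N.+1%:R)%:C%C * a.
have nb (j : nat) : (j <= N.+1)%N -> nrm (b j) <= 1/2.
  move=> jN; rewrite /b nrmM nrm_real ger0_norm ?divr_ge0 //.
  have : j%:R / N.+1%:R <= 1 :> R by rewrite ler_pdivrMr ?ltr0n // mul1r ler_nat.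
  by move=> X1; apply: le_trans (ler_piMl (nrm_ge0 a) X1) a2.
have tel (j : nat) : (j <= N.+1)%N ->
    nrm (ubox (kap (b j)) - ubox (kap 0)) <= j%:R * (128 * (N.+1%:R^-1) ^+ 2).
  elim: j => [|j IH] jN; first by rewrite /b mul0r mul0r subrr nrm0 mul0r.
  apply: le_trans (nrm_tri (ubox (kap (b j))) _ _) _.
  have bS : b j.+1 = b j + (N.+1%:R^-1)%:C%C * a.
    by rewrite /b -mulrDl -rmorphD /= -[j.+1]addn1 natrD mulrDl mul1r.
  have := step (b j) ((N.+1%:R^-1)%:C%C * a) (nb _ (ltnW jN)); rewrite -bS => /(_ (nb _ jN)).
  have := IH (ltnW jN); rewrite -[j.+1]addn1 natrD.
  rewrite nrmM nrm_real exprMn real_normK ?num_real //.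
  have : nrm a ^+ 2 <= 1 by rewrite expr_le1 ?nrm_ge0 //; lra.
  have : 0 <= N.+1%:R^-1 ^+ 2 :> R by rewrite sqr_ge0.
  set X := _^-1 ^+ 2; set Y := nrm a ^+ 2 => X0 Y1 h1 h2.
  have : X * Y <= X by rewrite -[leRHS]mulr1 ler_wpM2l.
  by lra.
have := tel N.+1 (leqnn _); rewrite /b divff ?pnatr_eq0 // mul1r => /le_trans; apply.
by rewrite expr2 mulrCA !mulrA mulfK ?pnatr_eq0 // ler_pdivrMr ?ltr0n.
Qed.

(** Adding the four edges turns the integrand into 4 'i / (1 + x^2), which stays within 1 of 3 'i.
    Hence the integral is within 4 of 6 'i, so its norm is at least 2. *)
Lemma ubox_kap0 : 2 <= nrm (ubox (kap (0 : C))).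
Proof.
have n0 : nrm (0 : C) <= 1/2 by rewrite nrm0; lra.
have [k1 k2 k3 k4] := econt_kap n0.
have m1 : (-1 : R) <= 1 by lra.
pose p : R -> C := fun x => 1 * (1 * hline (kap 0) (-1) x + (-1) * hline (kap 0) 1 x) +
  'i%C * (1 * vline (kap 0) 1 x + (-1) * vline (kap 0) (-1) x).
have cS q q' : ccont q -> ccont q' -> ccont (fun x => 1 * q x + (-1) * q' x).
  by move=> cq cq'; apply: ccontD; apply: ccontM => //; exact: ccont_cst.
have cp : ccont p.
  exact: (ccontD (ccontM (ccont_cst 1) (cS _ _ k1 k2)) (ccontM (ccont_cst _) (cS _ _ k4 k3))).
have E : ubox (kap 0) = cint p (-1) 1.
  rewrite /p (cint_lin _ _ (cS _ _ k1 k2) (cS _ _ k4 k3) (lexx _) m1 (lexx _)).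
  rewrite (cint_lin _ _ k1 k2 (lexx _) m1 (lexx _)).
  by rewrite (cint_lin _ _ k4 k3 (lexx _) m1 (lexx _)) /ubox /box; ring.
have pE (x : R) : p x = 'i%C * (4 / (1 + x ^+ 2))%:C%C.
  have x0 : 0 < 1 + x ^+ 2 by rewrite ltr_wpDr ?sqr_ge0.
  have inv1 (s u v : R) : s = 1 + x ^+ 2 -> u ^+ 2 + v ^+ 2 = s ->
      kap 0 (pt u v) = pt (u / s) (- v / s).
    move=> sE uv; rewrite /kap subr0; apply: (@mulfI _ (pt u v)).
      by apply/negP => /eqP [u0 v0]; move: uv; rewrite u0 v0; lra.
    rewrite divff; last by apply/negP => /eqP [u0 v0]; move: uv; rewrite u0 v0; lra.
    have s0 : s != 0 by rewrite sE lt0r_neq0.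
    apply: complex_ext; rewrite ?ReM ?ImM /=; last by field.
    by rewrite -(divff s0) -[X in X / _]uv; field.
  rewrite /p /hline /vline !(inv1 (1 + x ^+ 2)) //; try ring.
  apply: complex_ext; rewrite !(ReD, ImD, ReM, ImM) /=; field; exact: lt0r_neq0.
have B : nrm (cint (fun x => 1 * p x + (-1) * (3 * 'i%C)) (-1) 1) <= 2 * 1 * (1 - -1).
  apply: (cint_bound _ (lexx _) m1 (lexx _)).
    exact: (ccontD (ccontM (ccont_cst 1) cp) (ccontM (ccont_cst _) (ccont_cst _))).
  move=> x /andP[x1 x2]; rewrite pE.
  have -> : 1 * ('i%C * (4 / (1 + x ^+ 2))%:C%C) + -1 * (3 * 'i%C) =
     'i%C * (4 / (1 + x ^+ 2) - 3)%:C%C :> C.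
    by rewrite rmorphB /= rmorph_nat; ring.
  rewrite nrmM nrm_i mul1r nrm_real.
  have xx : x ^+ 2 <= 1 by nra.
  have x0 : 0 < 1 + x ^+ 2 by rewrite ltr_wpDr ?sqr_ge0.
  rewrite ler_norml; apply/andP; split.
    suff : 2 <= 4 / (1 + x ^+ 2) by lra.
    by rewrite ler_pdivlMr //; lra.
  suff : 4 / (1 + x ^+ 2) <= 4 by lra.
  by rewrite ler_pdivrMr //; have := sqr_ge0 x; lra.
move: B; rewrite (cint_lin _ _ cp (ccont_cst _) (lexx _) m1 (lexx _)).
rewrite -E (@cint_prim R (fun=> 3 * 'i%C) (fun x => x%:C%C * (3 * 'i%C)) _ _ _ _ (lexx _) m1 (lexx _)); first last.
- move=> x e _ e0; exists 1 => // h _; rewrite rmorphD /=.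
  have -> : (x%:C%C + h%:C%C) * (3 * 'i%C) - x%:C%C * (3 * 'i%C) - h%:C%C * (3 * 'i%C) = 0 :> C.
    by ring.
  by rewrite nrm0 mulr_ge0 // ltW.
- exact: ccont_cst.
rewrite rmorphN rmorph1.
have -> : 1 * ubox (kap 0) + -1 * (1 * (3 * 'i%C) - -1 * (3 * 'i%C)) = ubox (kap 0) - 6 * 'i%C by ring.
have := nrm_tri (ubox (kap 0)) (6 * 'i%C) 0; rewrite !subr0 [nrm (_ - ubox _)]nrmC nrmM nrm_i mulr1.
have -> : nrm (6 : C) = 6 by have := nrm_real (6 : R); rewrite rmorph_nat => ->; rewrite ger0_norm.
by lra.
Qed.

End UnitSquare.

(** * Cauchy formula and Taylor expansion with remainder *)

Section CauchyTaylor.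
Variable R : realType.
Local Notation C := (R[i]^o).
Implicit Types (f g : C -> C) (z : C).
Local Notation sq := (in_box (-1 : R) 1 (-1) 1).

Definition clamp1 (x : R) : R := Num.max (-1) (Num.min x 1).
(** Retraction of the plane onto the unit square. The integrals are stated for functions continuous
    everywhere, whereas [f] is controlled on the disc of radius 2 only, which contains the
    square. *)
Definition clamp z : C := pt (clamp1 (complex.Re z)) (clamp1 (complex.Im z)).

Lemma clamp1_itv x : -1 <= clamp1 x <= 1.
Proof. by rewrite /clamp1 le_max lexx /= ge_max ge_min lexx orbT andbT; lra. Qed.

Lemma clamp1_id x : -1 <= x <= 1 -> clamp1 x = x.
Proof. by move=> /andP[h1 h2]; rewrite /clamp1 min_l // max_r. Qed.

Lemma clamp1_lip x y : `|clamp1 x - clamp1 y| <= `|x - y|.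
Proof.
wlog xy : x y / x <= y => [H|].
  by case: (leP x y) => [|/ltW] /H //; rewrite distrC [`|y - x|]distrC.
have mn (k u v : R) : u <= v -> 0 <= Num.min v k - Num.min u k <= v - u.
  by move=> uv; case: (leP v k) => ?; case: (leP u k) => ?; lra.
have mx (k u v : R) : u <= v -> 0 <= Num.max k v - Num.max k u <= v - u.
  by move=> uv; case: (leP k v) => ?; case: (leP k u) => ?; lra.
have /andP[h1 h2] := mn 1 x y xy.
have /andP[h3 h4] := mx (-1) (Num.min x 1) (Num.min y 1) ltac:(lra).
by rewrite distrC [`|x - y|]distrC /clamp1 !ger0_norm; lra.
Qed.

Lemma clamp_sq z : sq (clamp z).
Proof. by split; exact: clamp1_itv. Qed.

Lemma clamp_id z : sq z -> clamp z = z.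
Proof. by case: z => x y [/= h1 h2]; rewrite /clamp /= !clamp1_id. Qed.

Lemma clamp_lip w z : nrm (clamp w - clamp z) <= 2 * nrm (w - z).
Proof.
apply: le_trans (nrm_pt _ _ _ _) _.
have h1 := clamp1_lip (complex.Re w) (complex.Re z).
have h2 := clamp1_lip (complex.Im w) (complex.Im z).
have := nrm_Re (w - z); have := nrm_Im (w - z); rewrite ReD ImD ReN ImN; lra.
Qed.

Lemma sq_lt2 z : sq z -> nrm z < 2.
Proof.
move=> [/andP[x1 x2] /andP[y1 y2]]; have n0 := nrm_ge0 z.
have : nrm z ^+ 2 = complex.Re z ^+ 2 + complex.Im z ^+ 2.
  by rewrite nrm_c sqr_sqrtr // addr_ge0 ?sqr_ge0.
by nra.
Qed.

Lemma clamp_cont g : (forall z, nrm z < 2 -> forall e : R, 0 < e ->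
    exists2 r : R, 0 < r & forall w, nrm (w - z) < r -> nrm (g w - g z) < e) ->
  continuous (fun z => g (clamp z)).
Proof.
move=> h z; apply/nrm_continuousP => e e0.
have [r r0 rh] := h (clamp z) (sq_lt2 (clamp_sq z)) e e0.
exists (r / 2) => [|w wr]; first by lra.
by apply: rh; have := clamp_lip w z; lra.
Qed.

Lemma diff_in_boxS g a b c d a' b' c' d' z :
  a <= a' -> b' <= b -> c <= c' -> d' <= d ->
  diff_in_box g a b c d z -> diff_in_box g a' b' c' d' z.
Proof.
move=> h1 h2 h3 h4 [L dL]; exists L => e /dL[r r0 rh]; exists r => // w.
move=> [/andP[i1 i2] /andP[i3 i4]]; apply: rh.
by split; apply/andP; split; lra.
Qed.

(** The function is merely continuous at the exceptional point [a]. The square is cut into five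
    rectangles: Goursat's theorem kills the four that avoid [a], and the small one around [a]
    contributes at most a multiple of its size. *)
Lemma goursat_pt g (a : C) : continuous g -> nrm a <= 1/2 ->
  (forall z, sq z -> z != a -> diff_in_box g (-1) 1 (-1) 1 z) -> ubox g = 0.
Proof.
move=> cg a2 dg.
have [ax ay] : `|complex.Re a| <= 1/2 /\ `|complex.Im a| <= 1/2.
  by split; [exact: le_trans (nrm_Re _) a2|exact: le_trans (nrm_Im _) a2].
move: ax ay; rewrite !ler_norml => /andP[x1 x2] /andP[y1 y2].
set x := complex.Re a in x1 x2 *; set y := complex.Im a in y1 y2 *.
have [r r0 rh] := (nrm_continuousP g a).1 (cg a) 1 ltr01.
pose K := nrm (g a) + 1; have K0 : 0 < K by rewrite /K; have := nrm_ge0 (g a); lra.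
apply: eq_nrm_small => e e0; rewrite subr0.
(* The three terms keep the small box inside the square, put it where [g] is bounded by [K], and
   make its contribution 16 K h at most [e]. *)
pose h := Num.min (1/4) (Num.min (r / 4) (e / (16 * K))).
have h0 : 0 < h by rewrite !lt_min !divr_gt0 // mulr_gt0.
have h4 : h <= 1/4 by rewrite ge_min lexx.
have hr : h <= r / 4 by rewrite !ge_min lexx /= orbT.
have he : h * (16 * K) <= e.
  by rewrite -ler_pdivlMr ?mulr_gt0 // !ge_min lexx !orbT.
have Z a' b' c' d' : -1 <= a' -> a' <= b' -> b' <= 1 -> -1 <= c' -> c' <= d' -> d' <= 1 ->
   (forall z, in_box a' b' c' d' z -> z != a) -> box g a' b' c' d' = 0.
  move=> i1 i2 i3 i4 i5 i6 ne; apply: goursat => // z zi.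
  apply: (@diff_in_boxS _ (-1) 1 (-1) 1) => //; apply: dg; last exact: ne.
  case: zi => /andP[j1 j2] /andP[j3 j4]; split; apply/andP; split.
  - exact: le_trans i1 j1.
  - exact: le_trans j2 i3.
  - exact: le_trans i4 j3.
  - exact: le_trans j4 i6.
rewrite /ubox (box_splitx g (-1) 1 (-1) 1 (x - h)) (box_splitx g (x - h) 1 (-1) 1 (x + h)).
rewrite (box_splity g (x - h) (x + h) (-1) 1 (y - h)).
rewrite (box_splity g (x - h) (x + h) (y - h) 1 (y + h)).
rewrite [box g (-1) _ _ _]Z; try lra; last first.
  by move=> z [/andP[_ zx] _]; apply: contraTneq zx => ->; rewrite -/x -ltNge; lra.
rewrite [box g (x + h) _ _ _]Z; try lra; last first.
  by move=> z [/andP[zx _] _]; apply: contraTneq zx => ->; rewrite -/x -ltNge; lra.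
rewrite [box g _ _ (-1) _]Z; try lra; last first.
  by move=> z [_ /andP[_ zx]]; apply: contraTneq zx => ->; rewrite -/y -ltNge; lra.
rewrite [box g _ _ (y + h) _]Z; try lra; last first.
  by move=> z [_ /andP[zx _]]; apply: contraTneq zx => ->; rewrite -/y -ltNge; lra.
rewrite add0r !addr0 add0r.
have iu : in_unit (x - h) (x + h) (y - h) (y + h).
  by split; [lra|lra|lra|lra|split; lra].
apply: le_trans (box_bound iu (cont_edges _ _ _ _ cg) (K := K) _) _.
  move=> z [/andP[i1 i2] /andP[i3 i4]].
  have : nrm (z - a) < r.
    apply: le_lt_trans (nrm_ReIm _) _; rewrite ReD ReN ImD ImN -/x -/y.
    apply: (@le_lt_trans _ _ (h + h)); last by lra.
    by apply: lerD; rewrite ler_norml; apply/andP; split; lra.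
  by move/rh; have := nrmD (g z - g a) (g a); rewrite subrK /K; lra.
by move: he; lra.
Qed.

Section Formula.
Variables (f : C -> C) (K : R).
Hypothesis df : forall z, nrm z < 2 -> exists L, cderiv f z L.
Hypothesis fK : forall z, nrm z < 2 -> nrm (f z) <= K.

Let fc := fun z => f (clamp z).

Lemma fc_cont : continuous fc.
Proof. by apply: clamp_cont => z /df[L dL]; exact: cderiv_cont dL. Qed.

Lemma fc_econt : econt fc. Proof. exact/cont_edges/fc_cont. Qed.

(** The quotient (f z - f a) / (z - a), completed by the derivative at [a], is continuous and is
    differentiable off [a], so its boundary integral is zero. The pole of the remaining kernel is
    then moved to 0. *)
Lemma cauchy_formula a : nrm a <= 1/2 ->
  ubox (fun z => fc z * kap a z) = f a * ubox (kap 0).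
Proof.
move=> a2; rewrite -(ubox_kap_const a2).
have [L dL] : exists L, cderiv f a L by apply: df; lra.
pose q := fun z => if z == a then L else (f z - f a) * (z - a)^-1.
have qN z : z != a -> forall w, nrm (w - z) < nrm (z - a) ->
    q w = (f w - f a) * (w - a)^-1.
  move=> za w wz; rewrite /q; case: eqP => // wa; move: wz.
  by rewrite wa nrmC ltxx.
have dq z : nrm z < 2 -> z != a -> exists M, cderiv q z M.
  move=> z2 za; have [M dM] := df z2.
  have dfa : cderiv (fun w => f w - f a) z M.
    move=> e /dM[r r0 rh]; exists r => // w /rh.
    by have -> : f w - f a - (f z - f a) = f w - f z by ring.
  exists (M * (z - a)^-1 + (f z - f a) * - (z - a) ^- 2).
  move=> e /(cderivM dfa (cderiv_inv za))[r r0 rh].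
  have nza : 0 < nrm (z - a) by apply: nrm_gt0; rewrite subr_eq0.
  exists (Num.min r (nrm (z - a))) => [|w]; first by rewrite lt_min r0.
  rewrite lt_min => /andP[/rh h1 h2].
  by rewrite (qN z za w h2) (qN z za z) // subrr nrm0.
have cq : continuous (fun z => q (clamp z)).
  apply: clamp_cont => z z2; have [->|za] := eqVneq z a; last first.
    by have [M dM] := dq z z2 za; exact: cderiv_cont dM.
  move=> e e0; have e2 : 0 < e / 2 by lra.
  have [r r0 rh] := dL _ e2; exists r => // w /rh.
  rewrite /q eqxx; case: eqP => [_|/eqP wa]; first by rewrite subrr nrm0.
  have wa0 : w - a != 0 by rewrite subr_eq0.
  have -> : (f w - f a) / (w - a) - L = (f w - f a - L * (w - a)) / (w - a).
    by field.
  have n0 := nrm_gt0 wa0.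
  rewrite nrmM nrmV ltr_pdivrMr // => h; nra.
have q0 : ubox (fun z => q (clamp z)) = 0.
  apply: (goursat_pt cq a2) => z zs za; have [M dM] := dq z (sq_lt2 zs) za.
  exists M => e /dM[r r0 rh]; exists r => // w ws wz.
  by rewrite (clamp_id ws) (clamp_id zs); exact: rh.
have ck := econt_kap a2.
have E : ubox (fun z => q (clamp z)) =
    ubox (fun z => 1 * (fc z * kap a z) + (- f a) * kap a z).
  apply: ubox_ext.
  - exact: cont_edges.
  - apply: econtD; apply: econtM => //; try exact: econt_cst.
    by apply: econtM => //; exact: fc_econt.
  move=> z ez; have [zs _] := ez; rewrite /fc (clamp_id zs) /q.
  case: eqP => [za|_]; last by rewrite /kap; ring.
  by exfalso; have := edge_far a2 ez; rewrite za subrr nrm0; lra.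
move: E; rewrite q0 ubox_lin //; last by apply: econtM => //; exact: fc_econt.
rewrite mul1r mulNr => /eqP; rewrite eq_sym subr_eq0 => /eqP ->; by [].
Qed.

Lemma kap0_pow k : econt (fun z => kap 0 z ^+ k : C).
Proof.
have n0 : nrm (0 : C) <= 1/2 by rewrite nrm0; lra.
elim: k => [|k IH]; first exact: econt_cst.
have := econtM (econt_kap n0) IH.
by under [X in econt X]eq_fun do rewrite -exprS.
Qed.

Lemma edge_ge1 z : edge z -> 1 <= nrm z.
Proof. by move=> [_ [<-|<-]]; [exact: nrm_Re|exact: nrm_Im]. Qed.

(** Iterating kap a = kap 0 + a (kap 0) (kap a) inside the Cauchy formula yields the expansion. On
    the boundary the kernels with poles 0 and [a] are at most 1 and 2, so the remainder integral is
    at most 16 (2 K) |a|^N; dividing by the constant, of norm at least 2, leaves 16 K |a|^N. *)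
Lemma taylor_unit : exists c : nat -> C, forall N a, nrm a <= 1/2 ->
  nrm (f a - \sum_(k < N) c k * a ^+ k) <= 16 * K * nrm a ^+ N.
Proof.
have n0 : nrm (0 : C) <= 1/2 by rewrite nrm0; lra.
have K0 : 0 <= K.
  by apply: le_trans (nrm_ge0 (f 0)) _; apply: fK; rewrite nrm0.
pose c0 := ubox (kap (0 : C)).
have c02 : 2 <= nrm c0 := ubox_kap0 R.
have c0N : c0 != 0 by apply: contraTneq c02 => ->; rewrite nrm0 -ltNge.
pose J k := ubox (fun z => fc z * kap 0 z ^+ k.+1).
exists (fun k => J k / c0) => N a a2.
pose S k := ubox (fun z => fc z * kap 0 z ^+ k * kap a z).
have cS k : econt (fun z => fc z * kap 0 z ^+ k * kap a z).
  apply: econtM; last exact: econt_kap.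
  by apply: econtM; [exact: fc_econt|exact: kap0_pow].
have SS k : S k = J k + a * S k.+1.
  rewrite -[J k]mul1r /S /J -ubox_lin //; last first.
    by apply: econtM; [exact: fc_econt|exact: kap0_pow].
  apply: ubox_ext => //.
    apply: econtD; apply: econtM; try exact: econt_cst; try exact: cS.
    by apply: econtM; [exact: fc_econt|exact: kap0_pow].
  move=> z ez; have z1 := far_neq0 (edge_far a2 ez).
  have z2 := far_neq0 (edge_far n0 ez); rewrite subr0 in z2.
  rewrite /kap subr0 exprS; set X := _ ^+ k.
  by field; rewrite z1 z2.
have S0 : f a * c0 = S 0%N.
  rewrite -(cauchy_formula a2) /S; congr ubox; apply/funext => z.
  by rewrite expr0 mulr1.
have SN : f a * c0 = \sum_(k < N) J k * a ^+ k + a ^+ N * S N.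
  rewrite S0; elim: (N) => [|k IH]; first by rewrite big_ord0 add0r expr0 mul1r.
  by rewrite big_ord_recr /= IH SS exprS; ring.
have -> : f a - \sum_(k < N) J k / c0 * a ^+ k = a ^+ N * S N / c0.
  apply: (mulIf c0N); rewrite mulfVK // mulrBl SN mulr_suml.
  rewrite [X in _ - X](_ : _ = \sum_(k < N) J k * a ^+ k); first by rewrite addrC addKr.
  by apply: eq_bigr => k _; field.
rewrite nrmM nrmM nrmX nrmV ler_pdivrMr; last by apply: lt_le_trans c02.
have SB : nrm (S N) <= 16 * (K * 2).
  apply: ubox_bound => // z ez; have [zs _] := ez.
  rewrite !nrmM nrmX; apply: ler_pM; rewrite ?mulr_ge0 ?exprn_ge0 ?nrm_ge0 //.
    rewrite -[leRHS]mulr1; apply: ler_pM; rewrite ?exprn_ge0 ?nrm_ge0 //.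
      by apply: fK; exact: sq_lt2 (clamp_sq _).
    rewrite exprn_ile1 ?nrm_ge0 // /kap subr0 nrmV invf_le1 ?edge_ge1 //.
    by apply: lt_le_trans (edge_ge1 ez).
  exact: far_inv (edge_far a2 ez).
have aN : 0 <= nrm a ^+ N by rewrite exprn_ge0 ?nrm_ge0.
have := ler_wpM2l aN SB.
have : 0 <= 16 * K * nrm a ^+ N by rewrite !mulr_ge0.
by move: c02; set X := nrm c0; set Y := nrm a ^+ N => h1 h2 h3; nra.
Qed.

End Formula.

(** Rescaling of the unit case. One coefficient sequence serves all orders [N], which gives
    asymptotic expansions to every order as well as bounds on the coefficients. *)
Theorem taylor f (r K : R) : 0 < r ->
  (forall z, nrm z < 2 * r -> differentiable f z) ->
  (forall z, nrm z < 2 * r -> nrm (f z) <= K) ->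
  exists c : nat -> C, forall N a, nrm a <= r / 2 ->
    nrm (f a - \sum_(k < N) c k * a ^+ k) <= 16 * K * (nrm a / r) ^+ N.
Proof.
move=> r0 df fK; pose rc : C := r%:C%C.
have nr : nrm rc = r by rewrite nrm_real gtr0_norm.
have rc0 : rc != 0 by apply: contraTneq r0 => rc0; rewrite -nr rc0 nrm0 ltxx.
have sc z : nrm z < 2 -> nrm (rc * z) < 2 * r by rewrite nrmM nr mulrC ltr_pM2r.
have [||c cP] := @taylor_unit (fun z => f (rc * z)) K.
- move=> z /sc /df/differentiable_cderiv [L dL]; exists (L * rc) => e e0.
  have [s s0 sh] := dL (e / r) (divr_gt0 e0 r0).
  exists (s / r) => [|w]; first by rewrite divr_gt0.
  rewrite ltr_pdivlMr // => wz.
  have nz : nrm (rc * w - rc * z) = r * nrm (w - z) by rewrite -mulrBr nrmM nr.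
  have := sh (rc * w); rewrite nz [r * _]mulrC => /(_ wz).
  have -> : L * (rc * w - rc * z) = L * rc * (w - z) by ring.
  by move/le_trans; apply; rewrite mulrCA -mulrA mulVf ?lt0r_neq0 // mulr1 mulrC.
- by move=> z /sc /fK.
exists (fun k => c k / rc ^+ k) => N a ar.
have := cP N (a / rc).
have -> : rc * (a / rc) = a by rewrite mulrC divfK.
have -> : nrm (a / rc) = nrm a / r by rewrite nrmM nrmV nr.
have -> : nrm a / r <= 1 / 2 by rewrite ler_pdivrMr // mulrC mulrA mulr1.
move=> /(_ isT).
have -> // : \sum_(k < N) c k / rc ^+ k * a ^+ k = \sum_(k < N) c k * (a / rc) ^+ k.
by apply: eq_bigr => k _; rewrite exprMn exprVn mulrA mulrAC.
Qed.

End CauchyTaylor.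

(** * Cauchy sequences of reals, complex numbers and rows *)

Section Completeness.
Variable R : realType.
Local Notation C := (R[i]^o).

(** The limit is produced as the supremum of the eventual lower bounds, that is, as an inferior
    limit. *)
Lemma real_complete (u : nat -> R) :
  (forall e : R, 0 < e -> exists N, forall m l, (N <= m)%N -> (N <= l)%N -> `|u m - u l| <= e) ->
  exists l : R, forall e : R, 0 < e -> exists N, forall m, (N <= m)%N -> `|u m - l| <= e.
Proof.
move=> cu; pose S := [set x : R | exists N, forall m, (N <= m)%N -> x <= u m].
have key (e : R) N : (forall m l, (N <= m)%N -> (N <= l)%N -> `|u m - u l| <= e) ->
    S (u N - e) /\ ubound S (u N + e).
  move=> h; split.
    exists N => m Nm; have := h m N Nm (leqnn N); rewrite ler_norml; lra.
  move=> x [M Mx]; have := Mx (maxn M N) (leq_maxl _ _).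
  have := h (maxn M N) N (leq_maxr _ _) (leqnn N); rewrite ler_norml; lra.
exists (sup S) => e e0; have e2 : 0 < e / 2 by lra.
have [N hN] := cu _ e2; exists N => m Nm.
have [h1 h2] := key _ _ hN.
have h3 : u N - e / 2 <= sup S by apply: ub_le_sup => //; exists (u N + e / 2).
have h4 : sup S <= u N + e / 2 by apply: ge_sup => //; exists (u N - e / 2).
have := hN m N Nm (leqnn N); rewrite !ler_norml; lra.
Qed.

Definition nrm_cauchy (V : normedModType R[i]) (u : nat -> V) :=
  forall e : R, 0 < e -> exists N, forall m l, (N <= m)%N -> (N <= l)%N -> nrm (u m - u l) <= e.
Definition nrm_cvg (V : normedModType R[i]) (u : nat -> V) (l : V) :=
  forall e : R, 0 < e -> exists N, forall m, (N <= m)%N -> nrm (u m - l) <= e.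

Lemma c_complete (u : nat -> C) : nrm_cauchy u -> exists l, nrm_cvg u l.
Proof.
move=> cu.
have [|x hx] := @real_complete (fun n => complex.Re (u n)).
  move=> e /cu[N hN]; exists N => m l Nm Nl; apply: le_trans (hN m l Nm Nl).
  by rewrite -ReN -ReD; exact: nrm_Re.
have [|y hy] := @real_complete (fun n => complex.Im (u n)).
  move=> e /cu[N hN]; exists N => m l Nm Nl; apply: le_trans (hN m l Nm Nl).
  by rewrite -ImN -ImD; exact: nrm_Im.
exists (pt x y) => e e0; have e2 : 0 < e / 2 by lra.
have [N hN] := hx _ e2; have [M hM] := hy _ e2.
exists (maxn N M) => m; rewrite geq_max => /andP[/hN h1 /hM h2].
apply: le_trans (nrm_ReIm _) _; rewrite ReD ReN ImD ImN /=; lra.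
Qed.

Lemma nrm_cvg_unique (V : normedModType R[i]) (u : nat -> V) l l' :
  nrm_cvg u l -> nrm_cvg u l' -> l = l'.
Proof.
move=> h h'; apply: eq_nrm_small => e e0; have e2 : 0 < e / 2 by lra.
have [N hN] := h _ e2; have [M hM] := h' _ e2.
have := hN (maxn N M) (leq_maxl _ _); have := hM (maxn N M) (leq_maxr _ _).
by have := nrm_tri (u (maxn N M)) l l'; rewrite [nrm (l - u _)]nrmC; lra.
Qed.

Lemma rv_complete n (u : nat -> 'rV[C]_n) : nrm_cauchy u -> exists l, nrm_cvg u l.
Proof.
move=> cu.
have H j : exists l : C, nrm_cvg (fun k => u k ord0 j : C) l.
  apply: c_complete => e /cu[N hN]; exists N => m l Nm Nl.
  apply: le_trans (hN m l Nm Nl).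
  by have := nrm_coord (u m - u l) j; rewrite !mxE.
have [l hl] := choice H.
exists (\row_j l j) => e e0.
have [N hN] := choice (fun j => hl j e e0).
exists (\max_j N j) => m Nm; apply/nrm_rV; first exact: ltW.
move=> j; rewrite !mxE; apply: hN; exact: leq_trans (leq_bigmax j) Nm.
Qed.

Lemma nrm_cvg_le (V : normedModType R[i]) (u : nat -> V) (v : V) (l : V) (B : R) N0 :
  nrm_cvg u l -> (forall m, (N0 <= m)%N -> nrm (u m - v) <= B) -> nrm (l - v) <= B.
Proof.
move=> h hB; apply/ler_addgt0Pr => e e0; have [N hN] := h e e0.
have := hN (maxn N N0) (leq_maxl _ _); have := hB (maxn N N0) (leq_maxr _ _).
by have := nrm_tri (u (maxn N N0)) l v; rewrite [nrm (l - u _)]nrmC; lra.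
Qed.

End Completeness.

(** * Cauchy estimates along complex lines and Weierstrass's convergence theorem *)

Section Differentials.
Variable R : realType.
Local Notation C := (R[i]^o).

Lemma differentiable_affine (V : normedModType R[i]) (z v : V) (x : C) :
  differentiable (fun a : C => z + a *: v) x.
Proof.
apply/differentiable_nrmP.
have [|l lE] := @linear_ex R C V (fun a : C => a *: v).
  by move=> k a b; rewrite scalerDl -[k *: a]/(k * a) scalerA.
exists l; split; first by exists (nrm v) => a; rewrite lE nrmZ mulrC.
move=> e e0; exists 1 => // w _; rewrite lE.
by rewrite scalerDl addrA [z + _ + _]addrC addrK subrr nrm0 mulr_ge0 ?nrm_ge0 ?(ltW e0).
Qed.

Lemma differentiable_line (V W : normedModType R[i]) (F : V -> W) (z v : V) (x : C) :
  differentiable F (z + x *: v) -> differentiable (fun a : C => F (z + a *: v)) x.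
Proof. by move=> dF; apply: differentiable_comp (differentiable_affine z v x) dF. Qed.

Lemma differentiable_entry n (V : normedModType R[i]) (F : V -> 'rV[C]_n) z j :
  differentiable F z -> differentiable (fun w => F w ord0 j : C) z.
Proof.
move=> /differentiable_nrmP[L [[A LA] h]]; apply/differentiable_nrmP.
have [|l lE] := @linear_ex R V C (fun w => L w ord0 j : C).
  by move=> k a b; rewrite linearP !mxE.
exists l; split.
  by exists A => w; rewrite lE; apply: le_trans (LA w); exact: nrm_coord.
move=> e /h[r r0 rh]; exists r => // w /rh; apply: le_trans; rewrite lE.
by have := nrm_coord (F (z + w) - F z - L w) j; rewrite !mxE.
Qed.

Lemma differentiable_row n (V : normedModType R[i]) (F : V -> 'rV[C]_n) z :
  (forall j, differentiable (fun w => F w ord0 j : C) z) -> differentiable F z.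
Proof.
move=> h; apply/differentiable_nrmP.
have /choice[L LP] := fun j => (differentiable_nrmP _ _).1 (h j).
have /choice[A AP] : forall j, exists A, forall w, nrm (L j w) <= A * nrm w.
  by move=> j; case: (LP j).
have [|l lE] := @linear_ex R V 'rV[C]_n (fun w => \row_j L j w).
  by move=> k a b; apply/rowP => j; rewrite !mxE linearP.
pose B := \sum_j `|A j|.
have AB j : `|A j| <= B by rewrite /B (bigD1 j) //= lerDl sumr_ge0.
exists l; split.
  exists B => w; apply/nrm_rV.
    by rewrite mulr_ge0 ?nrm_ge0 // sumr_ge0.
  move=> j; rewrite lE mxE; apply: le_trans (AP j w) _.
  by rewrite ler_wpM2r ?nrm_ge0 // (le_trans (ler_norm _)).
move=> e e0.
have /choice[r rP] : forall j, exists r : R, 0 < r /\ forall w, nrm w < r ->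
    nrm ((F (z + w) ord0 j : C) - F z ord0 j - L j w) <= e * nrm w.
  by move=> j; have [_ /(_ e e0)[r r0 rh]] := LP j; exists r.
exists (\big[Num.min/1]_j r j).
  by apply: lt_bigmin => // j _; case: (rP j).
move=> w /bigmin_gtP[_ wr]; apply/nrm_rV; first by rewrite mulr_ge0 ?nrm_ge0 // ltW.
by move=> j; rewrite lE !mxE; apply: (rP j).2; exact: wr.
Qed.

Section Lines.
Variable V : normedModType R[i].
Implicit Types (F : V -> C) (z v w : V).

Lemma line_taylor F z v (rho K : R) : 0 < rho -> nrm v <= 1 ->
  (forall y, nrm (y - z) < rho -> differentiable F y) ->
  (forall y, nrm (y - z) < rho -> nrm (F y) <= K) ->
  exists c : nat -> C, forall N (a : C), nrm a <= rho / 4 ->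
    nrm (F (z + a *: v) - \sum_(k < N) c k * a ^+ k) <= 16 * K * (nrm a / (rho / 2)) ^+ N.
Proof.
move=> r0 v1 dF FK.
have inb (a : C) : nrm a < 2 * (rho / 2) -> nrm (z + a *: v - z) < rho.
  rewrite addrC addKr nrmZ => ha; apply: (@le_lt_trans _ _ (nrm a)); last by lra.
  by rewrite ler_piMr ?nrm_ge0.
have [|||c cP] := @taylor R (fun a : C => F (z + a *: v)) (rho / 2) K.
- by lra.
- by move=> a /inb ha; apply: differentiable_line; exact: dF.
- by move=> a /inb ha; exact: FK.
by exists c => N a ha; apply: cP; lra.
Qed.

Lemma normalize w : w != 0 -> nrm ((nrm w)^-1%:C%C *: w) = 1.
Proof.
move=> w0; have nw := nrm_gt0 w0.
by rewrite nrmZ nrm_real gtr0_norm ?invr_gt0 // mulVf ?lt0r_neq0.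
Qed.

Lemma normalizeK w : w != 0 -> (nrm w)%:C%C *: ((nrm w)^-1%:C%C *: w) = w.
Proof.
move=> w0; have nw := nrm_gt0 w0.
by rewrite scalerA -rmorphM /= divff ?lt0r_neq0 // scale1r.
Qed.

(** First-order Taylor remainder on the complex line through [z] and [w]. A ball of radius rho / 2
    around [z] is available, and 16 K / (rho / 4) is the constant obtained. *)
Lemma cauchy_lipschitz F z0 (rho K : R) : 0 < rho ->
  (forall y, nrm (y - z0) < rho -> differentiable F y) ->
  (forall y, nrm (y - z0) < rho -> nrm (F y) <= K) ->
  forall z w, nrm (z - z0) <= rho / 16 -> nrm (w - z0) <= rho / 16 ->
  nrm (F w - F z) <= 64 * K / rho * nrm (w - z).
Proof.
move=> r0 dF FK z w hz hw.
have [->|wz] := eqVneq w z; first by rewrite !subrr !nrm0 mulr0.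
have wz0 : w - z != 0 by rewrite subr_eq0.
have nwz := nrm_gt0 wz0.
have d8 : nrm (w - z) <= rho / 8 by have := nrm_tri z0 w z; rewrite [nrm (z0 - z)]nrmC; lra.
have inb y : nrm (y - z) < rho / 2 -> nrm (y - z0) < rho.
  by move=> h; have := nrm_tri z y z0; lra.
have [||||c cP] := @line_taylor F z ((nrm (w - z))^-1%:C%C *: (w - z)) (rho / 2) K.
- by lra.
- by rewrite normalize.
- by move=> y /inb; exact: dF.
- by move=> y /inb; exact: FK.
have := cP 1%N (nrm (w - z))%:C%C; rewrite normalizeK // nrm_real gtr0_norm //.
rewrite [z + (w - z)]addrC subrK big_ord1 expr0 mulr1 expr1 => h1.
have := cP 1%N 0; rewrite nrm0 scale0r addr0 big_ord1 expr0 mulr1 expr1 mul0r mulr0 => h0.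
have E : F z = c 0%N.
  apply/eqP; rewrite -subr_eq0; apply/eqP/nrm0_eq0/eqP.
  by rewrite eq_le nrm_ge0 andbT; apply: h0; lra.
rewrite E; apply: le_trans (h1 _) _; first by lra.
rewrite [leLHS](_ : _ = 64 * K / rho * nrm (w - z)) //.
by field; rewrite lt0r_neq0.
Qed.

(** Second-order Taylor remainder on each line, the linear coefficient being identified with [L] by
    shrinking the parameter. Both bounds depend on [K] and [rho] alone, so they survive passage to a
    limit of functions. *)
Lemma cauchy_quadratic F z0 (rho K : R) (L : {linear V -> C}) : 0 < rho ->
  (forall y, nrm (y - z0) < rho -> differentiable F y) ->
  (forall y, nrm (y - z0) < rho -> nrm (F y) <= K) ->
  (forall e : R, 0 < e -> exists2 d : R, 0 < d & forall w, nrm w < d ->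
      nrm (F (z0 + w) - F z0 - L w) <= e * nrm w) ->
  (forall w, nrm w <= rho / 4 ->
     nrm (F (z0 + w) - F z0 - L w) <= 64 * K * (nrm w / rho) ^+ 2) /\
  (forall w, nrm (L w) <= 64 * K / rho * nrm w).
Proof.
move=> r0 dF FK dL.
have K0 : 0 <= K.
  by apply: le_trans (nrm_ge0 (F z0)) _; apply: FK; rewrite subrr nrm0.
have main (v : V) : nrm v = 1 -> nrm (L v) <= 64 * K / rho /\
   forall a : C, nrm a <= rho / 4 ->
     nrm (F (z0 + a *: v) - F z0 - a * L v) <= 64 * K * (nrm a / rho) ^+ 2.
  move=> v1; have v1' : nrm v <= 1 by rewrite v1.
  have [c cP] := line_taylor r0 v1' dF FK.
  have := cP 1%N 0; rewrite nrm0 scale0r addr0 big_ord1 expr0 mulr1 expr1 mul0r mulr0 => h0.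
  have E : F z0 = c 0%N.
    apply/eqP; rewrite -subr_eq0; apply/eqP/nrm0_eq0/eqP.
    by rewrite eq_le nrm_ge0 andbT; apply: h0; lra.
  have B2 (a : C) : nrm a <= rho / 4 ->
      nrm (F (z0 + a *: v) - F z0 - a * c 1%N) <= 64 * K * (nrm a / rho) ^+ 2.
    move=> ha; have := cP 2%N a ha.
    rewrite !big_ord_recl big_ord0 /= expr0 mulr1 addr0 expr1 E opprD addrA [c 1%N * a]mulrC.
    move/le_trans; apply; rewrite [leLHS](_ : _ = 64 * K * (nrm a / rho) ^+ 2) //.
    by field; rewrite lt0r_neq0.
  have E1 : L v = c 1%N.
    apply: eq_nrm_small => e e0; have e2 : 0 < e / 2 by lra.
    have [d d0 dh] := dL _ e2.
    pose B := 64 * K / rho ^+ 2 + 1.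
    have B0 : 0 < B by rewrite ltr_wpDl // divr_ge0 ?mulr_ge0 ?exprn_ge0 ?(ltW r0).
    pose s := Num.min (rho / 4) (Num.min (d / 2) (e / 2 / B)).
    have s0 : 0 < s by rewrite !lt_min !divr_gt0.
    have s1 : s <= rho / 4 by rewrite ge_min lexx.
    have s2 : s < d by apply: (@le_lt_trans _ _ (d / 2)); [rewrite !ge_min lexx orbT|lra].
    have s3 : s * B <= e / 2 by rewrite -ler_pdivlMr // !ge_min lexx !orbT.
    have ns : nrm (s%:C%C : C) = s by rewrite nrm_real gtr0_norm.
    have i1 := B2 (s%:C%C); rewrite ns in i1; have {}i1 := i1 s1.
    have i2 := dh (s%:C%C *: v); rewrite nrmZ ns v1 mulr1 in i2; have {}i2 := i2 s2.
    rewrite linearZ /= in i2.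
    have E3 : (s%:C%C : C) * (L v - c 1%N) =
      (F (z0 + s%:C%C *: v) - F z0 - s%:C%C * c 1%N) - (F (z0 + s%:C%C *: v) - F z0 - s%:C%C * L v).
      by ring.
    have : s * nrm (L v - c 1%N) <= s * e.
      rewrite -{1}ns -nrmM E3; apply: le_trans (nrmB _ _) _.
      have i3 : 64 * K * (s / rho) ^+ 2 <= s * (e / 2).
        rewrite expr_div_n.
        have -> : 64 * K * (s ^+ 2 / rho ^+ 2) = s * (s * (64 * K / rho ^+ 2)).
          by rewrite expr2; ring.
        rewrite ler_wpM2l ?(ltW s0) //; apply: le_trans s3.
        by rewrite ler_wpM2l ?(ltW s0) // /B; lra.
      by lra.
    by rewrite ler_pM2l.
  split; last by rewrite E1.
  have r4 : nrm ((rho / 4)%:C%C : C) = rho / 4 by rewrite nrm_real gtr0_norm //; lra.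
  have i1 := B2 ((rho / 4)%:C%C); rewrite r4 in i1; have {}i1 := i1 (lexx _).
  have i2 := cP 1%N ((rho / 4)%:C%C); rewrite r4 in i2; have {}i2 := i2 (lexx _).
  rewrite big_ord1 expr0 mulr1 expr1 -E -E1 in i1 i2.
  have : nrm ((rho / 4)%:C%C * L v : C) <= 64 * K * (rho / 4 / rho) ^+ 2 + 16 * K * (rho / 4 / (rho / 2)).
    have E3 : (rho / 4)%:C%C * L v = (F (z0 + (rho / 4)%:C%C *: v) - F z0) -
       (F (z0 + (rho / 4)%:C%C *: v) - F z0 - (rho / 4)%:C%C * L v) :> C by ring.
    by rewrite E3; apply: le_trans (nrmB _ _) _; lra.
  rewrite nrmM r4.
  have -> : rho / 4 / rho = 1/4 by field; rewrite lt0r_neq0.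
  have -> : rho / 4 / (rho / 2) = 1/2 by field; rewrite lt0r_neq0.
  move=> h; rewrite ler_pdivlMr // mulrC; nra.
split=> w.
  have [->|w0] := eqVneq w 0.
    by move=> _; rewrite addr0 linear0 subrr subr0 !nrm0 mul0r expr0n /= mulr0.
  move=> hw; have [_ /(_ (nrm w)%:C%C)] := main _ (normalize w0).
  rewrite normalizeK // nrm_real gtr0_norm ?nrm_gt0 //.
  rewrite -[_ * L _]/(_ *: (L _)) -linearZ /= normalizeK //.
  by apply.
have [->|w0] := eqVneq w 0; first by rewrite linear0 !nrm0 mulr0.
have [h _] := main _ (normalize w0).
rewrite -[in L w](normalizeK w0) linearZ nrmM nrm_real gtr0_norm ?nrm_gt0 // mulrC.
by rewrite ler_wpM2r ?nrm_ge0.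
Qed.

(** Cauchy bounds applied to F m - F l show that the differentials at [z0] converge pointwise to a
    linear map. The quadratic remainder bounds are uniform in m and pass to [G]. *)
Lemma weierstrass (F : nat -> V -> C) (G : V -> C) z0 (rho : R) : 0 < rho ->
  (forall m z, nrm (z - z0) < rho -> differentiable (F m) z) ->
  (forall e : R, 0 < e -> exists N, forall m z, (N <= m)%N -> nrm (z - z0) < rho ->
     nrm (F m z - G z) <= e) ->
  differentiable G z0.
Proof.
move=> r0 dF cF.
have [N0 hN0] := cF 1 ltr01.
have z00 : nrm (z0 - z0) < rho by rewrite subrr nrm0.
have [d d0 dh] := (nrm_continuousP (F N0) z0).1 (differentiable_continuous (dF N0 z0 z00)) 1 ltr01.
pose r := Num.min rho d; have rp : 0 < r by rewrite lt_min r0.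
(* Three units of slack: from [F m] to [G], from [G] to [F N0], and from [F N0 y] to [F N0 z0]. *)
pose K := nrm (F N0 z0) + 3.
have FK m y : (N0 <= m)%N -> nrm (y - z0) < r -> nrm (F m y) <= K.
  rewrite lt_min => Nm /andP[y1 y2].
  have := hN0 m y Nm y1; have := hN0 N0 y (leqnn _) y1; have := dh y y2.
  have := nrm_tri (F N0 y) (F m y) 0; have := nrm_tri (G y) (F m y) (F N0 y).
  have := nrm_tri (F N0 z0) (F N0 y) 0.
  by rewrite !subr0 [nrm (G y - _)]nrmC /K; lra.
have dFr m y : nrm (y - z0) < r -> differentiable (F m) y.
  by rewrite lt_min => /andP[y1 _]; exact: dF.
have /choice[L LP] := fun m => (differentiable_nrmP _ _).1 (dF m z0 z00).
have cL w : nrm_cauchy (fun m => L m w : C).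
  move=> e e0; pose e' := e * r / (64 * (nrm w + 1)).
  have w1 : 0 < nrm w + 1 by have := nrm_ge0 w; lra.
  have e'0 : 0 < e' / 2 by rewrite !divr_gt0 // mulr_gt0.
  have [N hN] := cF _ e'0; exists N => m l Nm Nl.
  have [|Ld LdE] := @linear_ex R V C (fun w => L m w - L l w : C).
    by move=> k a b; rewrite (linearP (L m)) (linearP (L l)) opprD addrACA -scalerBr.
  have [|||_ /(_ w)] := @cauchy_quadratic (fun y => F m y - F l y) z0 r e' Ld rp.
  - by move=> y yr; apply: differentiableB; exact: dFr.
  - move=> y; rewrite lt_min => /andP[y1 _].
    have := hN m y Nm y1; have := hN l y Nl y1.
    by have := nrm_tri (G y) (F m y) (F l y); rewrite [nrm (G y - _)]nrmC; lra.
  - move=> e1 e10; have e12 : 0 < e1 / 2 by lra.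
    have [_ /(_ _ e12)[r1 r10 r1h]] := LP m; have [_ /(_ _ e12)[r2 r20 r2h]] := LP l.
    exists (Num.min r1 r2) => [|v]; first by rewrite lt_min r10.
    rewrite lt_min => /andP[/r1h h1 /r2h h2]; rewrite LdE.
    have -> : F m (z0 + v) - F l (z0 + v) - (F m z0 - F l z0) - (L m v - L l v) =
      (F m (z0 + v) - F m z0 - L m v) - (F l (z0 + v) - F l z0 - L l v) by ring.
    by apply: le_trans (nrmB _ _) _; lra.
  rewrite LdE => /le_trans; apply.
  have -> : 64 * e' / r * nrm w = e * (nrm w / (nrm w + 1)).
    by rewrite /e'; field; rewrite !lt0r_neq0.
  by rewrite ler_piMr ?(ltW e0) // ler_pdivrMr //; lra.
have /choice[l lP] := fun w => c_complete (cL w).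
have [|Lg LgE] := @linear_ex R V C l.
  move=> k a b; apply: (nrm_cvg_unique (lP _)) => e e0.
  have k0 : 0 < nrm (k : C) + 1 by have := nrm_ge0 (k : C); lra.
  have ek : 0 < e / 2 / (nrm (k : C) + 1) by rewrite !divr_gt0.
  have e2 : 0 < e / 2 by lra.
  have [N hN] := lP a _ ek; have [M hM] := lP b _ e2.
  exists (maxn N M) => m; rewrite geq_max => /andP[/hN h1 /hM h2].
  rewrite linearP.
  have -> : k *: L m a + L m b - (k *: l a + l b) = k *: (L m a - l a) + (L m b - l b).
    by rewrite opprD addrACA -scalerBr.
  apply: le_trans (nrmD _ _) _; rewrite nrmZ.
  rewrite ler_pdivlMr // in h1.
  by have := nrm_ge0 (L m a - l a); lra.
have QL m : (N0 <= m)%N -> (forall w, nrm w <= r / 4 ->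
     nrm (F m (z0 + w) - F m z0 - L m w) <= 64 * K * (nrm w / r) ^+ 2) /\
  (forall w, nrm (L m w) <= 64 * K / r * nrm w).
  move=> Nm; apply: cauchy_quadratic => //; first exact: dFr.
    by move=> y; exact: FK.
  by case: (LP m).
apply/differentiable_nrmP; exists Lg; split.
  exists (64 * K / r) => w; rewrite LgE -[l w]subr0.
  by apply: (nrm_cvg_le (lP w) (N0 := N0)) => m /QL[_ /(_ w)]; rewrite subr0.
have K0 : 0 <= K by rewrite /K; have := nrm_ge0 (F N0 z0); lra.
have quad w : nrm w <= r / 4 -> nrm (G (z0 + w) - G z0 - Lg w) <= 64 * K * (nrm w / r) ^+ 2.
  move=> hw; rewrite LgE.
  have inr : nrm (z0 + w - z0) < rho.
    rewrite addrC addKr; have : r <= rho by rewrite ge_min lexx.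
    by have := nrm_ge0 w; lra.
  have cc : nrm_cvg (fun m => F m (z0 + w) - F m z0 - L m w) (G (z0 + w) - G z0 - l w).
    move=> e e0; have e3 : 0 < e / 3 by lra.
    have [N hN] := cF _ e3; have [M hM] := lP w _ e3.
    exists (maxn N M) => m; rewrite geq_max => /andP[Nm /hM h3].
    have h1 := hN m _ Nm inr; have h2 := hN m _ Nm z00.
    have -> : F m (z0 + w) - F m z0 - L m w - (G (z0 + w) - G z0 - l w) =
      (F m (z0 + w) - G (z0 + w)) - (F m z0 - G z0) - (L m w - l w) by ring.
    apply: le_trans (nrmB _ _) _; have := nrmB (F m (z0 + w) - G (z0 + w)) (F m z0 - G z0).
    by lra.
  rewrite -[X in nrm X]subr0; apply: (nrm_cvg_le cc (N0 := N0)) => m /QL[/(_ w hw) h _].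
  by rewrite subr0.
move=> e e0; pose B := 64 * K / r ^+ 2 + 1.
have B0 : 0 < B by rewrite ltr_wpDl // divr_ge0 ?mulr_ge0 ?exprn_ge0 ?(ltW rp).
exists (Num.min (r / 4) (e / B)) => [|w]; first by rewrite lt_min !divr_gt0.
rewrite lt_min => /andP[/ltW h1]; rewrite ltr_pdivlMr // => h2.
apply: le_trans (quad w h1) _; rewrite expr_div_n.
have -> : 64 * K * (nrm w ^+ 2 / r ^+ 2) = nrm w * (64 * K / r ^+ 2) * nrm w.
  by rewrite expr2; ring.
rewrite ler_wpM2r ?nrm_ge0 //; apply: le_trans (ltW h2).
by rewrite ler_wpM2l ?nrm_ge0 // /B; lra.
Qed.

End Lines.
End Differentials.

(** * Complex-time flow of a bounded Lipschitz field as a limit of Euler polygons *)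

Section EulerFlow.
Variables (R : realType) (n : nat).
Local Notation C := (R[i]^o).
Local Notation Cn := 'rV[C]_n.
Variables (X : Cn -> Cn) (K L : R).
Hypothesis XK : forall z, nrm (X z) <= K.
Hypothesis XL : forall z w, nrm (X z - X w) <= L * nrm (z - w).
Hypothesis L0 : 0 <= L.
Implicit Types (z w : Cn) (h t s : C).

Lemma K_ge0 : 0 <= K. Proof. exact: le_trans (nrm_ge0 _) (XK 0). Qed.

Lemma subr4 (a b c d : Cn) : a - b - (c - d) + (b - d) = a - c.
Proof. by apply/rowP => k; rewrite !mxE; ring. Qed.

Definition eul h z : Cn := z + h *: X z.

Lemma natSr (j : nat) : j.+1%:R = j%:R + 1 :> R. Proof. by rewrite -addn1 natrD. Qed.

Lemma natSc (j : nat) : j.+1%:R = j%:R + 1 :> R[i]. Proof. by rewrite -addn1 natrD. Qed.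

Lemma eul_dist j h z : nrm (iter j (eul h) z - z) <= j%:R * nrm h * K.
Proof.
elim: j => [|j IH]; first by rewrite subrr nrm0 !mul0r.
rewrite iterS {1}/eul addrAC; apply: le_trans (nrmD _ _) _; rewrite nrmZ natSr.
by have := ler_wpM2l (nrm_ge0 h) (XK (iter j (eul h) z)); lra.
Qed.

(** Within the allowed time the field along the polygon is at most twice its initial value. The
    bound vanishes with [X z], and this is how the vanishing order of the field is transferred to
    the flow. *)
Lemma eul_dist2 j h z : 2 * j%:R * nrm h * L <= 1 ->
  nrm (iter j (eul h) z - z) <= 2 * j%:R * nrm h * nrm (X z).
Proof.
elim: j => [|j IH]; first by rewrite subrr nrm0 mulr0 !mul0r.
rewrite natSr => hL; have h0 := nrm_ge0 h; have x0 := nrm_ge0 (X z).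
have j0 : 0 <= j%:R :> R by [].
have hL' : 2 * j%:R * nrm h * L <= 1.
  have : 0 <= nrm h * L by rewrite mulr_ge0.
  by lra.
have {}IH := IH hL'.
rewrite iterS {1}/eul addrAC; apply: le_trans (nrmD _ _) _; rewrite nrmZ.
set y := iter j _ z in IH *.
have i1 : nrm (X y) <= nrm (X z) + L * nrm (y - z).
  by have := XL y z; have := nrmD (X y - X z) (X z); rewrite subrK; lra.
have i2 : L * nrm (y - z) <= nrm (X z).
  apply: le_trans (ler_wpM2l L0 IH) _.
  rewrite (_ : L * _ = 2 * j%:R * nrm h * L * nrm (X z)); last by ring.
  by rewrite ler_piMl.
have : nrm h * nrm (X y) <= nrm h * (2 * nrm (X z)) by apply: ler_wpM2l => //; lra.
by lra.
Qed.

(** The estimate concerns the displacement, not the map itself, so its constant tends to 0 with the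
    total time; this makes short-time flows close to the identity. *)
Lemma eul_lip j h z w : 2 * j%:R * nrm h * L <= 1 ->
  nrm (iter j (eul h) z - z - (iter j (eul h) w - w)) <= 2 * j%:R * nrm h * L * nrm (z - w).
Proof.
elim: j => [|j IH]; first by rewrite !subrr nrm0 mulr0 !mul0r.
rewrite natSr => hL; have h0 := nrm_ge0 h; have x0 := nrm_ge0 (z - w).
have j0 : 0 <= j%:R :> R by [].
have hL0 : 0 <= nrm h * L by rewrite mulr_ge0.
have hL' : 2 * j%:R * nrm h * L <= 1 by lra.
have {}IH := IH hL'.
rewrite !iterS /eul; set y := iter j _ z in IH *; set y' := iter j _ w in IH *.
have -> : y + h *: X y - z - (y' + h *: X y' - w) = (y - z - (y' - w)) + h *: (X y - X y').
  by rewrite scalerBr !addrA -!addrA; congr (_ + _); apply/rowP => k; rewrite !mxE; ring.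
apply: le_trans (nrmD _ _) _; rewrite nrmZ.
have i0 : nrm (y - y') <= 2 * nrm (z - w).
  have := nrmD (y - z - (y' - w)) (z - w).
  have -> : y - z - (y' - w) + (z - w) = y - y' by apply/rowP => k; rewrite !mxE; ring.
  have : 2 * j%:R * nrm h * L * nrm (z - w) <= nrm (z - w) by rewrite ler_piMl.
  by lra.
have i1 : nrm h * nrm (X y - X y') <= nrm h * (L * (2 * nrm (z - w))).
  by apply: ler_wpM2l => //; apply: le_trans (XL _ _) _; apply: ler_wpM2l.
by lra.
Qed.

(** Consistency of the scheme: [m] steps of size h agree with one step of size m h up to second
    order in the total time. *)
Lemma eul_loc m h z :
  nrm (iter m (eul h) z - z - (m%:R * h) *: X z) <= (m%:R * nrm h) ^+ 2 * (L * K).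
Proof.
have k0 := K_ge0; have h0 := nrm_ge0 h.
elim: m => [|m IH].
  by rewrite mul0r scale0r !subrr nrm0 mul0r expr0n mul0r.
have m0 : 0 <= m%:R :> R by [].
rewrite iterS /eul; set y := iter m _ z in IH *.
have -> : y + h *: X y - z - (m.+1%:R * h) *: X z =
   (y - z - (m%:R * h) *: X z) + h *: (X y - X z).
  by rewrite natSc; apply/rowP => k; rewrite !mxE; ring.
apply: le_trans (nrmD _ _) _; rewrite nrmZ natSr.
have i1 : nrm h * nrm (X y - X z) <= nrm h * (L * (m%:R * nrm h * K)).
  apply: ler_wpM2l => //; apply: le_trans (XL _ _) _; apply: ler_wpM2l => //.
  exact: eul_dist.
have : 0 <= L * K by rewrite mulr_ge0.
have := sqr_ge0 (nrm h); rewrite !expr2 in IH *.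
have E1 : nrm h * (L * (m%:R * nrm h * K)) = m%:R * (nrm h * nrm h) * (L * K) by ring.
have E2 : m%:R * nrm h * (m%:R * nrm h) = m%:R * m%:R * (nrm h * nrm h) by ring.
have -> : (m%:R + 1) * nrm h * ((m%:R + 1) * nrm h) = (m%:R + 1) * (m%:R + 1) * (nrm h * nrm h).
  by ring.
rewrite E1 in i1; rewrite E2 in IH.
set a := L * K in i1 IH *; set b := nrm h * nrm h in i1 IH * => b0 a0.
have ab : 0 <= b * a by rewrite mulr_ge0.
have : 0 <= m%:R * (b * a) by rewrite mulr_ge0.
by lra.
Qed.

Lemma eul_time j h h' z : 2 * j%:R * nrm h * L <= 1 ->
  nrm (iter j (eul h) z - iter j (eul h') z) <= 2 * j%:R * nrm (h - h') * K.
Proof.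
have k0 := K_ge0.
elim: j => [|j IH]; first by rewrite subrr nrm0 mulr0 !mul0r.
rewrite natSr => hL; have h0 := nrm_ge0 h; have d0 := nrm_ge0 (h - h').
have j0 : 0 <= j%:R :> R by [].
have hL0 : 0 <= nrm h * L by rewrite mulr_ge0.
have hL' : 2 * j%:R * nrm h * L <= 1 by lra.
have {}IH := IH hL'.
rewrite !iterS /eul; set y := iter j _ z in IH *; set y' := iter j _ z in IH *.
have -> : y + h *: X y - (y' + h' *: X y') = (y - y') + (h *: (X y - X y') + (h - h') *: X y').
  move: (X y) (X y') => a b; move: y y' {IH} => c e.
  by apply/rowP => k; rewrite !mxE; ring.
apply: le_trans (nrmD _ _) _; have := nrmD (h *: (X y - X y')) ((h - h') *: X y').
rewrite !nrmZ.
have i1 : nrm h * nrm (X y - X y') <= nrm h * (L * (2 * j%:R * nrm (h - h') * K)).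
  by apply: ler_wpM2l => //; apply: le_trans (XL _ _) _; apply: ler_wpM2l.
have i2 : nrm (h - h') * nrm (X y') <= nrm (h - h') * K by apply: ler_wpM2l.
have i3 : nrm h * (L * (2 * j%:R * nrm (h - h') * K)) <= nrm (h - h') * K.
  rewrite (_ : nrm h * _ = 2 * j%:R * nrm h * L * (nrm (h - h') * K)); last by ring.
  by rewrite ler_piMl // mulr_ge0.
by lra.
Qed.

(** Each coarse step adds the local error of [eul_loc], and amplifies the previous error by at most
    the same amount because 2 N |h| L <= 1; hence the factor 2 N. *)
Lemma eul_refine m N h z : (0 < m)%N -> 2 * N%:R * nrm h * L <= 1 ->
  nrm (iter N (eul h) z - iter (m * N) (eul (h / m%:R)) z) <=
  2 * N%:R * (nrm h ^+ 2 * (L * K)).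
Proof.
move=> m0; have k0 := K_ge0.
elim: N => [|j IH]; first by rewrite muln0 subrr nrm0 mulr0 !mul0r.
rewrite natSr => hL; have h0 := nrm_ge0 h.
have j0 : 0 <= j%:R :> R by [].
have hL0 : 0 <= nrm h * L by rewrite mulr_ge0.
have hL' : 2 * j%:R * nrm h * L <= 1 by lra.
have {}IH := IH hL'.
rewrite mulnS iterD iterS; set y := iter j _ z in IH *; set y' := iter (m * j) _ z in IH *.
apply: le_trans (nrm_tri (eul h y') _ _) _.
have i1 : nrm (eul h y - eul h y') <= nrm (y - y') + nrm h * (L * nrm (y - y')).
  rewrite /eul; have -> : y + h *: X y - (y' + h *: X y') = (y - y') + h *: (X y - X y').
    by apply/rowP => k; rewrite !mxE; ring.
  by apply: le_trans (nrmD _ _) _; rewrite nrmZ lerD2l ler_wpM2l.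
have m0' : (m%:R : C) != 0 by rewrite pnatr_eq0 -lt0n.
have i2 : nrm (eul h y' - iter m (eul (h / m%:R)) y') <= nrm h ^+ 2 * (L * K).
  have := eul_loc m (h / m%:R) y'.
  have -> : m%:R * (h / m%:R) = h by rewrite mulrCA divff // mulr1.
  have -> : m%:R * nrm (h / m%:R : C) = nrm h.
    have nm : nrm (m%:R : C) = m%:R.
      by have := nrm_real (m%:R : R); rewrite rmorph_nat => ->; rewrite ger0_norm.
    by rewrite nrmM nrmV nm mulrCA divff ?mulr1 // pnatr_eq0 -lt0n.
  rewrite nrmC /eul; congr (nrm _ <= _).
  by apply/rowP => k; rewrite !mxE; ring.
set A := nrm h ^+ 2 * (L * K) in IH i2 *.
have A0 : 0 <= A by rewrite mulr_ge0 ?sqr_ge0 ?mulr_ge0.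
have i3 : nrm h * (L * nrm (y - y')) <= A.
  apply: le_trans (_ : nrm h * (L * (2 * j%:R * A)) <= _).
    by apply: ler_wpM2l => //; apply: ler_wpM2l.
  rewrite (_ : nrm h * _ = 2 * j%:R * nrm h * L * A); last by ring.
  by rewrite ler_piMl.
by lra.
Qed.

(** The polygon has N + 1 steps, so that the step size is defined for every [N]. *)
Definition eulN t z (N : nat) : Cn := iter N.+1 (eul (t / N.+1%:R)) z.

Lemma nrm_nat (m : nat) : nrm (m%:R : C) = m%:R.
Proof. by have := nrm_real (m%:R : R); rewrite rmorph_nat => ->; rewrite ger0_norm. Qed.

Lemma step_total (m : nat) t : m.+1%:R * nrm (t / m.+1%:R : C) = nrm t.
Proof. by rewrite nrmM nrmV nrm_nat mulrCA divff ?mulr1 // pnatr_eq0. Qed.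

Lemma step_total2 (m : nat) t : 2 * m.+1%:R * nrm (t / m.+1%:R : C) = 2 * nrm t.
Proof. by rewrite -[LHS]mulrA step_total. Qed.

Lemma step_cond (m : nat) t : 2 * nrm t * L <= 1 ->
  2 * m.+1%:R * nrm (t / m.+1%:R : C) * L <= 1.
Proof. by rewrite step_total2. Qed.

Definition errA t : R := 2 * nrm t ^+ 2 * (L * K).

Lemma errA_ge0 t : 0 <= errA t.
Proof.
have k0 := K_ge0; apply: mulr_ge0; last exact: mulr_ge0.
by apply: mulr_ge0 => //; exact: sqr_ge0.
Qed.

Lemma eulN_refine t z N m : 2 * nrm t * L <= 1 ->
  nrm (eulN t z N - eulN t z (m.+1 * N.+1).-1) <= errA t / N.+1%:R.
Proof.
move=> hL; have := @eul_refine m.+1 N.+1 (t / N.+1%:R) z isT (step_cond N hL).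
rewrite /eulN prednK ?muln_gt0 //.
have -> : t / N.+1%:R / m.+1%:R = t / (m.+1 * N.+1)%:R.
  by rewrite natrM invfM mulrA mulrAC.
move/le_trans; apply; rewrite /errA nrmM nrmV nrm_nat.
rewrite [leLHS](_ : _ = 2 * nrm t ^+ 2 * (L * K) / N.+1%:R) //.
have : N.+1%:R != 0 :> R by rewrite pnatr_eq0.
by set M := N.+1%:R => M0; field.
Qed.

(** Both polygons are compared with their common refinement, which has (m + 1)(N + 1) steps. *)
Lemma eulN_diff t z N m : 2 * nrm t * L <= 1 ->
  nrm (eulN t z N - eulN t z m) <= errA t / N.+1%:R + errA t / m.+1%:R.
Proof.
move=> hL; have h1 := eulN_refine z N m hL; have h2 := eulN_refine z m N hL.
rewrite mulnC in h2; have := nrm_tri (eulN t z (m.+1 * N.+1).-1) (eulN t z N) (eulN t z m).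
by move=> /le_trans; apply; rewrite nrmC in h2; exact: lerD.
Qed.

Lemma arch_small (A e : R) : 0 < e -> exists N : nat, A / N.+1%:R <= e.
Proof.
move=> e0; exists (Num.truncn (`|A| / e)); rewrite ler_pdivrMr ?ltr0n //.
apply: le_trans (ler_norm A) _; rewrite mulrC -ler_pdivrMr //.
exact/ltW/truncnS_gt.
Qed.

Lemma inv_mono (A : R) (N m : nat) : 0 <= A -> (N <= m)%N -> A / m.+1%:R <= A / N.+1%:R.
Proof.
move=> A0 Nm; rewrite ler_wpM2l // lef_pV2 ?posrE ?ltr0n //.
by rewrite ler_nat.
Qed.

(** The flow for complex time [t]. Where the polygons fail to converge, the value is the default
    [z]. *)
Definition Phi t z : Cn := xget z [set l | nrm_cvg (eulN t z) l].

Lemma Phi_cvg t z : 2 * nrm t * L <= 1 -> nrm_cvg (eulN t z) (Phi t z).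
Proof.
move=> hL.
have [l ll] : exists l, nrm_cvg (eulN t z) l.
  apply: rv_complete => e e0; have e2 : 0 < e / 2 by lra.
  have [N hN] := arch_small (errA t) e2.
  exists N => m l Nm Nl; apply: le_trans (eulN_diff z m l hL) _.
  rewrite [leRHS]splitr; apply: lerD; apply: le_trans hN; exact: inv_mono (errA_ge0 t) _.
by rewrite /Phi; case: xgetP => [y -> //|/(_ l)].
Qed.

Lemma Phi_err t z N : 2 * nrm t * L <= 1 ->
  nrm (eulN t z N - Phi t z) <= 2 * errA t / N.+1%:R.
Proof.
move=> hL; rewrite nrmC; apply: (nrm_cvg_le (Phi_cvg z hL) (N0 := N)) => m Nm.
apply: le_trans (eulN_diff z m N hL) _; rewrite -mulrA mulr_natl mulr2n lerD2r.
exact: inv_mono (errA_ge0 t) Nm.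
Qed.

Lemma nrm_cvg_lim (u v : nat -> Cn) (a b : Cn) (B : R) : nrm_cvg u a -> nrm_cvg v b ->
  (forall m, nrm (u m - v m) <= B) -> nrm (a - b) <= B.
Proof.
move=> ha hb h; apply/ler_addgt0Pr => e e0; have e2 : 0 < e / 2 by lra.
have [N hN] := ha _ e2; have [M hM] := hb _ e2.
have := hN (maxn N M) (leq_maxl _ _); have := hM (maxn N M) (leq_maxr _ _).
have := h (maxn N M); set x := u _; set y := v _.
have := nrm_tri x a b; have := nrm_tri y x b; rewrite [nrm (a - x)]nrmC; lra.
Qed.

Lemma nrm_cvg_cst (a : Cn) : nrm_cvg (fun=> a) a.
Proof. by move=> e e0; exists 0%N => m _; rewrite subrr nrm0 ltW. Qed.

Lemma Phi_dist t z : 2 * nrm t * L <= 1 -> nrm (Phi t z - z) <= 2 * nrm t * nrm (X z).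
Proof.
move=> hL; apply: (nrm_cvg_lim (Phi_cvg z hL) (nrm_cvg_cst z)) => m.
have := eul_dist2 z (step_cond m hL).
by rewrite step_total2.
Qed.

Lemma Phi_distK t z : 2 * nrm t * L <= 1 -> nrm (Phi t z - z) <= nrm t * K.
Proof.
move=> hL; apply: (nrm_cvg_lim (Phi_cvg z hL) (nrm_cvg_cst z)) => m.
by have := eul_dist m.+1 (t / m.+1%:R) z; rewrite step_total.
Qed.

Lemma Phi0 z : Phi 0 z = z.
Proof.
apply: eq_nrm_small => e e0.
have h : 2 * nrm (0 : C) * L <= 1 by rewrite nrm0 mulr0 mul0r.
by have := Phi_dist z h; rewrite nrm0 mulr0 mul0r; lra.
Qed.

Lemma Phi_lip t z w : 2 * nrm t * L <= 1 ->
  nrm (Phi t z - z - (Phi t w - w)) <= 2 * nrm t * L * nrm (z - w).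
Proof.
move=> hL.
have -> : Phi t z - z - (Phi t w - w) = Phi t z - (Phi t w - w + z).
  by move: (Phi t z) (Phi t w) => a b; apply/rowP => k; rewrite !mxE; ring.
have cw : nrm_cvg (fun N => eulN t w N - w + z) (Phi t w - w + z).
  move=> e e0; have [N hN] := Phi_cvg w hL e0; exists N => m /hN.
  have -> // : eulN t w m - w + z - (Phi t w - w + z) = eulN t w m - Phi t w.
  by move: (Phi t w) (eulN t w m) => a b; apply/rowP => k; rewrite !mxE; ring.
apply: (nrm_cvg_lim (Phi_cvg z hL) cw) => m.
have := eul_lip z w (step_cond m hL); rewrite step_total2 -/(eulN t z m) -/(eulN t w m).
have -> // : eulN t z m - z - (eulN t w m - w) = eulN t z m - (eulN t w m - w + z).
by move: (eulN t z m) (eulN t w m) => a b; apply/rowP => k; rewrite !mxE; ring.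
Qed.

Lemma Phi_loc t z : 2 * nrm t * L <= 1 ->
  nrm (Phi t z - z - t *: X z) <= nrm t ^+ 2 * (L * K).
Proof.
move=> hL.
have -> : Phi t z - z - t *: X z = Phi t z - (z + t *: X z) by rewrite opprD addrA.
apply: (nrm_cvg_lim (Phi_cvg z hL) (nrm_cvg_cst _)) => m.
have := eul_loc m.+1 (t / m.+1%:R) z; rewrite step_total.
have -> : m.+1%:R * (t / m.+1%:R) = t by rewrite mulrCA divff ?mulr1 // pnatr_eq0.
by rewrite opprD addrA.
Qed.

Lemma Phi_time t t' z : 2 * nrm t * L <= 1 -> 2 * nrm t' * L <= 1 ->
  nrm (Phi t z - Phi t' z) <= 2 * nrm (t - t') * K.
Proof.
move=> hL hL'; apply: (nrm_cvg_lim (Phi_cvg z hL) (Phi_cvg z hL')) => m.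
have := eul_time (t' / m.+1%:R) z (step_cond m hL).
by rewrite -mulrBl step_total2.
Qed.

(** With a common step size the polygons for the times (b + 1) s and s concatenate exactly to the
    one for (b + 2) s; the Lipschitz bound allows the limit to be taken in the inner point. *)
Lemma Phi_semi (b : nat) s z : 2 * (b.+2%:R * nrm s) * L <= 1 ->
  Phi (b.+2%:R * s) z = Phi s (Phi (b.+1%:R * s) z).
Proof.
move=> hL; have s0 := nrm_ge0 s.
have nb m : nrm (m%:R * s : C) = m%:R * nrm s by rewrite nrmM nrm_nat.
have sL : 0 <= nrm s * L by rewrite mulr_ge0.
have b0 : 0 <= b%:R :> R by [].
have hL2 : 2 * nrm (b.+2%:R * s) * L <= 1 by rewrite nb.
have bsL : 0 <= b%:R * (nrm s * L) by rewrite mulr_ge0.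
have hL1 : 2 * nrm (b.+1%:R * s) * L <= 1.
  by move: hL; rewrite nb !natSr; lra.
have hL0 : 2 * nrm s * L <= 1 by move: hL; rewrite !natSr; lra.
pose u N := eulN (b.+2%:R * s) z (b.+2 * N.+1).-1.
pose y N := eulN (b.+1%:R * s) z (b.+1 * N.+1).-1.
have uE N : u N = iter N.+1 (eul (s / N.+1%:R)) (y N).
  have mg m : (0 < m.+1 * N.+1)%N by [].
  rewrite /u /y /eulN !(prednK (mg _)).
  have e1 m : m.+1%:R * s / (m.+1 * N.+1)%:R = s / N.+1%:R.
    by rewrite natrM invfM mulrACA divff ?pnatr_eq0 // mul1r.
  by rewrite !e1 -iterD mulSn.
have sub (w : nat -> Cn) l m : nrm_cvg w l -> nrm_cvg (fun N => w (m.+1 * N.+1).-1) l.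
  move=> wl e /wl[N hN]; exists N => k Nk; apply: hN; apply: leq_trans Nk _.
  by rewrite -ltnS prednK ?muln_gt0 // mulSn leq_addr.
have cu := sub _ _ b.+1 (Phi_cvg z hL2).
have cy := sub _ _ b (Phi_cvg z hL1).
apply: (nrm_cvg_unique cu) => e e0.
have e4 : 0 < e / 4 by lra.
have e34 : 2 * (e / 4) + e / 4 <= e by lra.
have [N hN] := cy _ e4; have [M hM] := Phi_cvg (Phi (b.+1%:R * s) z) hL0 e4.
exists (maxn N M) => m; rewrite geq_max => /andP[/hN h1 /hM h2].
rewrite -/(u m) uE; set z' := Phi (_ * s) z in h1 h2 *.
set w := iter m.+1 _ (y m); set w' := eulN s z' m in h2.
have h3 : nrm (w - y m - (w' - z')) <= 2 * nrm s * L * nrm (y m - z').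
  by rewrite -(step_total2 m s); exact: eul_lip (y m) z' (step_cond m hL0).
have h4 : nrm (w - w') <= 2 * nrm (y m - z').
  rewrite -(subr4 w (y m) w' z'); apply: le_trans (nrmD _ _) _.
  rewrite mulr_natl mulr2n lerD2r; apply: le_trans h3 _.
  by rewrite ler_piMl ?nrm_ge0.
apply: le_trans (nrm_tri w' _ _) _.
apply: (@le_trans _ _ (2 * (e / 4) + e / 4)); last exact: e34.
apply: lerD; last exact: h2.
exact: le_trans h4 (ler_wpM2l (ler0n _ 2) h1).
Qed.

End EulerFlow.

(** * Holomorphy of the flow and its differential equation *)

Section FlowHolomorphic.
Variables (R : realType) (n : nat).
Local Notation C := (R[i]^o).
Local Notation Cn := 'rV[C]_n.
Variables (X : Cn -> Cn) (K L : R) (p : Cn) (r : R).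
Hypothesis XK : forall z, nrm (X z) <= K.
Hypothesis XL : forall z w, nrm (X z - X w) <= L * nrm (z - w).
Hypothesis L0 : 0 <= L.
Hypothesis r0 : 0 < r.
Hypothesis dX : forall z, nrm (z - p) < r -> differentiable X z.
Hypothesis K0 : 0 <= K.
Local Notation Phi := (Phi X).

Lemma differentiable_scale (V : normedModType R[i]) (g : V -> C) (F : V -> Cn) v :
  differentiable g v -> differentiable F v -> differentiable (fun w => g w *: F w) v.
Proof.
move=> dg dF; apply: differentiable_row => j.
have -> : (fun w => (g w *: F w) ord0 j : C) = (g * (fun w => F w ord0 j : C))%R.
  by apply/funext => w; rewrite mxE.
exact: differentiableM dg (differentiable_entry j dF).
Qed.

Lemma eul_differentiable (V : normedModType R[i]) (g : V -> C) (F : V -> Cn) v (N j : nat) :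
  differentiable g v -> differentiable F v -> (j <= N.+1)%N ->
  K * nrm (g v) <= r / 2 -> nrm (F v - p) < r / 2 ->
  differentiable (fun w => iter j (eul X (g w / N.+1%:R)) (F w)) v.
Proof.
move=> dg dF jN gK Fp.
have dgN : differentiable (fun w => g w / N.+1%:R : C) v.
  have -> : (fun w => g w / N.+1%:R : C) = (g * cst (N.+1%:R^-1 : C))%R by [].
  by apply: differentiableM dg _; exact: differentiable_cst.
elim: j jN => [//|j IH] jN.
have {}IH := IH (ltnW jN).
have -> : (fun w => iter j.+1 (eul X (g w / N.+1%:R)) (F w)) =
  (fun w => iter j (eul X (g w / N.+1%:R)) (F w)) +
  (fun w => (g w / N.+1%:R) *: X (iter j (eul X (g w / N.+1%:R)) (F w))).
  by apply/funext => w; rewrite iterS.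
apply: (differentiableD IH); apply: (differentiable_scale dgN).
apply: (differentiable_comp IH); apply: dX.
apply: le_lt_trans (nrm_tri (F v) _ _) _.
have := eul_dist XK j (g v / N.+1%:R) (F v).
have : j%:R * nrm (g v / N.+1%:R : C) * K <= K * nrm (g v).
  rewrite mulrC ler_wpM2l // -[leRHS](step_total N) ler_wpM2r ?nrm_ge0 //.
  by rewrite ler_nat ltnW.
by lra.
Qed.

(** Euler maps are compositions of holomorphic maps and converge uniformly. Time and starting point
    may both depend on the parameter, which covers the time variable, complex lines of starting
    points, and the twisted maps. *)
Lemma Phi_differentiable (V : normedModType R[i]) (g : V -> C) (F : V -> Cn) v0 (rho : R) :
  0 < rho ->
  (forall v, nrm (v - v0) < rho -> [/\ differentiable g v, differentiable F v,
     2 * nrm (g v) * L <= 1, K * nrm (g v) <= r / 2 & nrm (F v - p) < r / 2]) ->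
  differentiable (fun v => Phi (g v) (F v)) v0.
Proof.
have r0' := r0; move=> rho0 H; apply: differentiable_row => j.
apply: (@weierstrass R V (fun N v => eulN X (g v) (F v) N ord0 j : C) _ v0 rho rho0).
  move=> m v /H[h1 h2 h3 h4 h5]; apply: differentiable_entry.
  exact: eul_differentiable.
move=> e e0; have [N hN] := @arch_small R (2 * r) e e0.
exists N => m v Nm /H[h1 h2 h3 h4 h5].
have := nrm_coord (eulN X (g v) (F v) m - Phi (g v) (F v)) j; rewrite !mxE => /le_trans; apply.
apply: le_trans (Phi_err XK XL L0 (F v) m h3) _.
have r2 : 0 <= 2 * r by rewrite mulr_ge0 // ltW.
apply: le_trans hN; apply: le_trans (inv_mono r2 Nm).
rewrite ler_wpM2r ?invr_ge0 // ler_wpM2l // /errA.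
have -> : 2 * nrm (g v) ^+ 2 * (L * K) = (2 * nrm (g v) * L) * (K * nrm (g v)).
  by rewrite expr2; ring.
apply: le_trans (_ : 1 * (K * nrm (g v)) <= _); last by lra.
by rewrite ler_wpM2r // mulr_ge0 // nrm_ge0.
Qed.

(** The time derivative exists by holomorphy, so it can be identified along one family of small
    increments: for h = s / (b + 1) the law for commensurable times rewrites the flow at s + h as
    the flow for time h started at [Phi s z], whose first-order term is the field there. For s = 0
    any small real increment works. *)
Lemma Phi_ode z (s : C) : nrm (z - p) < r / 2 -> 4 * nrm s * L < 1 -> K * nrm s < r / 2 ->
  forall e : R, 0 < e -> exists2 d : R, 0 < d & forall h : C, nrm h < d ->
    nrm (Phi (s + h) z - Phi s z - h *: X (Phi s z)) <= e * nrm h.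
Proof.
move=> zp sL sK; have L0' := L0; have r0' := r0; have K0' := K0.
have s0 := nrm_ge0 s.
have slk : exists2 rho : R, 0 < rho & forall h : C, nrm (h - s) < rho ->
    2 * nrm h * L <= 1 /\ K * nrm h <= r / 2.
  have L1 : 0 < 2 * (L + 1) by lra.
  have K1 : 0 < K + 1 by lra.
  have S1 : 0 < 1 - 4 * nrm s * L by lra.
  have S2 : 0 < r / 2 - K * nrm s by lra.
  pose d : R := Num.min ((1 - 4 * nrm s * L) / (2 * (L + 1))) ((r / 2 - K * nrm s) / (K + 1)).
  exists d; first by rewrite lt_min !divr_gt0.
  move=> h; rewrite lt_min !ltr_pdivlMr // => /andP[h1 h2].
  have := nrmD (h - s) s; rewrite subrK => h3; have := nrm_ge0 (h - s) => h4.
  have i1 : nrm h * L <= (nrm (h - s) + nrm s) * L by apply: ler_wpM2r.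
  have i2 : K * nrm h <= K * (nrm (h - s) + nrm s) by apply: ler_wpM2l.
  have i3 : 0 <= nrm s * L by apply: mulr_ge0.
  by split; lra.
have [rho rho0 slkP] := slk.
have dP : differentiable (fun t : C => Phi t z) s.
  apply: (@Phi_differentiable C (fun t => t) (fun=> z) s rho rho0) => v /slkP[h1 h2].
  by split.
have [D [[A DA] hD]] := (differentiable_nrmP _ _).1 dP.
have DE h : D h = h *: D 1 by rewrite -[in LHS](mulr1 h) -linearZ.
suff -> : X (Phi s z) = D 1.
  by move=> e /hD[d d0 dh]; exists d => // h /dh; rewrite DE.
have LK0 : 0 <= L * K by rewrite mulr_ge0.
have loc (B : R) : 0 < B -> exists h : C, [/\ h != 0, nrm h < B &
    nrm (Phi (s + h) z - Phi s z - h *: X (Phi s z)) <= nrm h ^+ 2 * (L * K)].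
  move=> B0; have [->|sn0] := eqVneq s 0.
    pose c := Num.min (B / 2) (1 / (2 * (L + 1))).
    have c0 : 0 < c by rewrite lt_min !divr_gt0 //; lra.
    have nc : nrm (c%:C%C : C) = c by rewrite nrm_real gtr0_norm.
    exists (c%:C%C); split.
    - by apply: contraTneq c0 => cE; rewrite -nc cE nrm0 ltxx.
    - by rewrite nc; apply: le_lt_trans (_ : B / 2 < _); [rewrite ge_min lexx|lra].
    - rewrite add0r (Phi0 XK XL L0); apply: (Phi_loc XK XL L0).
      rewrite nc; have : c <= 1 / (2 * (L + 1)) by rewrite ge_min lexx orbT.
      rewrite ler_pdivlMr; last by lra.
      by have := L0; lra.
  have [b hb] := @arch_small R (nrm s) (B / 2) ltac:(lra).
  pose h : C := s / b.+1%:R.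
  have nh : nrm h = nrm s / b.+1%:R by rewrite nrmM nrmV nrm_nat.
  have sE : s = b.+1%:R * h by rewrite /h mulrCA divff ?mulr1 // pnatr_eq0.
  have sE2 : s + h = b.+2%:R * h by rewrite {1}sE [b.+2%:R]natSc mulrDl mul1r.
  exists h; split.
  - by rewrite mulf_neq0 // invr_eq0 pnatr_eq0.
  - by rewrite nh; apply: le_lt_trans hb _; rewrite ltr_pdivrMr // ltr_pMr // ltr1n.
  have hs : nrm h <= nrm s by rewrite nh ler_piMr // invf_le1 ?ltr0n // ler1n.
  have h0 := nrm_ge0 h.
  have hL : nrm h * L <= nrm s * L by apply: ler_wpM2r.
  have cond : 2 * (b.+2%:R * nrm h) * L <= 1.
    have -> : b.+2%:R * nrm h = nrm s + nrm h.
      by rewrite [in RHS]sE nrmM nrm_nat [b.+2%:R]natSr mulrDl mul1r.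
    by lra.
  rewrite sE2 (Phi_semi XK XL L0 z cond) -sE.
  by apply: (Phi_loc XK XL L0); have := mulr_ge0 h0 L0; lra.
apply: eq_nrm_small => e e0; have e2 : 0 < e / 2 by lra.
have [d d0 dh] := hD _ e2.
have [|h [hn0 hd hl]] := loc (Num.min d (e / (2 * (L * K + 1)))).
  by rewrite lt_min d0 divr_gt0 //; lra.
move: hd; rewrite lt_min ltr_pdivlMr; last by lra.
move=> /andP[/dh h1 h2]; rewrite DE in h1.
have h0 := nrm_gt0 hn0.
have : nrm (h *: (X (Phi s z) - D 1)) <= nrm h * e.
  have -> : h *: (X (Phi s z) - D 1) = (Phi (s + h) z - Phi s z - h *: D 1) -
     (Phi (s + h) z - Phi s z - h *: X (Phi s z)).
    by rewrite scalerBr [RHS]addrC opprB -addrA addKr.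
  apply: le_trans (nrmB _ _) _.
  have : nrm h ^+ 2 * (L * K) <= nrm h * (e / 2).
    by rewrite expr2 -mulrA ler_wpM2l ?(ltW h0) //; lra.
  by lra.
by rewrite nrmZ ler_pM2l.
Qed.

End FlowHolomorphic.

(** * Global bounded Lipschitz extension of the field *)

Section Extension.
Variables (R : realType) (n : nat).
Local Notation C := (R[i]^o).
Local Notation Cn := 'rV[C]_n.

(* Y is X composed with the coordinatewise retraction onto a polysquare. *)
Lemma extend_field (X : Cn -> Cn) (p : Cn) (U : set Cn) : open U -> U p ->
  (forall z, U z -> differentiable X z) ->
  exists (Y : Cn -> Cn) (K L r : R), [/\ 0 <= L, 0 < r,
    (forall z, nrm (Y z) <= K), (forall z w, nrm (Y z - Y w) <= L * nrm (z - w)) &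
    (forall z, nrm (z - p) < r -> U z /\ Y z = X z /\ differentiable Y z)].
Proof.
move=> oU Up dX.
have [d1 d10 dU] := (open_nrmP U).1 oU p Up.
have [d2 d20 dc] := (nrm_continuousP X p).1 (differentiable_continuous (dX p Up)) 1 ltr01.
pose r1 : R := Num.min d1 d2; have r10 : 0 < r1 by rewrite lt_min d10.
pose K := nrm (X p) + 1.
have inU z : nrm (z - p) < r1 -> U z by rewrite lt_min => /andP[/dU].
have XK z : nrm (z - p) < r1 -> nrm (X z) <= K.
  rewrite lt_min => /andP[_ /dc h]; have := nrmD (X z - X p) (X p); rewrite subrK /K; lra.
pose L1 := 64 * K / r1.
have K0 : 0 <= K by rewrite /K; have := nrm_ge0 (X p); lra.
have L10 : 0 <= L1 by rewrite /L1 divr_ge0 ?(ltW r10) // mulr_ge0.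
have XL z w : nrm (z - p) <= r1 / 16 -> nrm (w - p) <= r1 / 16 ->
    nrm (X w - X z) <= L1 * nrm (w - z).
  move=> hz hw; apply/nrm_rV; first by rewrite mulr_ge0 ?nrm_ge0.
  move=> j; rewrite !mxE.
  apply: (@cauchy_lipschitz R _ (fun z => X z ord0 j : C) p r1 K) => // y yr.
    by apply: differentiable_entry; apply: dX; exact: inU.
  exact: le_trans (nrm_coord _ _) (XK y yr).
(* Clamped values have norm below 2, so the retraction lands within 2 r = r1 / 16 of [p], where the
   Cauchy estimate makes the field Lipschitz. *)
pose r := r1 / 32; have r0 : 0 < r by rewrite /r; lra.
pose rc : C := r%:C%C.
have nr : nrm rc = r by rewrite nrm_real gtr0_norm.
have rc0 : rc != 0 by apply: contraTneq r0 => e; rewrite -nr e nrm0 ltxx.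
pose ret (z : Cn) : Cn := p + rc *: (\row_j clamp (rc^-1 * (z ord0 j - p ord0 j))).
have ret_in z : nrm (ret z - p) <= r1 / 16.
  rewrite /ret addrC addKr nrmZ nr.
  have h : nrm (\row_j clamp (rc^-1 * (z ord0 j - p ord0 j)) : Cn) <= 2.
    by apply/nrm_rV => // j; rewrite mxE; apply/ltW/sq_lt2/clamp_sq.
  by have := ler_wpM2l (ltW r0) h; rewrite /r; lra.
have ret_lip z w : nrm (ret z - ret w) <= 2 * nrm (z - w).
  have -> : ret z - ret w = rc *: \row_j (clamp (rc^-1 * (z ord0 j - p ord0 j)) -
      clamp (rc^-1 * (w ord0 j - p ord0 j))).
    by apply/rowP => j; rewrite !mxE; ring.
  rewrite nrmZ nr mulrC -ler_pdivlMr //; apply/nrm_rV.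
    by rewrite divr_ge0 ?mulr_ge0 ?nrm_ge0 // ltW.
  move=> j; rewrite mxE; apply: le_trans (clamp_lip _ _) _.
  have -> : rc^-1 * (z ord0 j - p ord0 j) - rc^-1 * (w ord0 j - p ord0 j) =
    rc^-1 * (z ord0 j - w ord0 j) by ring.
  rewrite nrmM nrmV nr -mulrA ler_pM2l // mulrC ler_pM2r ?invr_gt0 //.
  by have := nrm_coord (z - w) j; rewrite !mxE.
have ret_id z : nrm (z - p) < r -> ret z = z.
  move=> zr; apply/rowP => j; rewrite !mxE clamp_id.
    by rewrite mulrA divff // mul1r addrC subrK.
  have : nrm (rc^-1 * (z ord0 j - p ord0 j) : C) <= 1.
    rewrite nrmM nrmV nr mulrC ler_pdivrMr // mul1r.
    by have := nrm_coord (z - p) j; rewrite !mxE; lra.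
  move=> h; have h1 := le_trans (nrm_Re _) h; have h2 := le_trans (nrm_Im _) h.
  by split; rewrite -ler_norml.
have YX z : nrm (z - p) < r -> X (ret z) = X z by move=> /ret_id ->.
have zU z : nrm (z - p) < r -> nrm (z - p) < r1 by rewrite /r; lra.
exists (fun z => X (ret z)), K, (L1 * 2), r; split => //.
- by rewrite mulr_ge0.
- by move=> z; apply: XK; have := ret_in z; lra.
- move=> z w; apply: le_trans (XL _ _ (ret_in w) (ret_in z)) _.
  by rewrite -mulrA ler_wpM2l.
move=> z zr; split; first exact/inU/zU.
split; first exact: YX.
have /dX/differentiable_nrmP[D [DA Dh]] : U z by exact/inU/zU.
apply/differentiable_nrmP; exists D; split=> // e /Dh[d d0 dh].
exists (Num.min d (r - nrm (z - p))) => [|w]; first by rewrite lt_min d0; lra.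
rewrite lt_min => /andP[/dh h1 h2].
have zw : nrm (z + w - p) < r.
  by have := nrm_tri z (z + w) p; rewrite [z + w - z]addrC addKr; lra.
rewrite (YX _ zw) (YX _ zr); exact: h1.
Qed.

End Extension.

(** * Nagumo's invariance theorem *)

Section Invariance.
Variables (R : realType) (n : nat).
Local Notation C := (R[i]^o).
Local Notation Cn := 'rV[C]_n.

(** Bolzano-Weierstrass: every coordinate stays in a compact square. *)
Lemma rv_cluster (u : nat -> Cn) (p : Cn) (r : R) : (forall m, nrm (u m - p) <= r) ->
  exists a, forall e : R, 0 < e -> forall N, exists2 m, (N <= m)%N & nrm (u m - a) < e.
Proof.
move=> ur.
pose A (j : 'I_n) : set C := (fun xy : R * R => p ord0 j + pt xy.1 xy.2 : C) @`
  (`[(- r), r]%classic `*` `[(- r), r]%classic).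
have cA j : compact (A j).
  apply: continuous_compact; last by apply: compact_setX; exact: segment_compact.
  apply: continuous_subspaceT => -[x y] B /nbhs_nrmP[e e0 eB].
  have e2 : 0 < e / 2 by lra.
  suff : \forall xy \near (x, y), B (p ord0 j + pt xy.1 xy.2) by [].
  near=> xy; apply: eB.
  have -> : p ord0 j + pt xy.1 xy.2 - (p ord0 j + pt x y) = pt xy.1 xy.2 - pt x y.
    by rewrite opprD addrACA subrr add0r.
  apply: le_lt_trans (nrm_pt _ _ _ _) _; rewrite (splitr e); apply: ltrD.
    near: xy; move: (e / 2) e2; apply: cvgr_distC_lt; exact: cvg_fst.
  near: xy; move: (e / 2) e2; apply: cvgr_distC_lt; exact: cvg_snd.
have := rV_compact cA => /(_ (u @ \oo) _).
have uA : (u @ \oo) [set v | forall i, A i (v ord0 i)].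
  exists 0%N => // m _ /= j; have h := le_trans (nrm_coord _ j) (ur m); rewrite !mxE in h.
  exists (complex.Re (u m ord0 j - p ord0 j), complex.Im (u m ord0 j - p ord0 j)).
    by split; rewrite /= in_itv /= -ler_norml; [exact: le_trans (nrm_Re _) h|
      exact: le_trans (nrm_Im _) h].
  rewrite /=; have -> : pt (complex.Re (u m ord0 j - p ord0 j : C))
     (complex.Im (u m ord0 j - p ord0 j : C)) = u m ord0 j - p ord0 j.
    by case: (u m ord0 j - p ord0 j).
  by rewrite addrC subrK.
move=> /(_ uA)[a [_ ac]]; exists a => e e0 N.
have [|| _ [[m /= Nm <-] me]] := ac [set u m | m in [set m | (N <= m)%N]] [set w | nrm (w - a) < e].
- by exists N => // m /= Nm; exists m.
- by apply/nbhs_nrmP; exists e.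
by exists m.
Unshelve. all: by end_near. Qed.

Lemma nagumo_step (e h sg A B N1 N2 N3 c : R) : N1 <= N3 + c -> N3 <= A + B ->
  A <= e / 2 * h -> B <= 2 * e * sg -> c <= h * e -> N2 <= e / 2 * h ->
  N1 + N2 <= 2 * e * (sg + h).
Proof. by lra. Qed.

(** The estimate that [y s] is within 2 e s of [M] is propagated. It persists at the supremum of the
    good times by compactness and closedness, and extends beyond it by tangency and the differential
    equation: these cost e h / 2 each, and the Lipschitz error costs e h because T L <= 1/2, which
    explains the factor 2. Closedness concludes as e tends to 0. *)
Lemma nagumo (M : set Cn) (p : Cn) (r T K L : R) (Y : Cn -> Cn) (y : R -> Cn) :
  0 < r -> 0 <= T -> 0 <= K -> 0 <= L -> T * L <= 1/2 ->
  (forall z, nrm (z - p) < r -> (forall e : R, 0 < e -> exists2 w, M w & nrm (w - z) < e) -> M z) ->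
  (forall z, M z -> nrm (z - p) < r -> forall e : R, 0 < e -> exists2 d : R, 0 < d &
     forall h : R, 0 < h < d -> exists2 w, M w & nrm (w - z - h%:C%C *: Y z) <= e * h) ->
  (forall z w, nrm (Y z - Y w) <= L * nrm (z - w)) ->
  (forall s : R, 0 <= s <= T -> forall e : R, 0 < e -> exists2 d : R, 0 < d &
     forall h : R, 0 < h < d -> nrm (y (s + h) - y s - h%:C%C *: Y (y s)) <= e * h) ->
  (forall s s' : R, 0 <= s <= T -> 0 <= s' <= T -> nrm (y s - y s') <= K * `|s - s'|) ->
  M (y 0) -> (forall s : R, 0 <= s <= T -> nrm (y s - p) <= r / 4) ->
  forall s : R, 0 <= s <= T -> M (y s).
Proof.
move=> r0 T0 K0 L0 TL clM tanM YL dy cy My0 yr.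
suff main (e : R) : 0 < e -> 2 * e * T <= r / 4 ->
    forall s : R, 0 <= s <= T -> exists2 m, M m & nrm (y s - m) <= 2 * e * s.
  move=> s sT; apply: clM; first by have := yr s sT; lra.
  (* The first term makes 2 e1 T smaller than [e]; the second keeps the approximating points of [M]
     in the region around [p] where closedness and tangency are available. *)
  move=> e e0; pose e1 : R := Num.min (e / (4 * (T + 1))) (r / (8 * (T + 1))).
  have T1 : 0 < T + 1 by lra.
  have e10 : 0 < e1 by rewrite lt_min !divr_gt0 // mulr_gt0.
  have a1 : e1 * (4 * (T + 1)) <= e by rewrite -ler_pdivlMr ?mulr_gt0 // ge_min lexx.
  have a2 : e1 * (8 * (T + 1)) <= r by rewrite -ler_pdivlMr ?mulr_gt0 // ge_min lexx orbT.
  have [|m Mm h] := main e1 e10 _ s sT; first by lra.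
  exists m => //; rewrite nrmC; apply: le_lt_trans h _.
  by case/andP: sT => s0 sT; nra.
move=> e0 eT.
pose P s := exists2 m, M m & nrm (y s - m) <= 2 * e * s.
pose S := [set s : R | 0 <= s <= T /\ forall s', 0 <= s' <= s -> P s'].
have S0 : S 0.
  split; first by rewrite lexx.
  move=> s' s'0; have -> : s' = 0 by lra.
  by exists (y 0) => //; rewrite subrr nrm0 mulr0.
have supS : has_sup S by split; [exists 0|exists T => s [/andP[]]].
pose sg := sup S.
have sg0 : 0 <= sg by apply: ub_le_sup => //; exact: supS.2.
have sgT : sg <= T by apply: ge_sup; [exists 0|move=> s [/andP[]]].
have below s : 0 <= s < sg -> P s.
  move=> /andP[s0 ssg]; have [t [tT tP] st] := sup_adherent (eps := sg - s) ltac:(lra) supS.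
  by apply: tP; rewrite s0 /=; rewrite -/sg in st; lra.
have Psg : P sg.
  have [sgz|sgN] := eqVneq sg 0; first by rewrite sgz; apply: S0.2; rewrite lexx.
  have sgp : 0 < sg by lra.
  (* Points of [M] close to y (u k), with u k increasing to [sg], stay within r / 2 of [p]; they
     cluster at a point of [M] within 2 e sg of y sg. *)
  pose u (k : nat) : R := sg - sg / k.+1%:R.
  have u0 k : 0 <= u k < sg.
    rewrite /u; apply/andP; split; last by rewrite gtrBl divr_gt0.
    by rewrite subr_ge0 ler_pdivrMr // ler_peMr // ler1n.
  have uT k : 0 <= u k <= T by have := u0 k; lra.
  have /choice[m mP] : forall k, exists m, M m /\ nrm (y (u k) - m) <= 2 * e * u k.
    by move=> k; have [m h1 h2] := below _ (u0 k); exists m.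
  have mp k : nrm (m k - p) <= r / 2.
    have [_ h] := mP k; have := yr _ (uT k); have := nrm_tri (y (u k)) (m k) p.
    rewrite [nrm (m k - y _)]nrmC; have /andP[i1 i2] := uT k.
    have : 2 * e * u k <= 2 * e * T by rewrite ler_wpM2l // mulr_ge0 // ltW.
    by lra.
  have [a aP] := rv_cluster mp.
  exists a.
    apply: clM.
      have [m0 _ h] := aP (r / 4) ltac:(lra) 0%N.
      by have := nrm_tri (m m0) a p; rewrite [nrm (a - m _)]nrmC; have := mp m0; lra.
    by move=> d d0; have [k _ h] := aP d d0 0%N; exists (m k) => //; case: (mP k).
  apply/ler_addgt0Pr => d d0; have d2 : 0 < d / 2 by lra.
  have [N hN] := arch_small (K * sg) d2.
  have [k Nk ka] := aP _ d2 N.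
  have [_ h] := mP k.
  have h1 := cy sg (u k) ltac:(by rewrite sg0) (uT k).
  have h2 : K * `|sg - u k| <= d / 2.
    rewrite /u opprB addrCA subrr addr0 ger0_norm ?divr_ge0 // mulrA.
    by apply: le_trans hN; apply: inv_mono => //; rewrite mulr_ge0.
  have h3 : 2 * e * u k <= 2 * e * sg.
    by rewrite ler_wpM2l ?mulr_ge0 // ?(ltW e0) //; have := u0 k; lra.
  have := nrm_tri (y (u k)) (y sg) a; have := nrm_tri (m k) (y (u k)) a.
  by move: h1 h2 h3 h ka; lra.
have [sT|sgT'] := ltP sg T; last first.
  move=> s /andP[s0 s1]; have [h|h] := ltP s sg; first by apply: below; rewrite s0.
  by have -> : s = sg by lra.
exfalso.
have sgi : 0 <= sg <= T by rewrite sg0.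
have [m Mm hm] := Psg.
have mp : nrm (m - p) < r.
  have := yr _ sgi; have := nrm_tri (y sg) m p; rewrite [nrm (m - y _)]nrmC.
  have : 2 * e * sg <= 2 * e * T by rewrite ler_wpM2l // mulr_ge0 // ltW.
  by lra.
have e2 : 0 < e / 2 by lra.
have [d1 d10 dh1] := tanM m Mm mp _ e2; have [d2 d20 dh2] := dy sg sgi _ e2.
pose d : R := Num.min (T - sg) (Num.min d1 d2) / 2.
have dm0 : 0 < Num.min (T - sg) (Num.min d1 d2) by rewrite !lt_min d10 d20; lra.
have dd0 : 0 < d by rewrite /d; lra.
have dT : d <= T - sg.
  have : Num.min (T - sg) (Num.min d1 d2) <= T - sg by rewrite ge_min lexx.
  by rewrite /d; lra.
have dd1 : d < d1.
  have : Num.min (T - sg) (Num.min d1 d2) <= d1 by rewrite !ge_min lexx orbT.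
  by rewrite /d; lra.
have dd2 : d < d2.
  have : Num.min (T - sg) (Num.min d1 d2) <= d2 by rewrite !ge_min lexx !orbT.
  by rewrite /d; lra.
have up h : 0 < h <= d -> P (sg + h).
  move=> /andP[h0 hd].
  have [|w Mw hw] := dh1 h; first by apply/andP; split; lra.
  have hy : nrm (y (sg + h) - y sg - h%:C%C *: Y (y sg)) <= e / 2 * h.
    by apply: dh2; apply/andP; split; lra.
  exists w => //.
  have -> : y (sg + h) - w = (y (sg + h) - y sg - h%:C%C *: Y (y sg)) + (y sg - m) +
      h%:C%C *: (Y (y sg) - Y m) - (w - m - h%:C%C *: Y m).
    by move: (y (sg + h)) (y sg) (Y _) (Y m) => a b c f; apply/rowP => k; rewrite !mxE; ring.
  apply: le_trans (nrmB _ _) _.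
  have i1 := nrmD ((y (sg + h) - y sg - h%:C%C *: Y (y sg)) + (y sg - m)) (h%:C%C *: (Y (y sg) - Y m)).
  have i2 := nrmD (y (sg + h) - y sg - h%:C%C *: Y (y sg)) (y sg - m).
  rewrite nrmZ nrm_real gtr0_norm // in i1.
  have i3 : h * nrm (Y (y sg) - Y m) <= h * e.
    rewrite ler_pM2l //; apply: le_trans (YL _ _) _.
    apply: le_trans (ler_wpM2l L0 hm) _.
    have sL : sg * L <= 1/2 by apply: le_trans TL; rewrite ler_wpM2r.
    rewrite (_ : L * _ = 2 * (e * (sg * L))); last by ring.
    apply: (@le_trans _ _ (2 * (e * (1/2)))); first by rewrite ler_pM2l // ler_pM2l.
    by rewrite mulrCA mul1r divff ?mulr1.
  exact: nagumo_step i1 i2 hy hm i3 hw.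
have : S (sg + d).
  split; first by apply/andP; split; lra.
  move=> s' /andP[s0 s1]; have [h|h] := ltP s' sg; first by apply: below; rewrite s0.
  have [->//|sn] := eqVneq s' sg.
  have -> : s' = sg + (s' - sg) by ring.
  by apply: up; apply/andP; split; [rewrite subr_gt0 lt_neqAle eq_sym sn|lra].
move/(ub_le_sup supS.2); rewrite -/sg; lra.
Qed.

End Invariance.

(** * Maps close to the identity are biholomorphic onto open images *)

Section NearIdentity.
Variables (R : realType) (n : nat).
Local Notation C := (R[i]^o).
Local Notation Cn := 'rV[C]_n.
Variables (H : Cn -> Cn) (p : Cn) (rho : R).
Let U : set Cn := [set z | nrm (z - p) < rho].
Hypothesis dH : forall z, U z -> differentiable H z.
Hypothesis lipH : forall z w, U z -> U w ->
  nrm (H z - z - (H w - w)) <= 1/2 * nrm (z - w).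

Lemma near_id_expand z w : U z -> U w -> nrm (z - w) <= 2 * nrm (H z - H w).
Proof.
move=> Uz Uw; have h := lipH Uz Uw.
have := nrm_tri (H z - H w) (z - w) 0; rewrite !subr0 nrmC.
have -> : H z - H w - (z - w) = H z - z - (H w - w).
  by move: (H z) (H w) => a b; apply/rowP => k; rewrite !mxE; ring.
by lra.
Qed.

Lemma near_id_inj z w : U z -> U w -> H z = H w -> z = w.
Proof.
move=> Uz Uw e; apply: eq_nrm_small => d d0; apply: le_trans (near_id_expand Uz Uw) _.
by rewrite e subrr nrm0 mulr0 ltW.
Qed.

Lemma contraction_bound (a b c d e : R) : a <= b + c -> b <= 1/2 * d -> d <= e ->
  c < e / 2 -> a <= e.
Proof. by lra. Qed.

(** Solutions of H z = y are fixed points of z -> y - (H z - z), a contraction of ratio 1/2; it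
    preserves the ball of radius [eta] since it moves the centre by less than eta / 2. *)
Lemma near_id_surj z0 eta y : (forall z, nrm (z - z0) <= eta -> U z) -> 0 < eta ->
  nrm (y - H z0) < eta / 2 -> exists2 z, U z & H z = y.
Proof.
move=> sub eta0 hy.
pose T (z : Cn) : Cn := y - (H z - z).
pose u k := iter k T z0.
have U0 : U z0 by apply: sub; rewrite subrr nrm0 ltW.
have TT z w : U z -> U w -> nrm (T z - T w) <= 1/2 * nrm (z - w).
  move=> Uz Uw; have -> : T z - T w = (H w - w) - (H z - z).
    by rewrite /T; move: (H z) (H w) => a b; apply/rowP => k; rewrite !mxE; ring.
  by rewrite nrmC; exact: lipH.
have Tz0 : nrm (T z0 - z0) < eta / 2.
  by rewrite /T opprD opprK addrA addrK.
have inb k : nrm (u k - z0) <= eta.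
  elim: k => [|k IH]; first by rewrite subrr nrm0 ltW.
  rewrite /u iterS -/(u k).
  exact: (contraction_bound (nrm_tri (T z0) _ _) (TT _ _ (sub _ IH) U0) IH Tz0).
have Uu k : U (u k) by exact/sub/inb.
have con k a b : nrm (u (k + a)%N - u (k + b)%N) <= 2 * eta / 2 ^+ k.
  elim: k => [|k IH].
    rewrite expr0 divr1 !add0n; have := nrm_tri z0 (u a) (u b).
    by rewrite [nrm (z0 - _)]nrmC; have := inb a; have := inb b; lra.
  rewrite !addSn /u !iterS -/(u (k + a)%N) -/(u (k + b)%N).
  apply: le_trans (TT _ _ (Uu _) (Uu _)) _; rewrite exprS invfM.
  by move: IH; lra.
have cu : nrm_cauchy u.
  move=> e e0.
  have [N hN] : exists N : nat, 2 * eta / 2 ^+ N <= e.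
    have [N hN] := arch_small (2 * eta) e0; exists N; apply: le_trans hN.
    rewrite ler_pM2l ?mulr_gt0 // lef_pV2 ?posrE ?exprn_gt0 ?ltr0n //.
    by rewrite -natrX ler_nat; exact: ltn_expl.
  exists N => m l Nm Nl; apply: le_trans hN.
  by rewrite -(subnKC Nm) -(subnKC Nl); exact: con.
have [z zP] := rv_complete cu.
have Uz : U z.
  apply: sub; apply: (nrm_cvg_le zP (N0 := 0%N)) => m _; exact: inb.
exists z => //; apply: eq_nrm_small => e e0.
have e2 : 0 < e / 2 by lra.
have [N hN] := zP _ e2.
have h1 := hN N (leqnn N); have h2 := hN N.+1 (leqnSn N).
have -> : H z - y = z - T z.
  by rewrite /T; move: (H z) => a; apply/rowP => k; rewrite !mxE; ring.
have := nrm_tri (u N.+1) z (T z); rewrite [nrm (z - u _)]nrmC.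
have := TT _ _ (Uu N) Uz; rewrite -[T (u N)]/(u N.+1).
by lra.
Qed.

Lemma U_ball z0 : U z0 -> exists2 eta : R, 0 < eta & forall z, nrm (z - z0) <= eta -> U z.
Proof.
rewrite /U /= => z0r; exists ((rho - nrm (z0 - p)) / 2); first by lra.
by move=> z h /=; have := nrm_tri z0 z p; lra.
Qed.

Lemma near_id_open : open (H @` U).
Proof.
apply/open_nrmP => _ [z0 Uz0 <-]; have [eta eta0 sub] := U_ball Uz0.
exists (eta / 2); first by lra.
by move=> y hy; have [z Uz <-] := near_id_surj sub eta0 hy; exists z.
Qed.

(** Expansion of [H] by at least 1/2 gives |w| <= 4 |L w| for the differential [L], which is
    therefore injective, hence invertible by finite dimension. Its inverse is the differential of
    the inverse map. *)
Lemma near_id_inverse : exists G : Cn -> Cn, holomorphic_on (H @` U) G /\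
  forall z, U z -> G (H z) = z.
Proof.
pose G y := xget p [set z | U z /\ H z = y].
have GH z : U z -> G (H z) = z.
  move=> Uz; rewrite /G; case: xgetP => [w _ [Uw Hw]|/(_ z)]; first exact: near_id_inj Uw Uz Hw.
  by move=> h; exfalso; apply: h.
exists G; split=> // _ [z0 Uz0 <-].
have [eta eta0 sub] := U_ball Uz0.
have [L [_ hL]] := (differentiable_nrmP _ _).1 (dH Uz0).
have expand w : nrm w <= 4 * nrm (L w).
  have [->|w0] := eqVneq w 0; first by rewrite linear0 !nrm0 mulr0.
  have nw := nrm_gt0 w0; have q0 : (0 : R) < 1/4 by lra.
  have [d d0 dh] := hL _ q0.
  pose c : R := Num.min eta (d / 2) / nrm w.
  have m0 : 0 < Num.min eta (d / 2) by rewrite lt_min eta0; lra.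
  have c0 : 0 < c by rewrite divr_gt0.
  have nc : nrm (c%:C%C *: w) = Num.min eta (d / 2).
    by rewrite nrmZ nrm_real gtr0_norm // /c divfK // lt0r_neq0.
  have h1 : nrm (H (z0 + c%:C%C *: w) - H z0 - L (c%:C%C *: w)) <= 1/4 * nrm (c%:C%C *: w).
    apply: dh; rewrite nc; apply: (@le_lt_trans _ _ (d / 2)); last by lra.
    by rewrite ge_min lexx orbT.
  have Uc : U (z0 + c%:C%C *: w).
    by apply: sub; rewrite [z0 + _]addrC addrK nc ge_min lexx.
  have := near_id_expand Uc Uz0; rewrite [z0 + _ - z0]addrC addKr.
  have := nrmD (H (z0 + c%:C%C *: w) - H z0 - L (c%:C%C *: w)) (L (c%:C%C *: w)).
  rewrite subrK; move: h1; rewrite linearZ !nrmZ nrm_real gtr0_norm // => h1 h2 h3.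
  have : c * nrm w <= c * (4 * nrm (L w)).
    by move: h1 h2 h3; set a := nrm (_ - _ - _); set b := nrm (_ - _); lra.
  by rewrite ler_pM2l.
pose A := lin1_mx L.
have AE w : w *m A = L w by rewrite mul_rV_lin1.
have Au : A \in unitmx.
  rewrite -row_free_unit; apply: inj_row_free => v; rewrite AE => Lv.
  apply: nrm0_eq0; have := expand v; rewrite Lv nrm0 mulr0 => h.
  by apply/eqP; rewrite eq_le nrm_ge0 andbT.
have [|Li LiE] := @linear_ex R Cn Cn (fun v => v *m invmx A).
  by move=> k a b; rewrite mulmxDl scalemxAl.
have LLi v : L (Li v) = v by rewrite -AE LiE mulmxKV.
have LiL v : Li (L v) = v by rewrite -AE LiE mulmxK.
have Lib v : nrm (Li v) <= 4 * nrm v by have := expand (Li v); rewrite LLi.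
apply/differentiable_nrmP; exists Li; split; first by exists 4.
(* The 8 is the bound 4 on the inverse differential times the factor 2 between |z - z0| and |k|. *)
move=> e e0; have e8 : 0 < e / 8 by lra.
have [d d0 dh] := hL _ e8.
exists (Num.min (eta / 2) (d / 2)) => [|k]; first by rewrite lt_min; apply/andP; split; lra.
rewrite lt_min => /andP[k1 k2].
have [|z Uz Hz] := @near_id_surj z0 eta (H z0 + k) sub eta0; first by rewrite [H z0 + k]addrC addrK.
rewrite -Hz (GH _ Uz) (GH _ Uz0).
have kE : k = H z - H z0 by rewrite Hz [H z0 + k]addrC addrK.
have zz : nrm (z - z0) <= 2 * nrm k by rewrite kE; exact: near_id_expand.
have h : nrm (H z - H z0 - L (z - z0)) <= e / 8 * nrm (z - z0).
  have := dh (z - z0); rewrite [z0 + _]addrC subrK; apply; lra.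
have -> : z - z0 - Li k = - Li (H z - H z0 - L (z - z0)).
  by rewrite linearB LiL -kE opprB.
rewrite nrmN; apply: le_trans (Lib _) _.
have := ler_wpM2l (ltW e8) zz; lra.
Qed.

Lemma near_id_biholo : biholo_on U H.
Proof.
split.
- exact: open_nrm_ball.
- exact: dH.
- exact: near_id_inj.
- exact: near_id_open.
- exact: near_id_inverse.
Qed.

End NearIdentity.

(** * Subfields, linear dependence, and spaces of polynomial values of bounded degree *)

Section Subfields.
Variable E : numFieldType.
Implicit Types (F : set E) (x y : E).

(** A predicate on sets, so that being generated by a finite list can be expressed as membership in
    every subfield that contains the list. *)
Definition subfield F :=
  [/\ F 1, (forall x y, F x -> F y -> F (x - y)),
      (forall x y, F x -> F y -> F (x * y)) & (forall x, F x -> F x^-1)].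

Section Closure.
Variable F : set E.
Hypothesis sF : subfield F.

Lemma sub1 : F 1. Proof. by case: sF. Qed.
Lemma subB x y : F x -> F y -> F (x - y). Proof. by case: sF => _ h _ _; exact: h. Qed.
Lemma subM x y : F x -> F y -> F (x * y). Proof. by case: sF => _ _ h _; exact: h. Qed.
Lemma subV x : F x -> F x^-1. Proof. by case: sF => _ _ _ h; exact: h. Qed.
Lemma sub0 : F 0. Proof. by rewrite -(subrr 1); apply: subB; exact: sub1. Qed.
Lemma subN x : F x -> F (- x). Proof. by rewrite -sub0r; apply: subB; exact: sub0. Qed.
Lemma subD x y : F x -> F y -> F (x + y).
Proof. by move=> Fx Fy; rewrite -[y]opprK; apply: subB => //; exact: subN. Qed.
Lemma subX x k : F x -> F (x ^+ k).
Proof.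
by move=> Fx; elim: k => [|k IH]; rewrite ?expr0 ?exprS; [exact: sub1|exact: subM].
Qed.
Lemma sub_sum (I : Type) (r : seq I) (P : pred I) (f : I -> E) :
  (forall i, P i -> F (f i)) -> F (\sum_(i <- r | P i) f i).
Proof. by move=> h; elim/big_rec: _ => [|i x /h]; [exact: sub0|exact: subD]. Qed.

Definition polyin (p : {poly E}) := forall i, F p`_i.

Lemma polyinM p q : polyin p -> polyin q -> polyin (p * q).
Proof. by move=> hp hq i; rewrite coefM; apply: sub_sum => j _; exact: subM. Qed.
Lemma polyinD p q : polyin p -> polyin q -> polyin (p + q).
Proof. by move=> hp hq i; rewrite coefD; exact: subD. Qed.
Lemma polyin_sum (I : Type) (r : seq I) (P : pred I) (f : I -> {poly E}) :
  (forall i, P i -> polyin (f i)) -> polyin (\sum_(i <- r | P i) f i).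
Proof.
move=> h; elim/big_rec: _ => [|i x /h]; last exact: polyinD.
by move=> i; rewrite coef0; exact: sub0.
Qed.
Lemma polyinC c : F c -> polyin c%:P.
Proof. by move=> Fc i; rewrite coefC; case: ifP => // _; exact: sub0. Qed.
Lemma polyinX : polyin 'X.
Proof. by move=> i; rewrite coefX; case: (i == 1%N); [exact: sub1|exact: sub0]. Qed.
Lemma polyin_exp p k : polyin p -> polyin (p ^+ k).
Proof.
move=> hp; elim: k => [|k IH]; last by rewrite exprS; exact: polyinM.
by rewrite expr0; apply: polyinC; exact: sub1.
Qed.

End Closure.

Definition alg_over F x := exists p : {poly E}, [/\ p != 0, polyin F p & root p x].

(** Gaussian elimination of the last equation with a pivot row [i0]; the unknown of that row is
    recovered at the end, and all divisions stay in [F]. *)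
Lemma lin_dep F (m N : nat) (A : nat -> nat -> E) : subfield F ->
  (forall i j, F (A i j)) -> (m < N)%N ->
  exists l : nat -> E, [/\ forall i, F (l i), exists2 i, (i < N)%N & l i != 0 &
    forall j, (j < m)%N -> \sum_(i < N) l i * A i j = 0].
Proof.
move=> sF; elim: m N A => [|m IH] N A FA mN.
  exists (fun=> 1); split => //; first by move=> _; exact: sub1.
  by exists 0%N => //; exact: oner_neq0.
case: N mN => // N mN.
have [[i0 iN Ai0]|H] := pselect (exists2 i, (i < N.+1)%N & A i m != 0); last first.
  have [l [Fl [i iN li] lA]] := IH N.+1 A FA (ltnW mN).
  exists l; split => //; first by exists i.
  move=> j; rewrite ltnS leq_eqVlt => /orP[/eqP->|/lA //].
  apply: big1 => k _; have [->|Ak] := eqVneq (A k m) 0; first by rewrite mulr0.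
  by exfalso; apply: H; exists k.
(* Renumbers the rows other than the pivot. *)
pose sk i := bump i0 i.
pose B i j := A (sk i) j - A (sk i) m / A i0 m * A i0 j.
have FB i j : F (B i j).
  by apply: subB => //; apply: subM => //; apply: subM => //; exact: subV.
have [l [Fl [i iN' li] lB]] := IH N B FB mN.
pose l0 := - \sum_(i < N) l i * (A (sk i) m / A i0 m).
pose l' i := if i == i0 then l0 else l (unbump i0 i).
have l'sk k : l' (sk k) = l k.
  by rewrite /l' /sk eq_sym (negbTE (neq_bump _ _)) bumpK.
have Fl0 : F l0.
  by apply: subN => //; apply: sub_sum => // k _; apply: subM => //; apply: subM => //; exact: subV.
have split_sum (f : nat -> E) : \sum_(i < N.+1) f i = f i0 + \sum_(i < N) f (sk i).
  by rewrite (bigD1_ord (Ordinal iN)) //=.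
exists l'; split.
- by move=> k; rewrite /l'; case: ifP.
- exists (sk i); last by rewrite l'sk.
  by rewrite /sk /bump; case: (i0 <= i)%N; rewrite ?add1n ?add0n ?ltnS // ltnW.
move=> j jm; rewrite (split_sum (fun i => l' i * A i j)).
under eq_bigr do rewrite l'sk.
rewrite {1}/l' eqxx /l0 mulNr mulr_suml addrC -sumrB.
move: jm; rewrite ltnS leq_eqVlt => /orP[/eqP->|jm].
  by apply: big1 => k _; rewrite -mulrA divfK // subrr.
apply: etrans (lB j jm); apply: eq_bigr => k _; rewrite /B.
by rewrite mulrBr !mulrA.
Qed.

Lemma sum_digits (f : nat -> E) (d M : nat) :
  \sum_(j < (d * M)%N) f j = \sum_(i < d) \sum_(j < M) f (i * M + j)%N.
Proof.
elim: d => [|d IHd]; first by rewrite mul0n !big_ord0.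
rewrite big_ord_recr -IHd mulSn addnC -(big_mkord xpredT f) (@big_cat_nat _ _ _ (d * M)%N) ?leq_addr //=.
rewrite big_mkord; congr (_ + _).
by rewrite -[X in index_iota X _]add0n big_addn addKn big_mkord; apply: eq_bigr => j _; rewrite addnC.
Qed.

(* Values at the point c of the polynomials over F of degree < D in each variable. *)
Fixpoint polval F (c : seq E) (D : nat) (x : E) : Prop :=
  if c is a :: c' then exists Y : {poly E},
    [/\ (size Y <= D)%N, forall i, polval F c' D Y`_i & x = Y.[a]]
  else F x.

Section Polval.
Variable F : set E.
Hypothesis sF : subfield F.

Lemma polval_sub c D x y : polval F c D x -> polval F c D y -> polval F c D (x - y).
Proof.
elim: c x y => [|a c IH] x y /=; first exact: subB.
move=> [Y [sY hY ->]] [Z [sZ hZ ->]]; exists (Y - Z); split.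
- by rewrite (leq_trans (size_polyD _ _)) // geq_max sY size_polyN.
- by move=> i; rewrite coefB; exact: IH.
- by rewrite hornerD hornerN.
Qed.

Lemma polval_base c D x : F x -> (0 < D)%N -> polval F c D x.
Proof.
move=> Fx D0; elim: c x Fx => [//|a c IH] x Fx /=; exists x%:P; split.
- exact: leq_trans (size_polyC_leq1 _) D0.
- by move=> i; rewrite coefC; case: ifP => _; apply: IH => //; exact: sub0.
- by rewrite hornerC.
Qed.

Lemma polval0 c D : polval F c D 0.
Proof.
elim: c => [|a c IH] /=; first exact: sub0.
by exists 0; split; rewrite ?size_poly0 ?horner0 // => i; rewrite coef0.
Qed.

Lemma polvalD c D x y : polval F c D x -> polval F c D y -> polval F c D (x + y).
Proof.
move=> hx hy; rewrite -[y]opprK; apply: polval_sub => //.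
by rewrite -sub0r; apply: polval_sub => //; exact: polval0.
Qed.

Lemma polval_sum c D (I : Type) (r : seq I) (P : pred I) (f : I -> E) :
  (forall i, P i -> polval F c D (f i)) -> polval F c D (\sum_(i <- r | P i) f i).
Proof. by move=> h; elim/big_rec: _ => [|i x /h]; [exact: polval0|exact: polvalD]. Qed.

Lemma polval_mono c D D' x : (D <= D')%N -> polval F c D x -> polval F c D' x.
Proof.
move=> DD; elim: c x => [//|a c IH] x /= [Y [sY hY ->]]; exists Y; split => //.
- exact: leq_trans DD.
- by move=> i; exact: IH.
Qed.

Lemma polvalM c D D' x y : polval F c D x -> polval F c D' y -> polval F c (D + D') (x * y).
Proof.
elim: c x y => [|a c IH] x y /=; first exact: subM.
move=> [Y [sY hY ->]] [Z [sZ hZ ->]]; exists (Y * Z); split.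
- apply: leq_trans (size_polyMleq _ _) _; apply: leq_trans (leq_pred _) _.
  exact: leq_add.
- by move=> i; rewrite coefM; apply: polval_sum => j _; exact: IH.
- by rewrite hornerM.
Qed.

Lemma polvalX c D x k : polval F c D x -> polval F c (1 + D * k) (x ^+ k).
Proof.
move=> hx; elim: k => [|k IH].
  by rewrite expr0 muln0 addn0; apply: polval_base => //; exact: sub1.
by rewrite exprS mulnS addnCA; exact: polvalM.
Qed.

Lemma polval_gen c D x : (1 < D)%N -> x \in c -> polval F c D x.
Proof.
move=> D1; elim: c => [//|a c IH]; rewrite inE /= => /orP[/eqP->|xc].
  exists 'X; split; rewrite ?size_polyX ?hornerX // => i.
  rewrite coefX; apply: polval_base; last exact: ltnW.
  by case: (i == 1%N); [exact: sub1|exact: sub0].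
exists x%:P; split; rewrite ?hornerC //.
- exact: leq_trans (size_polyC_leq1 _) (ltnW D1).
- by move=> i; rewrite coefC; case: ifP => _; [exact: IH|exact: polval0].
Qed.

(** [B] lists the monomials in the entries of [c], the exponents being the digits of j in base [D];
    there are D^(size c) of them. *)
Lemma polval_span c D : exists B : nat -> E, forall x, polval F c D x ->
  exists2 l : nat -> E, forall j, F (l j) & x = \sum_(j < D ^ size c) l j * B j.
Proof.
elim: c => [|a c [B IH]] /=.
  exists (fun=> 1) => x Fx; exists (fun=> x) => //.
  by rewrite expn0 big_ord1 mulr1.
exists (fun j => a ^+ (j %/ D ^ size c)%N * B (j %% D ^ size c)%N).
move=> x [Y [sY hY ->]].
have /choice[l lP] : forall i, exists l : nat -> E,
    (forall j, F (l j)) /\ Y`_i = \sum_(j < D ^ size c) l j * B j.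
  by move=> i; have [l Fl e] := IH _ (hY i); exists l.
exists (fun j => l (j %/ D ^ size c)%N (j %% D ^ size c)%N); first by move=> j; apply: (lP _).1.
have [D0|D0] := posnP D.
  move: sY; rewrite D0 leqn0 size_poly_eq0 => /eqP->.
  by rewrite horner0 exp0n // big_ord0.
have S0 : (0 < D ^ size c)%N by rewrite expn_gt0 D0.
rewrite (horner_coef_wide _ sY) expnS.
set M := (D ^ size c)%N in lP S0 *.
rewrite (sum_digits (fun j => l (j %/ M)%N (j %% M)%N * (a ^+ (j %/ M)%N * B (j %% M)%N)) D M).
apply: eq_bigr => i _; rewrite (lP i).2 mulr_suml; apply: eq_bigr => j _.
rewrite divnMDl // divn_small // addn0 modnMDl modn_small //.
by ring.
Qed.

End Polval.
End Subfields.

(** * Infinitely many independent elements do not lie in a finitely generated extension *)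

Section TranscendenceDegree.
Variable E : numFieldType.
Implicit Types (F : set E).

(** The monomial in g 0, ..., g (N - 1) whose exponents are the digits of [k] in base [d]. *)
Fixpoint mono (g : nat -> E) (d N k : nat) : E :=
  if N is N'.+1 then mono g d N' (k %% d ^ N') * g N' ^+ (k %/ d ^ N') else 1.

(** A relation, sorted by powers of the last variable [g N], is a polynomial over [Fs N] with root
    [g N]. It is zero by transcendence, and induction applies to each coefficient. *)
Lemma mono_free (Fs : nat -> set E) (g : nat -> E) d :
  (forall N, subfield (Fs N)) -> (forall N x, Fs N x -> Fs N.+1 x) ->
  (forall N, Fs N.+1 (g N)) -> (forall N, ~ alg_over (Fs N) (g N)) ->
  forall N (l : nat -> E), (forall k, Fs 0%N (l k)) ->
    \sum_(k < d ^ N) l k * mono g d N k = 0 -> forall k, (k < d ^ N)%N -> l k = 0.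
Proof.
move=> sF mon gF trg; elim=> [|N IH] l Fl.
  rewrite expn0 big_ord1 /= mulr1 => l0 k; rewrite ltnS leqn0 => /eqP->; exact: l0.
have FN : forall N x, Fs 0%N x -> Fs N x by elim=> // M IHM x /IHM/mon.
have monoF M k : Fs M (mono g d M k).
  elim: M k => [|M IHM] k /=; first exact: sub1 (sF _).
  by apply: (subM (sF _)); [exact/mon/IHM|apply: (subX (sF _))].
have [->|d0] := posnP d; first by rewrite exp0n.
have S0 : (0 < d ^ N)%N by rewrite expn_gt0 d0.
rewrite expnS (sum_digits (fun k => l k * mono g d N.+1 k)).
pose c i := \sum_(j < d ^ N) l (i * d ^ N + j)%N * mono g d N j.
have -> : \sum_(i < d) \sum_(j < d ^ N) l (i * d ^ N + j)%N * mono g d N.+1 (i * d ^ N + j) =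
    (\poly_(i < d) c i).[g N].
  rewrite horner_poly; apply: eq_bigr => i _; rewrite /c mulr_suml.
  apply: eq_bigr => j _ /=.
  by rewrite divnMDl // divn_small // addn0 modnMDl modn_small // mulrA.
move=> rt.
have p0 : \poly_(i < d) c i = 0.
  apply/eqP/negPn/negP => pn; apply: (trg N); exists (\poly_(i < d) c i); split => //.
    move=> i; rewrite coef_poly; case: ifP => _; last exact: sub0 (sF _).
    by apply: (sub_sum (sF _)) => j _; apply: (subM (sF _)); [exact/FN|exact: monoF].
  exact/eqP.
have c0 i : (i < d)%N -> c i = 0.
  by move=> id; have := congr1 (fun p : {poly E} => p`_i) p0; rewrite coef_poly id coef0.
move=> k kd; rewrite (divn_eq k (d ^ N)).
have kq : (k %/ d ^ N < d)%N by rewrite ltn_divLR.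
apply: (IH (fun j => l (k %/ d ^ N * d ^ N + j)%N)).
- by move=> j; exact: Fl.
- exact: c0.
- by rewrite ltn_mod.
Qed.

(* Otherwise there are more monomials in the g_i than dimensions for them. *)
Lemma not_fin_gen (Fs : nat -> set E) (g : nat -> E) (c : seq E) :
  (forall N, subfield (Fs N)) -> (forall N x, Fs N x -> Fs N.+1 x) ->
  (forall N, Fs N.+1 (g N)) -> (forall N, ~ alg_over (Fs N) (g N)) ->
  ~ (forall F, subfield F -> Fs 0%N `<=` F -> (forall x, x \in c -> F x) -> forall N, F (g N)).
Proof.
move=> sF mon gF trg H; set F := Fs 0%N; have s0 : subfield F := sF 0%N.
(* Values at [c] of rational functions over [F]. This is a subfield containing the generators, so
   [H] writes every g N as a quotient of polynomial values. *)
pose Q := [set x | exists e p q, [/\ polval F c e p, polval F c e q, q != 0 & x = p / q]].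
have sQ : subfield Q.
  split.
  - exists 1%N, 1, 1; split; rewrite ?divr1 ?oner_neq0 //; apply: polval_base => //; exact: sub1.
  - move=> _ _ [e [p [q [hp hq q0 ->]]]] [e' [p' [q' [hp' hq' q0' ->]]]].
    exists (e + e')%N, (p * q' - q * p'), (q * q'); split.
    + by apply: polval_sub => //; exact: polvalM.
    + exact: polvalM.
    + by rewrite mulf_neq0.
    + by field; rewrite q0 q0'.
  - move=> _ _ [e [p [q [hp hq q0 ->]]]] [e' [p' [q' [hp' hq' q0' ->]]]].
    exists (e + e')%N, (p * p'), (q * q'); split; try exact: polvalM.
    + by rewrite mulf_neq0.
    + by field; rewrite q0 q0'.
  - move=> _ [e [p [q [hp hq q0 ->]]]].
    have [->|p0] := eqVneq p 0.
      rewrite mul0r invr0; exists 1%N, 0, 1; split; rewrite ?mul0r ?oner_neq0 //.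
        exact: polval0.
      by apply: polval_base => //; exact: sub1.
    by exists e, q, p; split => //; rewrite invf_div.
have gQ : forall N, Q (g N).
  apply: H => // x hx.
    exists 1%N, x, 1; split; rewrite ?divr1 ?oner_neq0 //; apply: polval_base => //; exact: sub1.
  exists 2%N, x, 1; split; rewrite ?divr1 ?oner_neq0 //; first exact: polval_gen.
  by apply: polval_base => //; exact: sub1.
have /choice[pq pqP] : forall i, exists epq : nat * E * E,
    [/\ polval F c epq.1.1 epq.1.2, polval F c epq.1.1 epq.2, epq.2 != 0 & g i = epq.1.2 / epq.2].
  by move=> i; have [e [p [q h]]] := gQ i; exists (e, p, q).
(* One element g i more than there are generators. *)
pose m := size c; pose N := m.+1.
pose e := \max_(i < N) (pq i).1.1.
pose A := (1 + (1 + e + e) * N)%N.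
(* As d > A^m, the number d^(m + 1) of monomials exceeds (d A)^m, which bounds the dimension of the
   space containing them once denominators are cleared. *)
pose d := (A ^ m).+1.
pose q i := (pq i).2; pose p i := (pq i).1.2.
(* Degree bound for a monomial in M of the g i after multiplication by q i ^+ d for each of them,
   which clears all denominators since the exponents are below [d]. *)
pose D M := (1 + (2 + e * d + e * d) * M)%N.
have prodP M k : (M <= N)%N -> (k < d ^ M)%N ->
    polval F c (D M) ((\prod_(i < M) q i ^+ d) * mono g d M k).
  elim: M k => [|M IH] k MN kM.
    rewrite big_ord0 mulr1; apply: polval_base => //; exact: sub1.
  have dM0 : (0 < d ^ M)%N by rewrite expn_gt0.
  have kd : (k %/ d ^ M < d)%N by rewrite ltn_divLR // -expnS.
  set a := (k %/ d ^ M)%N in kd *.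
  have [hp hq q0 gE] := pqP M.
  have eM : ((pq M).1.1 <= e)%N by exact: (@leq_bigmax _ (fun i : 'I_N => (pq i).1.1) (Ordinal MN)).
  have E2 : q M ^+ d * g M ^+ a = q M ^+ (d - a) * p M ^+ a.
    rewrite gE exprMn exprVn -/(p M) -/(q M) -[in q M ^+ d](subnK (ltnW kd)) exprD.
    by field; rewrite expf_neq0.
  rewrite big_ord_recr /= mulrACA -/a E2.
  have -> : D M.+1 = (D M + (2 + e * d + e * d))%N.
    by rewrite /D; set Z := (2 + _ + _)%N; rewrite mulnS addnCA addnC.
  apply: polvalM => //.
    by apply: IH; [exact: ltnW|rewrite ltn_mod].
  apply: (@polval_mono _ _ _ ((1 + e * (d - a)) + (1 + e * a))).
    rewrite addnACA add1n -addnA leq_add2l.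
    by rewrite -mulnDr subnK ?(ltnW kd) // leq_addr.
  by apply: polvalM => //; apply: polvalX => //; [exact: polval_mono eM hq|exact: polval_mono eM hp].
have [B BP] := polval_span F c (D N).
have A0 : (0 < A)%N by [].
have d1 : (1 < d)%N by rewrite ltnS expn_gt0 A0.
have big : (D N ^ m < d ^ N)%N.
  have le : (D N <= d * A)%N.
    rewrite /D /A mulnDr muln1 mulnA; apply: leq_add; first exact: ltnW.
    rewrite leq_mul2r; apply/orP; right.
    by rewrite !mulnDr muln1 ![(d * e)%N]mulnC !leq_add2r.
  apply: (@leq_ltn_trans ((d * A) ^ m)).
    by elim: (m) => // k IHk; rewrite !expnS leq_mul.
  by rewrite expnMn /N expnSr ltn_pmul2l ?expn_gt0.
pose Qd := \prod_(i < N) q i ^+ d.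
have Qd0 : Qd != 0.
  by apply/prodf_neq0 => i _; rewrite expf_neq0 //; case: (pqP i).
have /choice[a aP] : forall k, exists a : nat -> E, (forall j, F (a j)) /\
    ((k < d ^ N)%N -> Qd * mono g d N k = \sum_(j < D N ^ m) a j * B j).
  move=> k; have [kN|kN] := ltnP k (d ^ N); last by exists (fun=> 0); split=> // _; exact: sub0.
  by have [a Fa aE] := BP _ (prodP N k (leqnn _) kN); exists a.
have [l [Fl [k kN lk] lA]] := lin_dep s0 (fun i j => (aP i).1 j) big.
move/eqP: lk; apply; apply: (mono_free sF mon gF trg Fl _ kN).
apply: (mulfI Qd0); rewrite mulr0 mulr_sumr.
under eq_bigr => i _.
  rewrite mulrCA (aP i).2 // mulr_sumr.
  under eq_bigr do rewrite mulrA.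
  over.
rewrite exchange_big /=; apply: big1 => j _.
by rewrite -mulr_suml (lA j (ltn_ord j)) mul0r.
Qed.

End TranscendenceDegree.

(** * Formal power series: algebraic equations and substitution *)

Section AlgebraicSeries.
Variable E : numFieldType.
Implicit Types (p q : {poly E}) (s : nat -> E) (P : {poly {poly E}}).

(** Congruence modulo 'X^N. *)
Definition eqm N p q := forall i, (i < N)%N -> p`_i = q`_i.

Lemma eqmM N p p' q q' : eqm N p p' -> eqm N q q' -> eqm N (p * q) (p' * q').
Proof.
move=> hp hq i iN; rewrite !coefM; apply: eq_bigr => j _.
rewrite hp ?hq //; first exact: leq_ltn_trans (leq_subr _ _) iN.
by apply: leq_ltn_trans iN; rewrite -ltnS.
Qed.

Lemma eqmD N p p' q q' : eqm N p p' -> eqm N q q' -> eqm N (p + q) (p' + q').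
Proof. by move=> hp hq i iN; rewrite !coefD hp ?hq. Qed.

Lemma eqmX N p p' k : eqm N p p' -> eqm N (p ^+ k) (p' ^+ k).
Proof. by move=> h; elim: k => [|k IH] //; rewrite !exprS; exact: eqmM. Qed.

Lemma eqm_horner N P p q : eqm N p q -> eqm N P.[p] P.[q].
Proof.
move=> h; elim/poly_ind: P => [|P c IH]; first by rewrite !horner0.
by rewrite !hornerMXaddC; apply: eqmD => //; exact: eqmM.
Qed.

Lemma horner_taylor2 P p q : exists r, P.[p + q] = P.[p] + P^`().[p] * q + q ^+ 2 * r.
Proof.
elim/poly_ind: P => [|P c [r IH]].
  by exists 0; rewrite deriv0 !horner0 mul0r mulr0 !addr0.
rewrite !hornerMXaddC derivMXaddC hornerD hornerMX IH.
by exists (P^`().[p] + r * (p + q)); ring.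
Qed.

Definition tr s N : {poly E} := \poly_(i < N) s i.

Lemma coef_tr s N i : (tr s N)`_i = if (i < N)%N then s i else 0.
Proof. by rewrite coef_poly. Qed.

Lemma tr_eqm s N M : (N <= M)%N -> eqm N (tr s N) (tr s M).
Proof. by move=> NM i iN; rewrite !coef_tr iN (leq_trans iN NM). Qed.

Lemma tr_split s N M : (N <= M)%N -> exists2 r, tr s M = tr s N + 'X^N * r &
  (N < M)%N -> r`_0 = s N.
Proof.
move=> NM; exists (\poly_(i < M - N) s (i + N)%N).
  apply/polyP => i; rewrite coefD !coef_tr coefXnM coef_poly.
  case: (ltnP i N) => iN; first by rewrite (leq_trans iN NM) addr0.
  by rewrite add0r ltn_subLR // subnKC // subnK.
by move=> NM'; rewrite coef_poly subn_gt0 NM' add0n.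
Qed.

(** The equation P(s) = 0 for the formal power series with coefficients [s], tested on
    truncations. *)
Definition vanish P s := forall N i, (i < N)%N -> (P.[tr s N])`_i = 0.

Lemma polyin_horner (F : set E) P p : subfield F -> (forall i, polyin F P`_i) ->
  polyin F p -> polyin F P.[p].
Proof.
move=> sF FP Fp; rewrite horner_coef; apply: polyin_sum => // i _.
by apply: polyinM => //; exact: polyin_exp.
Qed.

(* Newton iteration on an equation of minimal degree: its derivative at s is nonzero. *)
Lemma alg_series_fin_gen P s : P != 0 -> vanish P s ->
  exists c : seq E, forall F, subfield F -> (forall x, x \in c -> F x) -> forall N, F (s N).
Proof.
move=> P0 vP.
have [n0 [Q [Q0 vQ sQ] minQ]] : exists n0, exists2 Q : {poly {poly E}}, [/\ Q != 0, vanish Q s & size Q = n0] &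
    forall Q' : {poly {poly E}}, Q' != 0 -> vanish Q' s -> (n0 <= size Q')%N.
  pose A n := `[< exists Q : {poly {poly E}}, [/\ Q != 0, vanish Q s & size Q = n] >].
  have exA : exists n, A n by exists (size P); apply/asboolP; exists P.
  case: (ex_minnP exA) => n0 /asboolP[Q hQ] minn; exists n0, Q => // Q' Q'0 vQ'.
  by apply: minn; apply/asboolP; exists Q'.
have sQ2 : (1 < size Q)%N.
  rewrite ltnNge; apply/negP => /size1_polyC QC; move/negP: Q0; apply; rewrite QC polyC_eq0.
  apply/eqP/polyP => i; have := vQ i.+1 i (ltnSn i).
  by rewrite [in X in X -> _]QC hornerC coef0.
have dQ0 : (deriv Q) != 0.
  apply/eqP => /(congr1 (fun q : {poly {poly E}} => q`_(size Q).-2)).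
  have := lead_coef_eq0 Q; rewrite (negbTE Q0) lead_coefE.
  rewrite coef_deriv coef0; case: (size Q) sQ2 => [|[|k]] //= _ h /eqP.
  by rewrite -scaler_nat scale_poly_eq0 pnatr_eq0 /= h.
have nv : ~ vanish (deriv Q) s.
  by move=> /(minQ _ dQ0); rewrite -sQ leqNgt lt_size_deriv.
(* The coefficients of the series Q'(s), which do not depend on the truncation; [v] below is the
   order of this series. *)
pose w i := ((deriv Q).[tr s i.+1])`_i.
have wE N i : (i < N)%N -> ((deriv Q).[tr s N])`_i = w i.
  by move=> iN; apply/esym; exact: (@eqm_horner _ (deriv Q) _ _ (tr_eqm s iN) i (ltnSn i)).
have exw : exists i, w i != 0.
  apply: contrapT => H; apply: nv => N i iN; rewrite wE //.
  by apply/eqP/negPn/negP => wi; apply: H; exists i.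
case: (ex_minnP exw) => v wv minv.
have wlt i : (i < v)%N -> w i = 0.
  by move=> iv; apply/eqP/negPn/negP => /minv; rewrite leqNgt iv.
(* The generators are the coefficients of [Q] and the initial coefficients s 0, ..., s v. *)
exists (flatten [seq polyseq p | p <- polyseq Q] ++ [seq s i | i <- iota 0 v.+1]).
move=> F sF Fc.
have FQ i : polyin F Q`_i.
  move=> j; have [iQ|iQ] := ltnP i (size Q); last by rewrite (nth_default _ iQ) coef0; exact: sub0.
  have [jQ|jQ] := ltnP j (size Q`_i); last by rewrite (nth_default _ jQ); exact: sub0.
  apply: Fc; rewrite mem_cat; apply/orP; left; apply/flattenP.
  by exists (polyseq Q`_i); [apply: map_f; exact: mem_nth|exact: mem_nth].
have FdQ i : polyin F (deriv Q)`_i.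
  rewrite coef_deriv => j; rewrite coefMn -mulr_natr; apply: subM => //; first exact: FQ.
  elim: (i.+1) => [|k IH]; first exact: sub0.
  by rewrite -addn1 natrD; apply: subD => //; exact: sub1.
move=> N; elim/ltn_ind: N => M IH.
have [Mv|vM] := leqP M v.
  apply: Fc; rewrite mem_cat; apply/orP; right; apply: map_f.
  by rewrite mem_iota leq0n add0n ltnS.
have Ftr : polyin F (tr s M).
  by move=> i; rewrite coef_tr; case: ifP => [/IH//|_]; exact: sub0.
have Fe : F (w v).
  rewrite -(wE M v vM); exact: polyin_horner.
have [r rE r0] := tr_split s (leq_addr v.+1 M).
have [q qE] := horner_taylor2 Q (tr s M) ('X^M * r).
have Mv1 : (M + v < M + v.+1)%N by rewrite ltn_add2l.
(* Since M > v, the quadratic term of the expansion around the truncation starts in degree 2 M > M +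
   v. Hence the coefficient of degree M + v of the equation is linear in [s M] with factor [w v]. *)
have := vQ (M + v.+1)%N (M + v)%N Mv1.
rewrite rE qE !coefD.
have -> : (('X^M * r) ^+ 2 * q)`_(M + v) = 0.
  by rewrite exprMn -exprM -mulrA coefXnM muln2 -addnn ltn_add2l vM.
have -> : ((deriv Q).[tr s M] * ('X^M * r))`_(M + v) = w v * s M.
  rewrite mulrCA coefXnM ltnNge leq_addr /= addKn coefM big_ord_recr /= subnn wE //.
  rewrite r0; last by rewrite -addn1 leq_add2l.
  rewrite big1 ?add0r // => j _; rewrite wE; last exact: ltn_trans (ltn_ord j) vM.
  by rewrite wlt // mul0r.
rewrite addr0 => e0.
have -> : s M = - (Q.[tr s M])`_(M + v) / w v.
  by apply: (mulfI wv); rewrite mulrCA divff // mulr1; apply/eqP; rewrite eq_sym eqr_oppLR -addr_eq0 e0.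
apply: subM => //; last exact: subV.
by apply: subN => //; exact: polyin_horner.
Qed.

(** The double series with coefficients [b], cut at [L] in both indices, with the polynomial [t] put
    for the first variable and 'X for the second. *)
Definition subst (b : nat -> nat -> E) L (t : {poly E}) : {poly E} :=
  \sum_(k < L) \sum_(i < L) (b k i)%:P * (t ^+ k * 'X^i).

(** As y has no constant term, its powers of exponent k > 1 involve [y N] only from degree N + 1 on,
    and every term with k > 0 carries a factor 'X^m. In degree N + m, [y N] therefore appears in the
    single term with k = 1 and i = m. *)
Lemma subst_coef b (y : nat -> E) m N :
  (forall k i, (0 < k)%N -> (i < m)%N -> b k i = 0) -> y 0%N = 0 -> (0 < N)%N ->
  (subst b (N + m).+1 (tr y (N + m).+1))`_(N + m) =
  (subst b (N + m).+1 (tr y N))`_(N + m) + b 1%N m * y N.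
Proof.
move=> bm y0 N0; set L := (N + m).+1.
have L1 : (1 < L)%N by rewrite /L ltnS addn_gt0 N0.
have mL : (m < L)%N by rewrite /L ltnS leq_addl.
have NL : (N < L)%N by rewrite /L ltnS leq_addr.
have [r rE /(_ NL) r0] := tr_split y (ltnW NL).
have shift M : exists2 a, tr y M = 'X * a & forall i, a`_i = if (i.+1 < M)%N then y i.+1 else 0.
  exists (\poly_(i < M.-1) y i.+1).
    apply/polyP => i; rewrite coefXM coef_tr; case: i => [|i] /=; first by rewrite y0 if_same.
    by rewrite coef_poly; case: M => [|M] //=.
  by move=> i; rewrite coef_poly; case: M => [|M].
have pow k : (1 < k)%N -> eqm N.+1 (tr y L ^+ k) (tr y N ^+ k).
  move=> k1; have [a -> aE] := shift L; have [a' -> aE'] := shift N.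
  have aa : eqm N.-1 a a'.
    move=> i iN; rewrite aE aE'.
    have iN1 : (i.+1 < N)%N by rewrite -(prednK N0) ltnS.
    by rewrite iN1 (ltn_trans iN1 NL).
  move=> i iN; rewrite !exprMn !coefXnM; case: ltnP => // ki.
  apply: (eqmX k aa); rewrite -(prednK N0) in iN.
  by rewrite ltn_subLR // (leq_trans iN) // -addn2 addnC leq_add2r.
have term (k i : 'I_L) : ((b k i)%:P * (tr y L ^+ k * 'X^i))`_(N + m) =
    ((b k i)%:P * (tr y N ^+ k * 'X^i))`_(N + m) +
    (if (k == 1%N :> nat) && (i == m :> nat) then b 1%N m * y N else 0).
  rewrite !coefCM !coefMXn.
  case: (nat_of_ord k) => [|[|k']]; first by rewrite addr0 !expr0.
    rewrite expr1 eqxx /=; have [im|im] := eqVneq (i : nat) m.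
      rewrite im ltnNge leq_addl /= addnK rE coefD mulrDr; congr (_ + _).
      by rewrite coefXnM ltnn subnn r0.
    rewrite addr0; move: im; rewrite neq_ltn => /orP[im|mi]; first by rewrite bm // !mul0r.
    congr (_ * _); case: ltnP => // iNm; rewrite rE coefD coefXnM expr1.
    have lt : (N + m - i < N)%N by rewrite ltn_subLR // addnC ltn_add2r.
    by rewrite lt addr0.
  rewrite addr0; have [im|mi] := ltnP i m; first by rewrite bm // !mul0r.
  congr (_ * _); case: ifP => // _; apply: pow => //.
  by rewrite ltnS leq_subLR addnC leq_add2r.
rewrite /subst !coef_sum.
under eq_bigr => k _.
  rewrite coef_sum; under eq_bigr do rewrite term.
  rewrite big_split /=; over.
rewrite big_split /=; congr (_ + _); first by apply: eq_bigr => k _; rewrite coef_sum.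
rewrite (bigD1 (Ordinal L1)) //= (bigD1 (Ordinal mL)) //= !eqxx /=.
rewrite big1 ?addr0 => [|i im]; last by rewrite ifF //; apply/negbTE; move: im; rewrite -val_eqE.
rewrite big1 ?addr0 // => k k1; rewrite big1 // => i _.
by move: k1; rewrite -val_eqE /= => /negbTE ->.
Qed.

Lemma subst_gen (F : set E) b (y s : nat -> E) m : subfield F ->
  (forall k i, (0 < k)%N -> (i < m)%N -> b k i = 0) -> y 0%N = 0 -> b 1%N m != 0 ->
  (forall k i, F (b k i)) -> (forall i, F (s i)) ->
  (forall L i, (i < L)%N -> s i = (subst b L (tr y L))`_i) -> forall N, F (y N).
Proof.
move=> sF bm y0 b1 Fb Fs sE; elim/ltn_ind => N IH.
have [->|N0] := posnP N; first by rewrite y0; exact: sub0.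
have := subst_coef bm y0 N0; rewrite -sE // => e.
have -> : y N = (s (N + m)%N - (subst b (N + m).+1 (tr y N))`_(N + m)) / b 1%N m.
  by rewrite e addrC addKr mulrC mulKf.
apply: subM => //; last exact: subV.
apply: subB => //.
have Ftr : polyin F (tr y N).
  by move=> i; rewrite coef_tr; case: ifP => [/IH//|_]; exact: sub0.
have H : polyin F (subst b (N + m).+1 (tr y N)).
  apply: polyin_sum => // k _; apply: polyin_sum => // i _.
  apply: polyinM => //; first exact: polyinC.
  by apply: polyinM => //; apply: polyin_exp => //; exact: polyinX.
exact: H.
Qed.

End AlgebraicSeries.

(** * Countable subfields and algebraically independent reals *)

Section Countability.
Variable R : realType.
Local Notation C := (R[i]).

Lemma countable_image (T U : Type) (f : T -> U) (A : set T) : countable A -> countable (f @` A).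
Proof. by move=> cA; apply: sub_countable cA; exact: card_image_le. Qed.

Lemma countable_subfield (S : set C) : countable S ->
  exists F, [/\ subfield F, countable F & S `<=` F].
Proof.
move=> cS.
(* One round of closure; the case 0 retains the set itself, so the iterates increase. *)
pose st (A : set C) : set C := \bigcup_(k in [set: nat])
  (match k with
   | 0 => A
   | 1 => (fun xy : C * C => xy.1 - xy.2) @` (A `*` A)
   | 2 => (fun xy : C * C => xy.1 * xy.2) @` (A `*` A)
   | 3 => (fun x : C => x^-1) @` A
   | _ => [set 1] end).
pose Fi i := iter i st S.
have cFi i : countable (Fi i).
  elim: i => [//|i IH]; rewrite /Fi iterS -/(Fi i).
  apply: bigcup_countable => [|k _]; first exact: countableP.
  have c2 := countableX IH IH.
  case: k => [//|[|[|[|k]]]]; try exact: countable_image; exact: countable1.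
have mono i : Fi i `<=` Fi i.+1 by move=> x Fx; exists 0%N.
have mono2 i j : (i <= j)%N -> Fi i `<=` Fi j.
  elim: j => [|j IH]; first by rewrite leqn0 => /eqP->.
  by rewrite leq_eqVlt => /orP[/eqP->//|/IH h x /h /mono].
exists (\bigcup_(i in [set: nat]) Fi i); split.
- split.
  + by exists 1%N => //; exists 4%N.
  + move=> x y [i _ xi] [j _ yj]; exists (maxn i j).+1 => //; exists 1%N => //.
    by exists (x, y) => //; split; [exact: mono2 (leq_maxl _ _) _ xi|exact: mono2 (leq_maxr _ _) _ yj].
  + move=> x y [i _ xi] [j _ yj]; exists (maxn i j).+1 => //; exists 2%N => //.
    by exists (x, y) => //; split; [exact: mono2 (leq_maxl _ _) _ xi|exact: mono2 (leq_maxr _ _) _ yj].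
  + by move=> x [i _ xi]; exists i.+1 => //; exists 3%N => //; exists x.
- by apply: bigcup_countable => [|k _]; [exact: countableP|exact: cFi].
- by move=> x Sx; exists 0%N.
Qed.

Lemma countable_alg (F : set C) : countable F -> countable [set x | alg_over F x].
Proof.
move=> cF.
pose Pk k := iter k (fun A : set {poly C} =>
  (fun cp : C * {poly C} => cp.2 * 'X + cp.1%:P) @` (F `*` A)) [set 0].
have cPk k : countable (Pk k).
  elim: k => [|k IH]; first exact: countable1.
  exact: countable_image (countableX cF IH).
have inPk k p : polyin F p -> (size p <= k)%N -> Pk k p.
  elim: k p => [|k IH] p Fp; first by rewrite leqn0 size_poly_eq0 => /eqP.
  move=> sp; exists (p`_0, \poly_(i < k) p`_i.+1) => /=.
    split; first exact: Fp.
    apply: IH; last exact: size_poly.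
    move=> i; rewrite coef_poly; case: ifP => [_|ik]; first exact: Fp.
    have := Fp k.+1; rewrite nth_default //.
  apply/polyP => -[|i]; rewrite coefD coefMX coefC ?add0r // addr0 coef_poly.
  case: ltnP => // ki; rewrite nth_default //; exact: leq_trans sp _.
apply: (@sub_countable _ _ _ (\bigcup_(k in [set: nat]) \bigcup_(p in Pk k `&` [set p | p != 0])
   [set x | root p x])).
  apply: subset_card_le => x [p [p0 Fp rt]]; exists (size p) => //; exists p => //.
  by split=> //; exact: inPk.
apply: bigcup_countable => [|k _]; first exact: countableP.
apply: bigcup_countable => [|p [_ p0]].
  by apply: sub_countable (cPk k); apply: subset_card_le => p [].
have [r pE] := closed_field_poly_normal p.
apply: finite_set_countable; apply: (@sub_finite_set _ _ [set` r]); last exact: finite_seq.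
move=> x /=; rewrite pE rootZ ?lead_coef_eq0 //.
by rewrite root_prod_XsubC.
Qed.

(** At each stage the numbers algebraic over a countable field are countable, hence miss some point
    of ]0, 1], which has positive measure; adjoining that point keeps the field countable. The bound
    1 will make the series with coefficients g converge, and positivity makes g 0 nonzero. *)
Lemma independent_reals (K : set C) : countable K -> exists (g : nat -> R) (Fs : nat -> set C),
  [/\ K `<=` Fs 0%N, forall N, 0 < g N <= 1, forall N, subfield (Fs N),
      forall N x, Fs N x -> Fs N.+1 x &
      (forall N, Fs N.+1 (g N)%:C%C) /\ forall N, ~ alg_over (Fs N) (g N)%:C%C].
Proof.
move=> cK; pose T := {F : set C | subfield F /\ countable F}.
have pick (F : T) : exists gF : R * T, [/\ 0 < gF.1 <= 1, sval F `<=` sval gF.2,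
    sval gF.2 gF.1%:C%C & ~ alg_over (sval F) gF.1%:C%C].
  case: F => F [sF cF] /=.
  have [x [x01 xF]] : exists x : R, 0 < x <= 1 /\ ~ alg_over F x%:C%C.
    apply: contrapT => H.
    have : countable (`]0, 1]%classic : set R).
      have inj : {in (`]0, 1]%classic : set R) &, injective (fun x : R => x%:C%C)}.
        by move=> x y _ _ /complexI.
      have /eq_countable <- := inj_card_eq inj.
      apply: sub_countable (countable_alg cF); apply: subset_card_le => _ [x /= x01 <-].
      apply: contrapT => xF; apply: H; exists x; split=> //.
    move=> /countable_lebesgue_measure0; rewrite lebesgue_measure_itv /= lte_fin ltr01.
    by rewrite oppr0 adde0 => /eqP; rewrite eqe oner_eq0.
  have cU : countable (F `|` [set x%:C%C]).
    rewrite -bigcup2E; apply: bigcup_countable => [|[|[|k]] _] //=; exact: countableP.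
  have [F' [sF' cF' FF']] := countable_subfield cU.
  exists (x, exist _ F' (conj sF' cF')); split => //=.
    by move=> y Fy; apply: FF'; left.
  by apply: FF'; right.
have [nx nxP] := choice pick.
have [F0 [sF0 cF0 KF0]] := countable_subfield cK.
pose st := fix st n : T := if n is n'.+1 then (nx (st n')).2 else exist _ F0 (conj sF0 cF0).
exists (fun n => (nx (st n)).1), (fun n => sval (st n)); split => //.
- by move=> N; case: (nxP (st N)).
- by move=> N; case: (svalP (st N)).
- by move=> N x; case: (nxP (st N)) => _ h _ _; exact: h.
- by split=> N; case: (nxP (st N)).
Qed.

End Countability.

(** * Asymptotic expansions at 0 *)

Section Asymptotics.
Variable R : realType.
Local Notation C := (R[i]^o).
Implicit Types (f g : C -> C) (p q : {poly C}).

Definition bigO N f := exists A d : R, [/\ 0 <= A, 0 < d &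
  forall x : C, nrm x < d -> nrm (f x) <= A * nrm x ^+ N].

Lemma bigO_ext N f g : (forall x, f x = g x) -> bigO N f -> bigO N g.
Proof. by move=> e [A [d [A0 d0 h]]]; exists A, d; split=> // x /h; rewrite e. Qed.

Lemma bigO_near N f g : (exists2 d : R, 0 < d & forall x : C, nrm x < d -> f x = g x) ->
  bigO N f -> bigO N g.
Proof.
move=> [e e0 fg] [A [d [A0 d0 h]]]; exists A, (Num.min d e); split=> //.
  by rewrite lt_min d0.
by move=> x; rewrite lt_min => /andP[xd xe]; rewrite -fg //; exact: h.
Qed.

Lemma bigOD N f g : bigO N f -> bigO N g -> bigO N (fun x => f x + g x).
Proof.
move=> [A [d [A0 d0 h]]] [B [e [B0 e0 h']]]; exists (A + B), (Num.min d e); split.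
- exact: addr_ge0.
- by rewrite lt_min d0.
move=> x; rewrite lt_min => /andP[xd xe]; rewrite mulrDl.
by apply: le_trans (nrmD _ _) _; apply: lerD; [exact: h|exact: h'].
Qed.

Lemma bigON N f : bigO N f -> bigO N (fun x => - f x).
Proof. by move=> [A [d [A0 d0 h]]]; exists A, d; split=> // x /h; rewrite nrmN. Qed.

Lemma bigOB N f g : bigO N f -> bigO N g -> bigO N (fun x => f x - g x).
Proof. by move=> hf hg; apply: bigOD => //; exact: bigON. Qed.

Lemma bigO_le N M f : (N <= M)%N -> bigO M f -> bigO N f.
Proof.
move=> NM [A [d [A0 d0 h]]]; exists A, (Num.min d 1); split=> //.
  by rewrite lt_min d0 ltr01.
move=> x; rewrite lt_min => /andP[xd x1]; apply: le_trans (h x xd) _.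
by apply: ler_wpM2l => //; apply: ler_wiXn2l => //; [exact: nrm_ge0|exact: ltW].
Qed.

Lemma bigOM N M f g : bigO N f -> bigO M g -> bigO (N + M) (fun x => f x * g x).
Proof.
move=> [A [d [A0 d0 h]]] [B [e [B0 e0 h']]]; exists (A * B), (Num.min d e); split.
- exact: mulr_ge0.
- by rewrite lt_min d0.
move=> x; rewrite lt_min => /andP[xd xe]; rewrite nrmM exprD mulrACA.
by apply: ler_pM; rewrite ?nrm_ge0 //; [exact: h|exact: h'].
Qed.

Lemma bigO_cst (c : C) : bigO 0 (fun=> c).
Proof.
exists (nrm c), 1; split; rewrite ?nrm_ge0 ?ltr01 // => x _.
by rewrite expr0 mulr1.
Qed.

Lemma bigO_id : bigO 1 (fun x => x).
Proof. by exists 1, 1; split; rewrite ?ler01 ?ltr01 // => x _; rewrite expr1 mul1r. Qed.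

Lemma bigO_poly p : bigO 0 (fun x => p.[x]).
Proof.
elim/poly_ind: p => [|p c IH].
  by apply: bigO_ext (bigO_cst 0) => x; rewrite horner0.
apply: (@bigO_ext _ (fun x => p.[x] * x + c)); first by move=> x; rewrite hornerMXaddC.
apply: bigOD (bigO_cst c); apply: (@bigO_le _ (0 + 1)) => //.
by apply: bigOM => //; exact: bigO_id.
Qed.

Lemma bigO_X k : bigO k (fun x => x ^+ k).
Proof.
elim: k => [|k IH]; first exact: bigO_cst.
rewrite -addn1; apply: bigO_ext (bigOM IH bigO_id) => x; by rewrite exprD expr1.
Qed.

Lemma small_const (a : C) (A d : R) : 0 <= A -> 0 < d ->
  (forall x : R, 0 < x < d -> nrm a <= A * x) -> a = 0.
Proof.
move=> A0 d0 hA; apply/eqP/negPn/negP => a0; have na := nrm_gt0 a0.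
pose x : R := Num.min (d / 2) (nrm a / (2 * (A + 1))).
have A1 : 0 < A + 1 by apply: ltr_wpDl.
have A2 : 0 < 2 * (A + 1) by rewrite mulr_gt0.
have x0 : 0 < x by rewrite lt_min !divr_gt0.
have xd : x < d.
  by apply: le_lt_trans (_ : x <= d / 2) _; [rewrite ge_min lexx|rewrite ltr_pdivrMr // ltr_pMr // ltr1n].
have xa : x * (2 * (A + 1)) <= nrm a by rewrite -ler_pdivlMr // ge_min lexx orbT.
have := hA x; rewrite x0 xd => /(_ isT) ax.
have Ax : 0 <= A * x by rewrite mulr_ge0 // ltW.
move: ax xa Ax x0; clear; nra.
Qed.

(** After the lower coefficients have been removed by induction, dividing by x^i and letting x tend
    to 0 through positive reals isolates the next one. *)
Lemma bigO_coef N p : bigO N (fun x => p.[x]) -> forall i, (i < N)%N -> p`_i = 0.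
Proof.
move=> [A [d [A0 d0 hA]]] i; elim/ltn_ind: i => i IH iN.
have [q pE] : exists q : {poly C}, p = (q * 'X + (p`_i)%:P) * 'X^i.
  exists (\poly_(j < size p) p`_(j + i.+1)%N); apply/polyP => j.
  rewrite coefMXn; case: ltnP => [ji|ij]; first by apply: IH => //; exact: ltn_trans iN.
  rewrite coefD coefMX coefC -{1}(subnK ij); case: (j - i)%N => [|l] /=; first by rewrite !add0r.
  rewrite addr0 coef_poly addSnnS; case: ltnP => // hl; rewrite nth_default //.
  exact: leq_trans hl (leq_addr _ _).
have [B [e [B0 e0 hB]]] := bigOM (bigO_poly q) bigO_id.
pose d' := Num.min (Num.min d e) 1.
have d'0 : 0 < d' by rewrite !lt_min d0 e0 ltr01.
apply: (@small_const _ (A + B) d'); rewrite ?addr_ge0 //.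
move=> x /andP[x0]; rewrite !lt_min => /andP[/andP[xd xe] x1].
have nx : nrm (x%:C%C : C) = x by rewrite nrm_real gtr0_norm.
have := hA x%:C%C; have := hB x%:C%C; rewrite nx expr1 => /(_ xe) h1 /(_ xd) h2.
rewrite pE hornerM hornerXn nrmM nrmX nx in h2.
have xi : 0 < x ^+ i by rewrite exprn_gt0.
have xN : x ^+ N <= x * x ^+ i.
  by rewrite -exprS; apply: ler_wiXn2l => //; exact: ltW.
have h3 : nrm ((q * 'X + (p`_i)%:P).[x%:C%C] : C) <= A * x.
  rewrite -(ler_pM2r xi) -mulrA; apply: le_trans h2 _; exact: ler_wpM2l.
have -> : p`_i = (q * 'X + (p`_i)%:P).[x%:C%C] - q.[x%:C%C] * x%:C%C.
  by rewrite hornerMXaddC addrAC subrr add0r.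
by rewrite mulrDl; apply: le_trans (nrmB _ _) _; exact: lerD.
Qed.

Lemma bigO_eqm N p : eqm N p 0 -> bigO N (fun x => p.[x]).
Proof.
move=> h; have -> : p = (\poly_(j < size p) p`_(j + N)%N) * 'X^N.
  apply/polyP => j; rewrite coefMXn; case: ltnP => [jN|Nj]; first by rewrite h // coef0.
  rewrite coef_poly subnK //; case: ltnP => // hj; rewrite nth_default //.
  exact: leq_trans hj (leq_subr _ _).
rewrite -[N in bigO N]add0n.
apply: bigO_ext (bigOM (bigO_poly (\poly_(j < size p) p`_(j + N)%N)) (bigO_X N)) => x.
by rewrite hornerM hornerXn.
Qed.

(** Functions are linked to formal series through their expansions to each finite order; uniqueness
    of the polynomial modulo 'X^N then compares coefficients. *)
Definition asy f p N := bigO N (fun x => f x - p.[x]).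

Lemma asy_bounded f p N : asy f p N -> bigO 0 f.
Proof.
move=> h; apply: (@bigO_ext _ (fun x => f x - p.[x] + p.[x])); first by move=> x; rewrite subrK.
by apply: bigOD (bigO_poly p); exact: bigO_le h.
Qed.

Lemma asy_poly p N : asy (fun x => p.[x]) p N.
Proof.
have h : bigO N (fun x => (0 : {poly C}).[x]) by exact: bigO_eqm.
by apply: bigO_ext h => x; rewrite horner0 subrr.
Qed.

Lemma asyD f g p q N : asy f p N -> asy g q N -> asy (fun x => f x + g x) (p + q) N.
Proof. by move=> h h'; apply: bigO_ext (bigOD h h') => x; rewrite hornerD; ring. Qed.

Lemma asyM f g p q N : asy f p N -> asy g q N -> asy (fun x => f x * g x) (p * q) N.
Proof.
move=> h h'; have h1 := bigOM h (asy_bounded h'); have h2 := bigOM h' (bigO_poly p).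
rewrite addn0 in h1 h2.
by apply: bigO_ext (bigOD h1 h2) => x; rewrite hornerM; ring.
Qed.

Lemma asyX f p N k : asy f p N -> asy (fun x => f x ^+ k) (p ^+ k) N.
Proof.
move=> h; elim: k => [|k IH].
  by apply: bigO_ext (asy_poly 1 N) => x; rewrite hornerC expr0.
rewrite exprS; apply: bigO_ext (asyM h IH) => x; by rewrite exprS.
Qed.

Lemma asy_sum (I : Type) (r : seq I) (F : I -> C -> C) (P : I -> {poly C}) N :
  (forall i, asy (F i) (P i) N) ->
  asy (fun x => \sum_(i <- r) F i x) (\sum_(i <- r) P i) N.
Proof.
move=> h; elim: r => [|i r IH].
  by rewrite big_nil; apply: bigO_ext (asy_poly 0 N) => x; rewrite big_nil horner0.
by rewrite big_cons; apply: bigO_ext (asyD (h i) IH) => x; rewrite big_cons.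
Qed.

Lemma asy_uniq f p q N : asy f p N -> asy f q N -> eqm N p q.
Proof.
move=> h h' i iN; apply/eqP; rewrite -subr_eq0 -coefB.
apply/eqP; apply: (@bigO_coef N) iN; apply: bigO_ext (bigOB h' h) => x.
by rewrite hornerD hornerN; ring.
Qed.

Lemma asy_eqm f p q N : asy f p N -> eqm N p q -> asy f q N.
Proof.
move=> h e; have h' : bigO N (fun x => (p - q).[x]).
  by apply: bigO_eqm => i iN; rewrite coefB e // subrr coef0.
by apply: bigO_ext (bigOD h h') => x; rewrite hornerD hornerN; ring.
Qed.

Lemma asy_near f g p N : (exists2 d : R, 0 < d & forall x : C, nrm x < d -> f x = g x) ->
  asy f p N -> asy g p N.
Proof. by move=> [d d0 fg]; apply: bigO_near; exists d => // x /fg ->. Qed.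

Lemma asy_le f p N M : (N <= M)%N -> asy f p M -> asy f p N.
Proof. exact: bigO_le. Qed.

Lemma horner_tr (s : nat -> C) N x : (tr s N).[x] = \sum_(i < N) s i * x ^+ i.
Proof. by rewrite horner_poly. Qed.

Definition jexp (Psi : C -> C -> C) (b : nat -> nat -> C) := forall L, exists A d : R,
  [/\ 0 <= A, 0 < d & forall t x : C, nrm t < d -> nrm x < d ->
    nrm (Psi t x - \sum_(k < L) \sum_(i < L) b k i * (t ^+ k * x ^+ i)) <=
    A * (nrm t ^+ L + nrm x ^+ L)].

Lemma asy_subst Psi b (y : nat -> C) (f : C -> C) L : jexp Psi b -> y 0%N = 0 -> bigO 1 f ->
  asy f (tr y L) L -> asy (fun x => Psi (f x) x) (subst b L (tr y L)) L.
Proof.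
move=> jb y0 f1 fy.
have poly_part : asy (fun x => \sum_(k < L) \sum_(i < L) b k i * (f x ^+ k * x ^+ i))
    (subst b L (tr y L)) L.
  apply: asy_sum => k; apply: asy_sum => i; apply: asyM.
    by apply: bigO_ext (asy_poly (b k i)%:P L) => x; rewrite hornerC.
  apply: asyM; first exact: asyX.
  by apply: bigO_ext (asy_poly 'X^i L) => x; rewrite hornerXn.
have [A [d [A0 d0 hA]]] := jb L.
have [B [e [B0 e0 hB]]] := f1.
have rem : bigO L (fun x => Psi (f x) x - \sum_(k < L) \sum_(i < L) b k i * (f x ^+ k * x ^+ i)).
  exists (A * (B ^+ L + 1)), (Num.min (Num.min d e) (d / (B + 1))).
  have B1 : 0 < B + 1 by apply: ltr_wpDl.
  split; first by rewrite mulr_ge0 // addr_ge0 // exprn_ge0.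
    by rewrite !lt_min d0 e0 divr_gt0.
  move=> x; rewrite !lt_min => /andP[/andP[xd xe]]; rewrite ltr_pdivlMr // => xB.
  have fx : nrm (f x) <= B * nrm x by have := hB x xe; rewrite expr1.
  have fd : nrm (f x) < d.
    apply: le_lt_trans xB; apply: le_trans fx _.
    by rewrite mulrC; apply: ler_wpM2l; rewrite ?nrm_ge0 // lerDl.
  apply: le_trans (hA _ _ fd xd) _; rewrite -mulrA; apply: ler_wpM2l => //.
  rewrite mulrDl mul1r lerD2r -exprMn; apply: lerXn2r => //.
    by rewrite nnegrE nrm_ge0.
  by rewrite nnegrE mulr_ge0 ?nrm_ge0.
by apply: bigO_ext (bigOD rem poly_part) => x; ring.
Qed.

(** The coefficient of degree i is the same for all truncation orders L > i by uniqueness of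
    expansions, so the truncated substitutions define one formal series. *)
Lemma asy_series Psi b (y : nat -> C) (f : C -> C) : jexp Psi b -> y 0%N = 0 -> bigO 1 f ->
  (forall L, asy f (tr y L) L) ->
  exists2 s : nat -> C, (forall L i, (i < L)%N -> s i = (subst b L (tr y L))`_i) &
    forall L, asy (fun x => Psi (f x) x) (tr s L) L.
Proof.
move=> jb y0 f1 fy; pose s i := (subst b i.+1 (tr y i.+1))`_i.
have sE L i : (i < L)%N -> s i = (subst b L (tr y L))`_i.
  move=> iL; apply: (@asy_uniq (fun x => Psi (f x) x) _ _ i.+1) => //.
    exact: asy_subst.
  by apply: (@asy_le _ _ _ L) => //; exact: asy_subst.
exists s => // L; apply: asy_eqm (asy_subst jb y0 f1 (fy L)) _ => i iL.
by rewrite coef_tr iL (sE L).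
Qed.

(** Passage from functions to series: an identity valid near 0 holds for expansions of every
    order. *)
Lemma asy_vanish (P : {poly {poly C}}) (h : C -> C) (s : nat -> C) d : (size P <= d)%N ->
  (forall N, asy h (tr s N) N) ->
  (exists2 e : R, 0 < e & forall x : C, nrm x < e ->
     \sum_(k < d) (P`_k).[x] * h x ^+ k = 0) -> vanish P s.
Proof.
move=> sP hs rel N i iN; rewrite (horner_coef_wide _ sP) -[RHS](coef0 _ i).
apply: (@asy_uniq (fun x => \sum_(k < d) (P`_k).[x] * h x ^+ k) _ _ N) => //.
  by apply: asy_sum => k; apply: asyM; [exact: asy_poly|exact: asyX].
apply: asy_near (asy_poly 0 N).
by have [e e0 he] := rel; exists e => // x xe; rewrite he // horner0.
Qed.

End Asymptotics.

(** * Taylor coefficients and expansions in two complex variables *)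

Section Expansions.
Variable R : realType.
Local Notation C := (R[i]^o).
Implicit Types (f g : C -> C).

Lemma taylor_bigO f (c : nat -> C) (r K : R) : 0 < r -> (forall N (a : C), nrm a <= r / 2 ->
    nrm (f a - \sum_(k < N) c k * a ^+ k) <= 16 * K * (nrm a / r) ^+ N) ->
  forall N, asy f (tr c N) N.
Proof.
move=> r0 h N; exists (16 * `|K| * r^-1 ^+ N), (r / 2); split.
- by rewrite !mulr_ge0 // exprn_ge0 // invr_ge0 ltW.
- by rewrite divr_gt0.
move=> a ar; rewrite horner_tr; apply: le_trans (h N a (ltW ar)) _.
rewrite exprMn -!mulrA; apply: ler_wpM2l => //.
rewrite [nrm a ^+ N * _]mulrC; apply: ler_wpM2r; last exact: ler_norm.
by rewrite mulr_ge0 // exprn_ge0 ?nrm_ge0 // invr_ge0 ltW.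
Qed.

(** The term of degree k is the difference of two consecutive remainders, evaluated at r / 2. *)
Lemma taylor_term f (c : nat -> C) (r K : R) : 0 < r -> 0 <= K -> (forall N (a : C), nrm a <= r / 2 ->
    nrm (f a - \sum_(k < N) c k * a ^+ k) <= 16 * K * (nrm a / r) ^+ N) ->
  forall k, nrm (c k) <= 32 * K * r^-1 ^+ k.
Proof.
move=> r0 K0 h k; pose a : C := (r / 2)%:C%C.
have r20 : 0 < r / 2 by rewrite divr_gt0.
have na : nrm a = r / 2 by rewrite nrm_real gtr0_norm.
have ar : nrm a / r = 1 / 2 by rewrite na mulrAC divff ?lt0r_neq0.
have h1 := h k a; have := h k.+1 a; rewrite ar na lexx big_ord_recr /= => /(_ isT) h2.
rewrite ar na lexx in h1; have {}h1 := h1 isT.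
have half : (1 / 2 : R) ^+ k.+1 <= (1 / 2) ^+ k.
  by rewrite exprS ler_piMl // ?exprn_ge0 // ?divr_ge0 // ler_pdivrMr // mul1r ler1n.
have hc : nrm (c k * a ^+ k) <= 32 * K * (1 / 2) ^+ k.
  set S := \sum_(i < k) c i * a ^+ i in h1 h2.
  have -> : c k * a ^+ k = (f a - S) - (f a - (S + c k * a ^+ k)) by ring.
  apply: le_trans (nrmB _ _) _.
  have h3 : 16 * K * (1 / 2) ^+ k.+1 <= 16 * K * (1 / 2) ^+ k by apply: ler_wpM2l => //; rewrite mulr_ge0.
  have -> : 32 * K * (1 / 2) ^+ k = 16 * K * (1 / 2) ^+ k + 16 * K * (1 / 2) ^+ k by ring.
  by apply: lerD => //; exact: le_trans h2 h3.
move: hc; rewrite nrmM nrmX na => hc.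
have rk : 0 < (r / 2) ^+ k by rewrite exprn_gt0.
rewrite -(ler_pM2r rk); apply: le_trans hc _.
by rewrite -[leRHS]mulrA -exprMn mulrA mulVf ?lt0r_neq0 // mul1r.
Qed.

Lemma coef_bound f (c : nat -> C) (r K : R) k : 0 < r -> 0 <= K ->
  (forall z, nrm z < 2 * r -> differentiable f z) ->
  (forall z, nrm z < 2 * r -> nrm (f z) <= K) -> asy f (tr c k.+1) k.+1 ->
  nrm (c k) <= 32 * K * r^-1 ^+ k.
Proof.
move=> r0 K0 df fK fc; have [c' hc'] := taylor r0 df fK.
have := asy_uniq fc (taylor_bigO r0 hc' k.+1) (ltnSn k).
rewrite !coef_tr ltnSn => ->; exact: (taylor_term r0 K0 hc').
Qed.

Lemma differentiable_subc (V : normedModType R[i]) (f g : V -> C) x :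
  differentiable f x -> differentiable g x -> differentiable (fun y => f y - g y) x.
Proof. exact: differentiableB. Qed.

Lemma differentiable_mulc (V : normedModType R[i]) (f : V -> C) (k : C) x :
  differentiable f x -> differentiable (fun y => f y * k) x.
Proof.
move=> df; have := differentiableZ k df.
suff -> : (fun y => f y * k : C) = k *: f by [].
by apply/funext => y /=; exact: mulrC.
Qed.

Lemma differentiable_sumc (V : normedModType R[i]) N (f : 'I_N -> V -> C) x :
  (forall i, differentiable (f i) x) -> differentiable (fun y => \sum_(i < N) f i y) x.
Proof.
move=> df; have := differentiable_sum df.
suff -> : (fun y => \sum_(i < N) f i y) = \sum_(i < N) f i by [].
by apply/funext => y /=; rewrite fct_sumE.
Qed.

Lemma half_lt_double (u : R) : 0 < u -> u / 2 < 2 * u.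
Proof. by lra. Qed.

Lemma sum_pair_bound (a b T Y : R) : 0 <= a -> 0 <= b -> 0 <= T -> 0 <= Y ->
  a * T + b * Y <= (a + b) * (T + Y).
Proof. by nra. Qed.

Section TwoVariables.
Variables (Psi : C -> C -> C) (sg rho K : R).
Hypothesis sg0 : 0 < sg.
Hypothesis rho0 : 0 < rho.
Hypothesis K0 : 0 <= K.
Hypothesis dt : forall t x, nrm t < 2 * sg -> nrm x < 2 * rho -> differentiable (Psi ^~ x) t.
Hypothesis dx : forall t x, nrm t < 2 * sg -> nrm x < 2 * rho -> differentiable (Psi t) x.
Hypothesis PsiK : forall t x, nrm t < 2 * sg -> nrm x < 2 * rho -> nrm (Psi t x) <= K.

(** Expansion in t with x frozen. The coefficients are shown holomorphic in x by induction on k, so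
    that they can be expanded in turn. *)
Lemma tau_expansion : exists c : nat -> C -> C,
  [/\ forall x, nrm x < 2 * rho -> forall N t, nrm t <= sg / 2 ->
        nrm (Psi t x - \sum_(k < N) c k x * t ^+ k) <= 16 * K * (nrm t / sg) ^+ N,
      forall k x, nrm x < 2 * rho -> differentiable (c k) x &
      forall k x, nrm x < 2 * rho -> nrm (c k x) <= 32 * K * sg^-1 ^+ k].
Proof.
have /choice[c cP] : forall x : C, exists c : nat -> C, nrm x < 2 * rho -> forall N t, nrm t <= sg / 2 ->
    nrm (Psi t x - \sum_(k < N) c k * t ^+ k) <= 16 * K * (nrm t / sg) ^+ N.
  move=> x; have [xr|xr] := ltP (nrm x) (2 * rho); last by exists (fun=> 0).
  have [c hc] := @taylor _ (Psi ^~ x) sg K sg0 (fun t ht => dt ht xr) (fun t ht => PsiK ht xr).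
  by exists c.
exists (fun k x => c x k); split => //; last first.
  by move=> k x xr; exact: (taylor_term sg0 K0 (cP x xr)).
move=> k; elim/ltn_ind: k => k IH x xr.
(* the k-th coefficient is the uniform limit of the divided remainders as t -> 0 *)
pose tm (m : nat) : C := (sg / 2 / m.+1%:R)%:C%C.
have tm0 (m : nat) : 0 < sg / 2 / m.+1%:R by rewrite !divr_gt0.
have ntm m : nrm (tm m) = sg / 2 / m.+1%:R by rewrite nrm_real gtr0_norm.
have tmn0 m : tm m != 0.
  by apply/eqP => e; have := tm0 m; rewrite -ntm e nrm0 ltxx.
have tms m : nrm (tm m) <= sg / 2.
  rewrite ntm ler_pdivrMr // ler_peMr //; first by rewrite divr_ge0 // ltW.
  by rewrite ler1n.
have tms2 m : nrm (tm m) < 2 * sg.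
  apply: le_lt_trans (tms m) _; exact: half_lt_double.
pose F m y := (Psi (tm m) y - \sum_(i < k) c y i * tm m ^+ i) * (tm m ^+ k)^-1.
have gap : 0 < 2 * rho - nrm x by rewrite subr_gt0.
have near y : nrm (y - x) < 2 * rho - nrm x -> nrm y < 2 * rho.
  move=> h; rewrite -[y](subrK x); apply: le_lt_trans (nrmD _ _) _.
  by rewrite -ltrBrDr.
apply: (@weierstrass _ _ F _ x _ gap).
  move=> m y /near yr; apply: differentiable_mulc; apply: differentiable_subc.
    exact: dx.
  by apply: differentiable_sumc => i; apply: differentiable_mulc; apply: IH.
move=> e e0.
have [N hN] := arch_small (16 * K * sg^-1 ^+ k.+1 * (sg / 2)) e0.
exists N => m y Nm /near yr.
have FE : F m y - c y k = (Psi (tm m) y - \sum_(i < k.+1) c y i * tm m ^+ i) * (tm m ^+ k)^-1.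
  rewrite /F big_ord_recr /= opprD addrA [RHS]mulrDl mulNr mulfK //.
  by rewrite expf_neq0.
rewrite FE nrmM nrmV nrmX.
have nt : 0 < nrm (tm m) by rewrite ntm.
rewrite ler_pdivrMr ?exprn_gt0 //.
apply: le_trans (cP y yr k.+1 (tm m) (tms m)) _.
rewrite exprMn [nrm (tm m) ^+ k.+1]exprS.
have -> : 16 * K * (nrm (tm m) * nrm (tm m) ^+ k * sg^-1 ^+ k.+1) =
  16 * K * sg^-1 ^+ k.+1 * nrm (tm m) * nrm (tm m) ^+ k by ring.
apply: ler_wpM2r; first by rewrite exprn_ge0 ?nrm_ge0.
apply: le_trans hN; rewrite ntm mulrA; apply: inv_mono => //.
by rewrite !mulr_ge0 // ?exprn_ge0 ?invr_ge0 // ltW.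
Qed.

(** The coefficients in t are expanded in x. The first estimate is uniform in t, so Cauchy bounds
    make every coefficient with k > 0 a O(x^m); the second identifies the coefficient with k = 1 as
    [xi]. *)
Lemma joint_expansion (w xi : C -> C) (m : nat) (B : R) : 0 <= B ->
  (forall t x, nrm t < 2 * sg -> nrm x <= rho / 2 -> nrm (Psi t x - w x) <= B * nrm x ^+ m) ->
  (forall t x, nrm t < 2 * sg -> nrm x <= rho / 2 ->
     nrm (Psi t x - w x - t * xi x) <= B * nrm t ^+ 2) ->
  exists b : nat -> nat -> C, [/\ jexp Psi b,
    forall k i, (0 < k)%N -> (i < m)%N -> b k i = 0 & forall N, asy xi (tr (b 1%N) N) N].
Proof.
move=> B0 ord_m lin; have [c [cP cd cK]] := tau_expansion.
have KS k : 0 <= 32 * K * sg^-1 ^+ k.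
  by rewrite !mulr_ge0 // exprn_ge0 // invr_ge0 ltW.
have /choice[b bP] : forall k, exists bk : nat -> C, forall N x, nrm x <= rho / 2 ->
    nrm (c k x - \sum_(i < N) bk i * x ^+ i) <= 16 * (32 * K * sg^-1 ^+ k) * (nrm x / rho) ^+ N.
  by move=> k; apply: taylor => // x xr; [exact: cd|exact: cK].
have s20 : 0 < sg / 2 by rewrite divr_gt0.
have r20 : 0 < rho / 2 by rewrite divr_gt0.
have ce x k : nrm x <= rho / 2 -> asy (Psi ^~ x) (tr (c^~ x) k) k.
  move=> xr; apply: (taylor_bigO sg0) => N a; apply: cP.
  by apply: le_lt_trans xr _; exact: half_lt_double.
exists b; split.
- move=> L.
  pose A := 16 * K * sg^-1 ^+ L + L%:R * (16 * (32 * K) * rho^-1 ^+ L).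
  have A1 : 0 <= 16 * K * sg^-1 ^+ L by rewrite !mulr_ge0 // exprn_ge0 // invr_ge0 ltW.
  have A2 : 0 <= L%:R * (16 * (32 * K) * rho^-1 ^+ L).
    by rewrite !mulr_ge0 // exprn_ge0 // invr_ge0 ltW.
  exists A, (Num.min (sg / 2) (rho / 2)); split; first exact: addr_ge0.
    by rewrite lt_min s20.
  move=> t x; rewrite !lt_min => /andP[ts _] /andP[_ xr].
  have xr2 : nrm x < 2 * rho by apply: lt_trans xr _; exact: half_lt_double.
  have e1 := cP x xr2 L t (ltW ts).
  have -> : Psi t x - \sum_(k < L) \sum_(i < L) b k i * (t ^+ k * x ^+ i) =
    (Psi t x - \sum_(k < L) c k x * t ^+ k) +
    \sum_(k < L) (c k x - \sum_(i < L) b k i * x ^+ i) * t ^+ k.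
    under [X in _ = _ + X]eq_bigr do rewrite mulrBl.
    rewrite sumrB addrA subrK; congr (_ - _); apply: eq_bigr => k _.
    by rewrite mulr_suml; apply: eq_bigr => i _; rewrite mulrAC -mulrA.
  apply: le_trans (nrmD _ _) _.
  have e2 : nrm (\sum_(k < L) (c k x - \sum_(i < L) b k i * x ^+ i) * t ^+ k) <=
      L%:R * (16 * (32 * K) * rho^-1 ^+ L) * nrm x ^+ L.
    apply: le_trans (nrm_sum _ _ _) _.
    apply: (@le_trans _ _ (\sum_(k < L) (16 * (32 * K) * rho^-1 ^+ L) * nrm x ^+ L)); last first.
      by rewrite sumr_const card_ord -[X in X <= _]mulr_natl mulrA.
    apply: ler_sum => k _; rewrite nrmM nrmX.
    have h := bP k L x (ltW xr).
    apply: le_trans (ler_wpM2r _ h) _; first by rewrite exprn_ge0 ?nrm_ge0.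
    have -> : 16 * (32 * K * sg^-1 ^+ k) * (nrm x / rho) ^+ L * nrm t ^+ k =
      16 * (32 * K) * rho^-1 ^+ L * nrm x ^+ L * (nrm t / sg) ^+ k.
      by rewrite !exprMn; ring.
    apply: ler_piMr; first by rewrite !mulr_ge0 // exprn_ge0 ?nrm_ge0 // invr_ge0 ltW.
    apply: exprn_ile1; first by rewrite divr_ge0 ?nrm_ge0 // ltW.
    rewrite ler_pdivrMr // mul1r; apply: ltW; apply: lt_trans ts _.
    by rewrite ltr_pdivrMr // ltr_pMr // ltr1n.
  apply: le_trans (lerD e1 e2) _.
  rewrite exprMn; set T := nrm t ^+ L; set Y := nrm x ^+ L.
  have T0 : 0 <= T by rewrite exprn_ge0 ?nrm_ge0.
  have Y0 : 0 <= Y by rewrite exprn_ge0 ?nrm_ge0.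
  have -> : 16 * K * (T * sg^-1 ^+ L) = 16 * K * sg^-1 ^+ L * T by ring.
  exact: sum_pair_bound.
- move=> k i k0 im.
  have ck : bigO m (c k).
    exists (32 * B * sg^-1 ^+ k), (rho / 2); split => //.
      by rewrite !mulr_ge0 // exprn_ge0 // invr_ge0 ltW.
    move=> x xr.
    (* Subtracting [w x] alters only the coefficient of degree 0 in t. *)
    pose c' l := if l is l'.+1 then c l x else c 0%N x - w x.
    have xr2 : nrm x < 2 * rho by apply: lt_trans xr _; exact: half_lt_double.
    have ord' : asy (fun t => Psi t x - w x) (tr c' k.+1) k.+1.
      apply: bigO_ext (ce x k.+1 (ltW xr)) => t; rewrite !horner_tr !big_ord_recl /= expr0 !mulr1.
      have -> : \sum_(j < k) c' (bump 0 j) * t ^+ bump 0 j =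
        \sum_(j < k) c (bump 0 j) x * t ^+ bump 0 j by [].
      by ring.
    have -> : c k x = c' k by case: k k0 {ord'}.
    have -> : 32 * B * sg^-1 ^+ k * nrm x ^+ m = 32 * (B * nrm x ^+ m) * sg^-1 ^+ k by ring.
    apply: (@coef_bound (fun t => Psi t x - w x)).
    + exact: sg0.
    + by rewrite mulr_ge0 // exprn_ge0 ?nrm_ge0.
    + move=> t ts; apply: differentiable_subc; first exact: dt.
      exact: differentiable_cst.
    + by move=> t ts; apply: (ord_m _ _ ts); exact: ltW.
    + exact: ord'.
  have h : asy (c k) (tr (b k) m) m.
    by apply: (@taylor_bigO _ _ rho (32 * K * sg^-1 ^+ k)) => // N a; exact: bP.
  have h0 : asy (c k) 0 m by apply: bigO_ext ck => x; rewrite horner0 subr0.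
  by have := asy_uniq h h0 im; rewrite coef_tr im coef0.
- move=> N; have h : asy (c 1%N) (tr (b 1%N) N) N.
    by apply: (@taylor_bigO _ _ rho (32 * K * sg^-1 ^+ 1)) => // M a; exact: bP.
  apply: asy_near h; exists (rho / 2) => // x xr.
  have h2 : asy (Psi ^~ x) (tr (fun l => if l is 0 then w x else xi x) 2) 2.
    exists B, (2 * sg); split; rewrite ?mulr_gt0 // => t ts.
    rewrite horner_tr !big_ord_recl big_ord0 /= expr0 expr1 mulr1 addr0 opprD addrA [xi x * t]mulrC.
    by apply: lin => //; exact: ltW.
  by have := asy_uniq (ce x 2%N (ltW xr)) h2 (isT : (1 < 2)%N); rewrite !coef_tr.
Qed.

End TwoVariables.
End Expansions.

(** * Expansion of the flow along a line through the base point *)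

Section FlowLine.
Variables (R : realType) (n : nat).
Local Notation C := (R[i]^o).
Local Notation Cn := 'rV[C]_n.
Variables (X : Cn -> Cn) (K L : R) (p : Cn) (r : R).
Hypothesis XK : forall z, nrm (X z) <= K.
Hypothesis XL : forall z w, nrm (X z - X w) <= L * nrm (z - w).
Hypothesis L0 : 0 <= L.
Hypothesis r0 : 0 < r.
Hypothesis dX : forall z, nrm (z - p) < r -> differentiable X z.
Hypothesis K0 : 0 <= K.

Lemma time_scale (a c : R) : 0 <= a -> 0 < c -> exists2 s : R, 0 < s & forall t, 0 <= t <= s -> t * a <= c.
Proof.
move=> a0 c0; have a1 : 0 < a + 1 by apply: ltr_wpDl.
exists (c / (a + 1)); first exact: divr_gt0.
move=> t /andP[t0]; rewrite ler_pdivlMr // => ts; apply: le_trans ts.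
by apply: ler_wpM2l => //; rewrite lerDl.
Qed.

Lemma half_pow_small (a A : R) : 0 <= A -> (forall N, a <= A * (1 / 2) ^+ N) -> a <= 0.
Proof.
move=> A0 h; rewrite leNgt; apply/negP => a0.
have [N hN] := arch_small A (divr_gt0 a0 (ltr0Sn _ 1) : 0 < a / 2).
have := h N; apply/negP; rewrite -ltNge; apply: (@le_lt_trans _ _ (a / 2)); last first.
  by rewrite ltr_pdivrMr // ltr_pMr // ltr1n.
apply: le_trans hN; apply: ler_wpM2l => //.
rewrite mul1r exprVn lef_pV2 ?posrE ?ltr0n ?exprn_gt0 //.
by rewrite -natrX ler_nat; exact: ltn_expl.
Qed.

Lemma line_near u (x : C) : nrm u < r / 8 -> nrm x < 4 -> nrm (p + x *: u - p) < r / 2.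
Proof.
move=> ur x4; rewrite addrAC subrr add0r nrmZ.
have -> : r / 2 = 4 * (r / 8) by field.
by apply: ltr_pM; rewrite ?nrm_ge0.
Qed.

(* m is the vanishing order of X along the line p + x u, and j a component where it is attained:
   every positive power of the time comes with a factor x^m. *)
Lemma flow_line_expansion u : nrm u < r / 8 -> X (p + u) != 0 ->
  exists (j : 'I_n) (m : nat) (b : nat -> nat -> C),
    [/\ jexp (fun t x => Phi X t (p + x *: u) ord0 j) b,
        forall k i, (0 < k)%N -> (i < m)%N -> b k i = 0 & b 1%N m != 0].
Proof.
move=> ur Xu.
have r2 : r / 2 < r by rewrite ltr_pdivrMr // ltr_pMr // ltr1n.
(* For |x| < 4 the point p + x u stays within r / 2 of [p]. This gives Taylor radius 2, with an
   expansion valid for |x| <= 1, which includes the point x = 1 where the field is nonzero. *)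
have /choice[d dP] : forall l : 'I_n, exists c : nat -> C, forall N (x : C), nrm x <= 2 / 2 ->
    nrm ((X (p + x *: u) ord0 l : C) - \sum_(i < N) c i * x ^+ i) <= 16 * K * (nrm x / 2) ^+ N.
  move=> l; apply: taylor => // x; rewrite -natrM => x4.
    apply: (@differentiable_line _ _ _ (fun z => X z ord0 l : C)); apply: differentiable_entry.
    by apply: dX; apply: lt_trans r2; exact: line_near.
  exact: le_trans (nrm_coord _ _) (XK _).
(* If all coefficients were zero, the remainder bound 16 K / 2^N at x = 1 would force X (p + u) =
   0. *)
have ex : exists i, [exists l, d l i != 0].
  apply: contrapT => H; move/eqP: Xu; apply; apply: nrm0_eq0; apply/eqP.
  rewrite eq_le nrm_ge0 andbT; apply: (@half_pow_small _ (16 * K)); first by rewrite mulr_ge0.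
  move=> N; apply/nrm_rV; first by rewrite !mulr_ge0 // exprn_ge0 // divr_ge0.
  move=> l; have := dP l N 1; rewrite nrm1 divff // lexx scale1r => /(_ isT).
  rewrite big1 ?subr0 // => i _; have [->|dli] := eqVneq (d l i) 0; first by rewrite mul0r.
  by exfalso; apply: H; exists i; apply/existsP; exists l.
case: (ex_minnP ex) => m /existsP[j djm] minm.
have dlt l i : (i < m)%N -> d l i = 0.
  move=> im; apply/eqP/negPn/negP => dli; have := minm i; rewrite leqNgt im => /(_ _)/negP; apply => //.
  by apply/existsP; exists l.
have Xm (x : C) : nrm x <= 1 -> nrm (X (p + x *: u)) <= 16 * K * nrm x ^+ m.
  move=> x1; apply/nrm_rV; first by rewrite !mulr_ge0 // exprn_ge0 ?nrm_ge0.
  move=> l; have := dP l m x; rewrite divff // => /(_ x1).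
  rewrite big1 ?subr0 => [|i _]; last by rewrite dlt // mul0r.
  move=> h; apply: le_trans h _; apply: ler_wpM2l; first by rewrite mulr_ge0.
  apply: lerXn2r; rewrite ?nnegrE ?divr_ge0 ?nrm_ge0 //.
  by rewrite ler_pdivrMr // ler_peMr ?nrm_ge0 // ler1n.
have [s1 s10 hs1] := @time_scale (2 * L) 1 (mulr_ge0 (ler0n _ _) L0) ltr01.
have [s2 s20 hs2] := @time_scale K (r / 2) K0 (divr_gt0 r0 (ltr0Sn _ 1)).
pose sg := Num.min s1 s2 / 2.
have sg0 : 0 < sg by rewrite divr_gt0 // lt_min s10.
have sgE : 2 * sg = Num.min s1 s2 by rewrite mulrC divfK.
have tL (t : C) : nrm t < 2 * sg -> 2 * nrm t * L <= 1.
  rewrite sgE lt_min => /andP[ts _]; have := hs1 (nrm t); rewrite nrm_ge0 ltW //= => /(_ isT).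
  by rewrite mulrCA mulrA.
have tK (t : C) : nrm t < 2 * sg -> K * nrm t <= r / 2.
  rewrite sgE lt_min => /andP[_ ts]; have := hs2 (nrm t); rewrite nrm_ge0 ltW //= => /(_ isT).
  by rewrite mulrC.
have s20' : 0 < 2 * sg by rewrite mulr_gt0.
(* The first summand serves the estimate of order [m] in x, the second the estimate of order 2 in
   t. *)
pose B := 64 * sg * K + L * K.
have sgw := ltW sg0.
have B0 : 0 <= B by rewrite /B addr_ge0 // mulr_ge0 // mulr_ge0.
have two4 : 2 * 2 = 4 :> R by rewrite -natrM.
have n4 (x : C) : nrm x < 2 * 2 -> nrm x < 4 by rewrite two4.
have h : exists b : nat -> nat -> C, [/\ jexp (fun t x => Phi X t (p + x *: u) ord0 j) b,
    forall k i, (0 < k)%N -> (i < m)%N -> b k i = 0 &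
    forall N, asy (fun x => X (p + x *: u) ord0 j) (tr (b 1%N) N) N].
  apply: (@joint_expansion _ _ sg 2 (r + nrm p) sg0 _ _ _ _ _ (fun x => (p + x *: u) ord0 j) _ m B B0) => //.
  - by rewrite addr_ge0 ?nrm_ge0 // ltW.
  - move=> t x ts /n4 x4.
    apply: (@differentiable_entry _ _ _ (fun s : C => Phi X s (p + x *: u))).
    have gap : 0 < 2 * sg - nrm t by rewrite subr_gt0.
    apply: (Phi_differentiable XK XL L0 r0 dX K0 (g := fun s => s) (F := fun=> p + x *: u) gap).
    move=> s hs; have ss : nrm s < 2 * sg.
      by rewrite -[s](subrK t); apply: le_lt_trans (nrmD _ _) _; rewrite -ltrBrDr.
    split; [by []|exact: differentiable_cst|exact: tL|exact: tK|exact: line_near].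
  - move=> t x ts /n4 x4.
    apply: (@differentiable_entry _ _ _ (fun s : C => Phi X t (p + s *: u))).
    have gap : 0 < 4 - nrm x by rewrite subr_gt0.
    apply: (Phi_differentiable XK XL L0 r0 dX K0 (V := C) (g := fun=> t) (F := fun s : C => p + s *: u) gap).
    move=> s hs; have ss : nrm s < 4.
      by rewrite -[s](subrK x); apply: le_lt_trans (nrmD _ _) _; rewrite -ltrBrDr.
    split; [exact: differentiable_cst|exact: differentiable_affine|exact: tL|exact: tK|exact: line_near].
  - move=> t x ts /n4 x4; apply: le_trans (nrm_coord _ _) _.
    set z := p + x *: u; rewrite -[Phi X t z](subrK z); apply: le_trans (nrmD _ _) _.
    have e1 : nrm (Phi X t z - z) <= r / 2.
      by apply: le_trans (Phi_distK XK XL L0 _ (tL _ ts)) _; rewrite mulrC; exact: tK.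
    have e2 : nrm z <= r / 2 + nrm p.
      rewrite -[z](subrK p); apply: le_trans (nrmD _ _) _; rewrite lerD2r; apply: ltW.
      exact: line_near.
    apply: le_trans (lerD e1 e2) _; rewrite addrA -splitr lexx //.
  - move=> t x ts; rewrite divff // => x1.
    have -> : (Phi X t (p + x *: u) ord0 j - (p + x *: u) ord0 j : C) =
      (Phi X t (p + x *: u) - (p + x *: u)) ord0 j by rewrite !mxE.
    apply: le_trans (nrm_coord _ _) _; apply: le_trans (Phi_dist XK XL L0 _ (tL _ ts)) _.
    have h1 : 2 * nrm t * nrm (X (p + x *: u)) <= 2 * (2 * sg) * (16 * K * nrm x ^+ m).
      by apply: ler_pM; rewrite ?mulr_ge0 ?nrm_ge0 // ?Xm // ler_wpM2l // ltW.
    apply: le_trans h1 _.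
    have -> : 2 * (2 * sg) * (16 * K * nrm x ^+ m) = 64 * sg * K * nrm x ^+ m by ring.
    by rewrite /B [leRHS]mulrDl lerDl !mulr_ge0 // exprn_ge0 ?nrm_ge0.
  - move=> t x ts _.
    have -> : (Phi X t (p + x *: u) ord0 j - (p + x *: u) ord0 j - t * X (p + x *: u) ord0 j : C) =
      (Phi X t (p + x *: u) - (p + x *: u) - t *: X (p + x *: u)) ord0 j by rewrite !mxE.
    apply: le_trans (nrm_coord _ _) _; apply: le_trans (Phi_loc XK XL L0 _ (tL _ ts)) _.
    rewrite mulrC; apply: ler_wpM2r; first by rewrite exprn_ge0 ?nrm_ge0.
    by rewrite /B lerDr mulr_ge0 // mulr_ge0.
have [b [jb b0 bX]] := h; exists j, m, b; split => //.
have dj : asy (fun x => X (p + x *: u) ord0 j) (tr (d j) m.+1) m.+1.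
  by apply: (@taylor_bigO _ (fun x : C => X (p + x *: u) ord0 j) (d j) 2 K) => // N x; exact: dP.
have := asy_uniq (bX m.+1) dj (ltnSn m); rewrite !coef_tr ltnSn => ->; exact: djm.
Qed.

End FlowLine.

(** * The transcendental series with coefficients g *)

Section Gamma.
Variable R : realType.
Local Notation C := (R[i]^o).
Variable g : nat -> R.
Hypothesis g1 : forall N, 0 < g N <= 1.

Let S (N : nat) (x : C) : C := \sum_(i < N) (g i)%:C%C * x ^+ i.+1.

Lemma gser_cauchy (x : C) N k : nrm x <= 1 / 2 -> nrm (S (N + k) x - S N x) <= 2 * nrm x ^+ N.+1.
Proof.
move=> x2; have nx := nrm_ge0 x.
suff : nrm (S (N + k) x - S N x) <= 2 * nrm x ^+ N.+1 - 2 * nrm x ^+ (N + k).+1.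
  by move=> h; apply: le_trans h _; rewrite lerBlDr lerDl mulr_ge0 // exprn_ge0.
elim: k => [|k IH]; first by rewrite addn0 !subrr nrm0.
rewrite addnS /S big_ord_recr /= -/(S (N + k) x) addrAC.
apply: le_trans (nrmD _ _) _.
have e1 : nrm ((g (N + k)%N)%:C%C * x ^+ (N + k).+1 : C) <= nrm x ^+ (N + k).+1.
  rewrite nrmM nrmX nrm_real; have /andP[ga gb] := g1 (N + k).
  by rewrite gtr0_norm // ler_piMl // exprn_ge0.
have e2 : nrm x ^+ (N + k).+2 <= 1 / 2 * nrm x ^+ (N + k).+1.
  by rewrite exprS; apply: ler_wpM2r => //; rewrite exprn_ge0.
apply: le_trans (lerD IH e1) _.
by move: (nrm x ^+ (N + k).+1) (nrm x ^+ (N + k).+2) (nrm x ^+ N.+1) e2 => a b c; lra.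
Qed.

Lemma gser_ex : exists gam : C -> C, forall x, nrm x <= 1 / 2 ->
  forall N, nrm (gam x - S N x) <= 2 * nrm x ^+ N.+1.
Proof.
have : forall x : C, exists l : C, nrm x <= 1 / 2 -> forall N, nrm (l - S N x) <= 2 * nrm x ^+ N.+1.
  move=> x; have [x2|x2] := leP (nrm x) (1 / 2); last by exists 0.
  have [l hl] : exists l, nrm_cvg (S ^~ x) l.
    apply: c_complete => e e0.
    have [N hN] : exists N, 2 * nrm x ^+ N.+1 <= e / 2.
      have [N hN] := arch_small (2 : R) (divr_gt0 e0 (ltr0Sn _ 1)); exists N.
      apply: le_trans hN; apply: ler_wpM2l => //.
      apply: (@le_trans _ _ ((1 / 2) ^+ N.+1)).
        by apply: lerXn2r; rewrite ?nnegrE ?nrm_ge0 // divr_ge0.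
      rewrite mul1r exprVn lef_pV2 ?posrE ?ltr0n ?exprn_gt0 //.
      by rewrite -natrX ler_nat; apply: ltnW; exact: ltn_expl.
    exists N => m l Nm Nl; apply: le_trans (nrm_tri (S N x) _ _) _.
    rewrite [e]splitr; apply: lerD.
      by rewrite -(subnKC Nm); apply: le_trans hN; exact: gser_cauchy.
    by rewrite nrmC -(subnKC Nl); apply: le_trans hN; exact: gser_cauchy.
  exists l => _ N; apply: (nrm_cvg_le (N0 := N) hl) => m Nm.
  by rewrite -(subnKC Nm); exact: gser_cauchy.
by move=> /choice[gam h]; exists gam.
Qed.

(** On the disc of radius 1/2 this is the sum of the g i x^(i + 1), hence zero at 0; elsewhere the
    value is arbitrary. *)
Definition gam : C -> C := sval (cid gser_ex).

Lemma gam_rem x N : nrm x <= 1 / 2 -> nrm (gam x - S N x) <= 2 * nrm x ^+ N.+1.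
Proof. by move=> x2; exact: (svalP (cid gser_ex)). Qed.

Lemma gam_le x : nrm x <= 1 / 2 -> nrm (gam x) <= 2 * nrm x.
Proof. by move=> /(gam_rem 0); rewrite /S big_ord0 subr0 expr1. Qed.

Lemma gam_real (x : R) : `|x| <= 1 / 2 -> complex.Im (gam x%:C%C) = 0.
Proof.
move=> x2; have nx : nrm (x%:C%C : C) = `|x| by exact: nrm_real.
have ImS N : complex.Im (S N x%:C%C) = 0.
  rewrite /S; elim: N => [|N IH]; first by rewrite big_ord0.
  by rewrite big_ord_recr /= ImD IH add0r -rmorphXn /= mulr0 mul0r addr0.
apply/eqP; rewrite -normr_eq0 eq_le normr_ge0 andbT.
apply: (@half_pow_small _ _ 1) => // N.
have -> : complex.Im (gam x%:C%C) = complex.Im (gam x%:C%C - S N x%:C%C : C).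
  by rewrite ImD ImN ImS oppr0 addr0.
apply: le_trans (nrm_Im _) _; apply: le_trans (gam_rem N _) _; rewrite ?nx // exprS.
have e : `|x| ^+ N <= (1 / 2) ^+ N by apply: lerXn2r; rewrite ?nnegrE // divr_ge0.
have x0 := normr_ge0 x; have p0 : 0 <= `|x| ^+ N by rewrite exprn_ge0.
by move: (`|x| ^+ N) ((1/2) ^+ N) e p0 x0 x2 => a b; nra.
Qed.

Lemma gam_differentiable x : nrm x < 1 / 2 -> differentiable gam x.
Proof.
move=> x2; have gap : 0 < 1 / 2 - nrm x by rewrite subr_gt0.
apply: (@weierstrass _ _ S gam x _ gap).
  move=> m z _; apply: (@differentiable_sumc _ _ _ (fun i (z : C) => (g i)%:C%C * z ^+ i.+1 : C)) => i.
  have e (k : nat) : differentiable (fun z : C => z ^+ k : C) z.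
    elim: k => [|k IH]; first exact: differentiable_cst.
    suff -> : (fun z : C => z ^+ k.+1 : C) = (fun z : C => z : C) * (fun z : C => z ^+ k : C).
      by exact: differentiableM.
    by apply/funext => y; rewrite exprS.
  have := differentiable_mulc (g i)%:C%C (e i.+1).
  by under eq_fun do rewrite mulrC.
move=> e e0; have [N hN] := arch_small (2 : R) e0; exists N => m z Nm hz.
have z2 : nrm z <= 1 / 2.
  by apply: ltW; rewrite -[z](subrK x); apply: le_lt_trans (nrmD _ _) _; rewrite -ltrBrDr.
rewrite nrmC; apply: le_trans (gam_rem m z2) _.
apply: le_trans hN; apply: (@le_trans _ _ (2 / m.+1%:R)); last exact: inv_mono.
apply: ler_wpM2l => //; apply: (@le_trans _ _ ((1 / 2) ^+ m.+1)).
  by apply: lerXn2r; rewrite ?nnegrE ?nrm_ge0 // divr_ge0.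
rewrite mul1r exprVn lef_pV2 ?posrE ?ltr0n ?exprn_gt0 //.
by rewrite -natrX ler_nat; apply: ltnW; exact: ltn_expl.
Qed.

(** Cauchy estimate on the disc of radius 1/2, where [gam] is bounded by 1: the constant is 64 /
    (1/2) and the radius (1/2) / 16. The latter reappears in the final neighbourhood. *)
Lemma gam_lip x y : nrm x <= 1 / 32 -> nrm y <= 1 / 32 -> nrm (gam x - gam y) <= 128 * nrm (x - y).
Proof.
move=> hx hy.
have h : (1 / 2 : R) / 16 = 1 / 32 by field.
have -> : 128 = 64 * 1 / (1 / 2) :> R by field.
apply: (@cauchy_lipschitz _ _ gam 0 (1 / 2) 1); rewrite ?h ?subr0 //.
- by move=> z; rewrite subr0; exact: gam_differentiable.
- move=> z; rewrite subr0 => z2; apply: le_trans (gam_le (ltW z2)) _.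
  by lra.
Qed.

(* v is the last coordinate of the direction of a line through p. *)
Lemma gam_asy (t v : C) L : asy (fun x => t * gam (x * v))
  (tr (fun i => if i is i'.+1 then t * ((g i')%:C%C * v ^+ i) else 0) L) L.
Proof.
case: L => [|L].
  exists (nrm t), (1 / (2 * (nrm v + 1))); split; rewrite ?nrm_ge0 //.
    by rewrite divr_gt0 // mulr_gt0 // ltr_wpDl ?nrm_ge0.
  move=> x; rewrite ltr_pdivlMr; last by rewrite mulr_gt0 // ltr_wpDl ?nrm_ge0.
  move=> hx; rewrite expr0 horner_tr big_ord0 subr0 nrmM; apply: ler_wpM2l; rewrite ?nrm_ge0 //.
  have nx := nrm_ge0 x; have nv := nrm_ge0 v.
  have xv : nrm (x * v : C) <= 1 / 2.
    by rewrite nrmM; move: (nrm x) (nrm v) hx nx nv => a b; nra.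
  by apply: le_trans (gam_le xv) _; lra.
exists (nrm t * (2 * nrm v ^+ L.+1)), (1 / (2 * (nrm v + 1))); split.
- by rewrite !mulr_ge0 ?nrm_ge0 // exprn_ge0 ?nrm_ge0.
- by rewrite divr_gt0 // mulr_gt0 // ltr_wpDl ?nrm_ge0.
move=> x; rewrite ltr_pdivlMr; last by rewrite mulr_gt0 // ltr_wpDl ?nrm_ge0.
move=> hx; have nx := nrm_ge0 x; have nv := nrm_ge0 v.
have xv : nrm (x * v : C) <= 1 / 2.
  by rewrite nrmM; move: (nrm x) (nrm v) hx nx nv => a b; nra.
rewrite horner_tr big_ord_recl /= mul0r add0r.
have -> : \sum_(i < L) t * ((g i)%:C%C * v ^+ bump 0 i) * x ^+ bump 0 i = t * S L (x * v).
  rewrite /S mulr_sumr; apply: eq_bigr => i _; rewrite exprMn /bump leq0n add1n.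
  by ring.
rewrite -mulrBr nrmM -mulrA; apply: ler_wpM2l; rewrite ?nrm_ge0 //.
apply: le_trans (gam_rem L xv) _; rewrite nrmM exprMn -mulrA.
by rewrite [nrm x ^+ _ * _]mulrC.
Qed.

End Gamma.

(** * Polynomials on lines, dense directions, and local properties of the submanifold *)

Section Polynomials.
Variables (R : realType) (n : nat).
Local Notation C := (R[i]^o).
Local Notation Cn := 'rV[C]_n.
Implicit Types (z w u : Cn) (q : Cn -> C).

Lemma holpoly_line q z u : holpoly q -> exists P : {poly C}, forall x : C, q (z + x *: u) = P.[x].
Proof.
elim=> {q} [c|j|q1 q2 _ [P1 h1] _ [P2 h2]|q1 q2 _ [P1 h1] _ [P2 h2]].
- by exists c%:P => x; rewrite hornerC.
- exists ((u ord0 j)%:P * 'X + (z ord0 j)%:P) => x.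
  by rewrite hornerMXaddC hornerC /Defs.coord !mxE addrC mulrC.
- by exists (P1 + P2) => x; rewrite hornerD h1 h2.
- by exists (P1 * P2) => x; rewrite hornerM h1 h2.
Qed.

Lemma holpoly_differentiable q z : holpoly q -> differentiable q z.
Proof.
elim=> {q} [c|j|q1 q2 _ h1 _ h2|q1 q2 _ h1 _ h2].
- exact: differentiable_cst.
- by apply: (@differentiable_entry _ _ _ (fun z : Cn => z)).
- exact: differentiableD.
- exact: differentiableM.
Qed.

Lemma continuous_neq0 q z : {for z, continuous q} -> q z != 0 ->
  exists2 d : R, 0 < d & forall w, nrm (w - z) < d -> q w != 0.
Proof.
move=> /nrm_continuousP cq qz; have [d d0 hd] := cq _ (nrm_gt0 qz); exists d => // w /hd.
by apply: contraTneq => ->; rewrite sub0r nrmN ltxx.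
Qed.

(** Otherwise the restriction to the line from [z0] to [z1] would be a one-variable polynomial
    vanishing near 0, hence zero, in contradiction with its value at [z1]. *)
Lemma holpoly_nonvanishing q z0 z1 (e : R) : holpoly q -> q z1 != 0 -> 0 < e ->
  exists2 z, nrm (z - z0) < e & q z != 0.
Proof.
move=> hq qz e0; have [P hP] := holpoly_line z0 (z1 - z0) hq.
apply: contrapT => H; move/eqP: qz; apply.
have -> : q z1 = P.[1] by rewrite -hP scale1r addrC subrK.
suff -> : P = 0 by rewrite horner0.
have u1 : 0 < nrm (z1 - z0) + 1 by apply: ltr_wpDl; rewrite ?nrm_ge0.
apply/polyP => i; rewrite coef0; apply: (@bigO_coef _ i.+1) => //.
exists 0, (e / (nrm (z1 - z0) + 1)); split => //; first exact: divr_gt0.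
move=> x; rewrite ltr_pdivlMr // => hx.
rewrite -hP; have [->|qx] := eqVneq (q (z0 + x *: (z1 - z0))) 0; first by rewrite nrm0 mul0r.
exfalso; apply: H; exists (z0 + x *: (z1 - z0)) => //.
rewrite addrAC subrr add0r nrmZ; apply: le_lt_trans hx.
by apply: ler_wpM2l; rewrite ?nrm_ge0 // lerDl.
Qed.

Lemma holpolys_nonvanishing (I : eqType) (s : seq I) (q : I -> Cn -> C) z0 (e : R) :
  (forall i, holpoly (q i)) -> (forall i, exists z, q i z != 0) -> 0 < e ->
  exists (z : Cn) (d : R), [/\ 0 < d, nrm (z - z0) + d <= e &
    forall w, nrm (w - z) < d -> forall i, i \in s -> q i w != 0].
Proof.
move=> hq qn e0; elim: s => [|i s [z [d [d0 zd hd]]]].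
  by exists z0, e; split=> //; rewrite subrr nrm0 add0r.
have [z1 qz1] := qn i.
have [z2 z2d qz2] := holpoly_nonvanishing z (hq i) qz1 (divr_gt0 d0 (ltr0Sn _ 1)).
have [d2 d20 hd2] := continuous_neq0 (differentiable_continuous (holpoly_differentiable z2 (hq i))) qz2.
have m1 : Num.min d2 (d / 2) <= d / 2 by rewrite ge_min lexx orbT.
exists z2, (Num.min d2 (d / 2)); split.
- by rewrite lt_min d20 divr_gt0.
- apply: le_trans zd; apply: le_trans (lerD (nrm_tri z z2 z0) m1) _.
  by move: z2d; move: (nrm (z2 - z)) (nrm (z - z0)) => a b; lra.
move=> w; rewrite lt_min => /andP[w2 wd] j; rewrite inE => /orP[/eqP->|js].
  exact: hd2.
apply: hd => //; apply: le_lt_trans (nrm_tri z2 w z) _; rewrite [d]splitr; exact: ltrD.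
Qed.

Lemma countable_dense : exists2 D : set Cn, countable D &
  forall z (e : R), 0 < e -> exists2 u, D u & nrm (u - z) < e.
Proof.
pose f (ab : 'rV[rat]_n * 'rV[rat]_n) : Cn :=
  \row_j (ratr (ab.1 ord0 j) +i* ratr (ab.2 ord0 j))%C.
exists (f @` [set: 'rV[rat]_n * 'rV[rat]_n]); first exact: countable_image.
move=> z e e0.
have approx (x : R) : exists a : rat, `|ratr a - x| <= e / 4.
  have lt : x < x + e / 4 by rewrite ltrDl divr_gt0.
  have [a] := rat_in_itvoo lt; rewrite in_itv /= => /andP[xa ae]; exists a.
  by rewrite ger0_norm ?subr_ge0 ?(ltW xa) // lerBlDl ltW.
have /choice[a ha] : forall j, exists a : rat, `|ratr a - complex.Re (z ord0 j)| <= e / 4.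
  by move=> j; exact: approx.
have /choice[b hb] : forall j, exists a : rat, `|ratr a - complex.Im (z ord0 j)| <= e / 4.
  by move=> j; exact: approx.
exists (f (\row_j a j, \row_j b j)); first by exists (\row_j a j, \row_j b j).
apply: (@le_lt_trans _ _ (e / 2)); last by rewrite ltr_pdivrMr // ltr_pMr // ltr1n.
apply/nrm_rV; first by rewrite divr_ge0 // ltW.
move=> j; apply: le_trans (nrm_ReIm _) _.
have -> : e / 2 = e / 4 + e / 4 by field.
rewrite !mxE /= ReD ImD ReN ImN /=; apply: lerD; [exact: ha|exact: hb].
Qed.

Lemma realpoly_continuous q z : realpoly q -> forall e : R, 0 < e ->
  exists2 d : R, 0 < d & forall w, nrm (w - z) < d -> nrm (q w - q z) < e.
Proof.
have entry (j : 'I_n) : forall e : R, 0 < e -> exists2 d : R, 0 < d &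
    forall w, nrm (w - z) < d -> nrm (Defs.coord w j - Defs.coord z j : C) < e.
  move=> e e0; exists e => // w h; apply: le_lt_trans h.
  by have := nrm_coord (w - z) j; rewrite !mxE.
elim=> {q} [c _|j|j|q1 q2 _ h1 _ h2|q1 q2 _ h1 _ h2] e e0.
- by exists 1 => // w _; rewrite subrr nrm0.
- have [d d0 hd] := entry j e e0; exists d => // w /hd.
  apply: le_lt_trans; rewrite -!complexRe -rmorphB /= nrm_real.
  by apply: le_trans (nrm_Re _); rewrite ReD ReN.
- have [d d0 hd] := entry j e e0; exists d => // w /hd.
  apply: le_lt_trans; rewrite -!complexIm -rmorphB /= nrm_real.
  by apply: le_trans (nrm_Im _); rewrite ImD ImN.
- have c1 := (nrm_continuousP (q1 : Cn -> C) z).2 h1.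
  have c2 := (nrm_continuousP (q2 : Cn -> C) z).2 h2.
  exact: ((nrm_continuousP _ z).1 (continuousD c1 c2) e e0).
- have c1 := (nrm_continuousP (q1 : Cn -> C) z).2 h1.
  have c2 := (nrm_continuousP (q2 : Cn -> C) z).2 h2.
  exact: ((nrm_continuousP _ z).1 (continuousM c1 c2) e e0).
Qed.

(** Near [p] the set is the common zero set of the functions [rho k], which are continuous. *)
Lemma generic_locally_closed (M : set Cn) p : real_alg_generic_at M p ->
  exists2 r : R, 0 < r & forall z, nrm (z - p) < r ->
    (forall e : R, 0 < e -> exists2 w, M w & nrm (w - z) < e) -> M z.
Proof.
move=> [d [rho [U [oU Up rp MU _]]]].
have [r r0 hr] := (open_nrmP U).1 oU p Up; exists r => // z zr cl.
have Uz := hr z zr.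
suff : (M `&` U) z by case.
rewrite MU; split=> // k; apply: (@eq_nrm_small _ C) => e e0; rewrite subr0.
have [d1 d10 hd1] := realpoly_continuous z (rp k) e0.
have [d2 d20 hd2] := (open_nrmP U).1 oU z Uz.
have m0 : 0 < Num.min d1 d2 by rewrite lt_min d10.
have [w Mw] := cl _ m0; rewrite lt_min => /andP[w1 w2].
have : (M `&` U) w by split=> //; exact: hd2.
rewrite MU => -[_ /(_ k) rw].
by have := hd1 w w1; rewrite rw sub0r nrmN => /ltW.
Qed.

(** Curves witnessing tangency are two-sided, so both signs of h are covered; the flow is later
    followed for negative times too. *)
Lemma tangent_step (M : set Cn) z v : tangent_vec M z v -> forall e : R, 0 < e ->
  exists2 d : R, 0 < d & forall h : R, h != 0 -> `|h| < d ->
    exists2 w, M w & nrm (w - z - h%:C%C *: v) <= e * `|h|.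
Proof.
move=> [gamma [delta [delta0 g0 gM cv]]] e e0.
have /cv : nbhs v [set v' | nrm (v' - v) < e] by apply/nbhs_nrmP; exists e.
move=> /nbhs_ballP[d /= d0 hd]; exists (Num.min d delta); first by rewrite lt_min d0.
move=> h h0; rewrite lt_min => /andP[hd1 hd2]; exists (gamma h); first exact: gM.
have := hd h; rewrite /ball /= sub0r normrN => /(_ hd1 h0) /ltW.
have hC : h%:C%C != 0 :> C by rewrite (fmorph_eq0 (real_complex R)).
have -> : gamma h - z - h%:C%C *: v = h%:C%C *: (rC h^-1 *: (gamma h - z) - v).
  rewrite scalerBr scalerA /rC fmorphV divff // scale1r //.
by rewrite nrmZ nrm_real mulrC => le; apply: ler_wpM2r.
Qed.

End Polynomials.

(** * Real-time flows preserve the submanifold *)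

Section FlowInvariance.
Variables (R : realType) (n : nat).
Local Notation C := (R[i]^o).
Local Notation Cn := 'rV[C]_n.
Variables (X : Cn -> Cn) (K L : R) (p : Cn) (r : R).
Hypothesis XK : forall z, nrm (X z) <= K.
Hypothesis XL : forall z w, nrm (X z - X w) <= L * nrm (z - w).
Hypothesis L0 : 0 <= L.
Hypothesis r0 : 0 < r.
Hypothesis dX : forall z, nrm (z - p) < r -> differentiable X z.
Hypothesis K0 : 0 <= K.
Variable M : set Cn.
Hypothesis Mcl : forall z, nrm (z - p) < r ->
  (forall e : R, 0 < e -> exists2 w, M w & nrm (w - z) < e) -> M z.
Hypothesis MX : forall z, M z -> nrm (z - p) < r -> tangent_vec M z (X z).

Lemma flow_invariant (s : R) z : M z -> nrm (z - p) <= r / 8 -> 8 * `|s| * L <= 1 ->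
  8 * (K * `|s|) <= r -> M (Phi X s%:C%C z).
Proof.
move=> Mz zp; rewrite -mulrA => sL sK.
(* Negative times are reduced to positive ones: Nagumo's theorem is applied to [sg] times the field
   over the interval [0, |s|]. *)
pose sg : R := if 0 <= s then 1 else -1.
have sgs : s = sg * `|s| by rewrite /sg; case: ger0P => _; rewrite ?mul1r // mulN1r opprK.
have sg1 : `|sg| = 1 by rewrite /sg; case: ifP => _; rewrite ?normrN normr1.
have sg0 : sg != 0 by rewrite -normr_eq0 sg1 oner_eq0.
have T0 := normr_ge0 s; have rr := r0.
have inT (a : R) : 0 <= a <= `|s| -> [/\ `|sg * a| = a, a * L <= 1 / 8 & K * a <= r / 8].
  move=> /andP[a0 aT]; rewrite normrM sg1 mul1r ger0_norm //.
  have h1 := ler_wpM2r L0 aT; have h2 := ler_wpM2l K0 aT.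
  by split=> //; move: (a * L) (`|s| * L) (K * a) (K * `|s|) h1 h2 sL sK => *; lra.
have nsg (a : R) : nrm ((sg * a)%:C%C : C) = `|sg * a| by exact: nrm_real.
rewrite {1}sgs.
apply: (@nagumo R n M p r `|s| (2 * K) L (fun z => sg%:C%C *: X z)
  (fun a => Phi X (sg * a)%:C%C z)) => //.
- exact: mulr_ge0.
- by have [] := inT `|s|; rewrite ?T0 ?lexx // => _ h _; apply: le_trans h _; lra.
- move=> w Mw wp e e0; have [d d0 hd] := tangent_step (MX Mw wp) e0; exists d => // h /andP[h0 hd'].
  have nh : `|sg * h| = h by rewrite normrM sg1 mul1r gtr0_norm.
  have [||w' Mw' hw'] := hd (sg * h); rewrite ?nh //.
    by rewrite mulf_neq0 // gt_eqF.
  exists w' => //; move: hw'; rewrite nh scalerA -rmorphM /= [h * sg]mulrC //.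
- move=> w w'; rewrite -scalerBr nrmZ nrm_real sg1 mul1r; exact: XL.
- move=> a aT e e0; have [na aL aK] := inT a aT.
  have [|||d d0 hd] := @Phi_ode _ _ X K L p r XK XL L0 r0 dX K0 z (sg * a)%:C%C _ _ _ e e0.
  + by apply: le_lt_trans zp _; lra.
  + by rewrite nsg na -mulrA; lra.
  + by rewrite nsg na; lra.
  exists d => // h /andP[h0 hd'].
  have nh : `|sg * h| = h by rewrite normrM sg1 mul1r gtr0_norm.
  have := hd (sg * h)%:C%C; rewrite nsg nh => /(_ hd').
  by rewrite -rmorphD /= -mulrDr scalerA -rmorphM /= [h * sg]mulrC.
- move=> a a' aT aT'; have [na aL aK] := inT a aT; have [na' aL' aK'] := inT a' aT'.
  apply: le_trans (Phi_time XK XL L0 z _ _) _; rewrite ?nsg ?na ?na'.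
  + by rewrite -mulrA; lra.
  + by rewrite -mulrA; lra.
  rewrite -rmorphB /= nrm_real -mulrBr normrM sg1 mul1r.
  by rewrite [_ * K]mulrAC.
- by rewrite mulr0 rmorph0 (Phi0 XK XL L0).
- move=> a aT; have [na aL aK] := inT a aT.
  apply: le_trans (nrm_tri z _ _) _.
  have h : nrm (Phi X (sg * a)%:C%C z - z) <= K * a.
    have cL : 2 * nrm ((sg * a)%:C%C : C) * L <= 1 by rewrite nsg na -mulrA; lra.
    by have := Phi_distK XK XL L0 z cL; rewrite nsg na [a * K]mulrC.
  by move: (nrm _) (nrm _) h zp => x y; lra.
- by rewrite T0 lexx.
Qed.

End FlowInvariance.

(** * The twisted flow: nonalgebraicity and dependence on the parameter *)

Section TwistedFlow.
Variables (R : realType) (n : nat).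
Local Notation C := (R[i]^o).
Local Notation Cn := 'rV[C]_n.
Variables (X : Cn -> Cn) (K L : R) (p : Cn) (r : R).
Hypothesis XK : forall z, nrm (X z) <= K.
Hypothesis XL : forall z w, nrm (X z - X w) <= L * nrm (z - w).
Hypothesis L0 : 0 <= L.
Hypothesis r0 : 0 < r.
Hypothesis dX : forall z, nrm (z - p) < r -> differentiable X z.
Hypothesis K0 : 0 <= K.
Hypothesis Xn0 : forall e : R, 0 < e -> exists2 z, nrm (z - p) < e & X z != 0.

(** All the conditions hold together on some small ball close to [p], and [D] meets its translate by
    -p. The index type leaves room for one polynomial per component and one more, at [None], which
    keeps a coordinate of the direction nonzero. *)
Lemma generic_direction (D : set Cn) (q : option 'I_n -> Cn -> C) :
  (forall z (e : R), 0 < e -> exists2 u, D u & nrm (u - z) < e) ->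
  (forall i, holpoly (q i)) -> (forall i, exists z, q i z != 0) ->
  exists u, [/\ D u, nrm u < r / 8, X (p + u) != 0 & forall i, q i (p + u) != 0].
Proof.
move=> Dd hq qn; have r8 : 0 < r / 8 by rewrite divr_gt0.
have [z0 z0r Xz0] := Xn0 r8.
have [e e0 he] : exists2 e : R, 0 < e & forall z, nrm (z - z0) < e -> X z != 0.
  have L1 : 0 < L + 1 by apply: ltr_wpDl.
  exists (nrm (X z0) / (L + 1)); first by rewrite divr_gt0 // nrm_gt0.
  move=> z; rewrite ltr_pdivlMr // => hz; apply/eqP => Xz.
  have := XL z z0; rewrite Xz sub0r nrmN => h; move: hz; apply/negP; rewrite -leNgt.
  by apply: le_trans h _; rewrite mulrC; apply: ler_wpM2l; rewrite ?nrm_ge0 // lerDl.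
have gap : 0 < Num.min e (r / 8 - nrm (z0 - p)) by rewrite lt_min e0 subr_gt0.
have [z [d [d0 zd hd]]] := holpolys_nonvanishing (enum {: option 'I_n}) z0 hq qn gap.
have [u Du ud] := Dd (z - p) d d0; exists u.
have wz : nrm (p + u - z) < d by move: ud; rewrite opprB addrA [u + p]addrC.
have wz0 : nrm (p + u - z0) < Num.min e (r / 8 - nrm (z0 - p)).
  apply: lt_le_trans zd; apply: le_lt_trans (nrm_tri z _ _) _.
  by rewrite addrC ltrD2l.
move: wz0; rewrite lt_min => /andP[we wr]; split => //.
- have -> : u = (p + u - z0) + (z0 - p) by rewrite addrA subrK addrAC subrr add0r.
  by apply: le_lt_trans (nrmD _ _) _; rewrite -ltrBrDr.
- exact: he.
- by move=> i; apply: hd => //; rewrite mem_enum.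
Qed.

(** [q] is a coefficient of the equation that is not identically zero. When it is nonzero at p + u,
    its restriction to the line is nonzero at x = 1, so the restricted equation is nontrivial. *)
Lemma alg_on_line (U : set Cn) (f : Cn -> C) : open U -> U p -> alg_on U f ->
  exists q : Cn -> C, [/\ holpoly q, exists z, q z != 0 & forall u, q (p + u) != 0 ->
    exists (d : nat) (P : {poly {poly C}}), [/\ P != 0, (size P <= d)%N &
      exists2 e : R, 0 < e & forall x : C, nrm x < e ->
        \sum_(k < d) (P`_k).[x] * f (p + x *: u) ^+ k = 0]].
Proof.
move=> oU Up [d [a [ha [k0 [z0 ak0]] rel]]]; exists (a k0); split=> //; first by exists z0.
move=> u au; have /choice[A hA] : forall k : 'I_d.+1, exists P : {poly C}, forall x : C,
    a k (p + x *: u) = P.[x] by move=> k; exact: holpoly_line.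
have PE (k : 'I_d.+1) : (\poly_(i < d.+1) A (inord i))`_k = A k.
  by rewrite coef_poly ltn_ord inord_val.
exists d.+1, (\poly_(i < d.+1) A (inord i)); split.
- apply/eqP => /(congr1 (fun P : {poly {poly C}} => P`_k0)); rewrite PE coef0 => A0.
  by move: au; rewrite -[u]scale1r hA A0 horner0 eqxx.
- exact: size_poly.
have [e e0 he] := (open_nrmP U).1 oU p Up.
have u1 : 0 < nrm u + 1 by apply: ltr_wpDl; rewrite ?nrm_ge0.
exists (e / (nrm u + 1)); first exact: divr_gt0.
move=> x; rewrite ltr_pdivlMr // => hx.
rewrite -[RHS](rel (p + x *: u)); last first.
  apply: he; rewrite addrAC subrr add0r nrmZ; apply: le_lt_trans hx.
  by apply: ler_wpM2l; rewrite ?nrm_ge0 // lerDl.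
by apply: eq_bigr => k _; rewrite PE hA.
Qed.

Variable l : 'I_n.

Definition twist (g : nat -> R) (g1 : forall N, 0 < g N <= 1) (t : R) (z : Cn) : Cn :=
  Phi X (t%:C%C * gam g1 (z ord0 l - p ord0 l)) z.

Lemma twist_line g g1 t (x : C) u : @twist g g1 t (p + x *: u) =
  Phi X (t%:C%C * gam g1 (x * u ord0 l)) (p + x *: u).
Proof. by rewrite /twist !mxE [p ord0 l + _]addrC addrK. Qed.

(** Taylor coefficients at 0 of x -> t gam(x v), the time at which the flow is evaluated along a
    line. *)
Let ycoef (g : nat -> R) (t : R) (v : C) (i : nat) : C :=
  if i is i'.+1 then t%:C%C * ((g i')%:C%C * v ^+ i) else 0.

Lemma twist_series g g1 t u (j : 'I_n) b :
  jexp (fun t x => Phi X t (p + x *: u) ord0 j) b ->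
  exists2 s : nat -> C,
    (forall N i, (i < N)%N -> s i = (subst b N (tr (ycoef g t (u ord0 l)) N))`_i) &
    forall N, asy (fun x => @twist g g1 t (p + x *: u) ord0 j) (tr s N) N.
Proof.
move=> jb.
have fy N : asy (fun x => t%:C%C * gam g1 (x * u ord0 l)) (tr (ycoef g t (u ord0 l)) N) N.
  exact: gam_asy.
have f1 : bigO 1 (fun x => t%:C%C * gam g1 (x * u ord0 l)).
  by apply: bigO_ext (fy 1%N) => x; rewrite horner_tr big_ord1 mul0r subr0.
have [s sE sP] := asy_series jb (erefl : ycoef g t (u ord0 l) 0 = 0) f1 fy.
exists s; first exact: sE.
move=> N; apply: (@bigO_ext _ N _ _ _ (sP N)) => x.
rewrite twist_line; reflexivity.
Qed.

(** Both properties rest on the same [g] and on directions taken from the countable set [D], fixed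
    before [g]. The nonalgebraicity of H_t uses all coefficients along a line; separating two
    parameters uses only the first one that depends on them. *)
Lemma twist_nonalgebraic : exists (g : nat -> R) (g1 : forall N, 0 < g N <= 1),
  (forall t, t != 0 -> ~ alg_map_at p (twist g1 t)) /\
  (forall (e : R) s t, 0 < e -> s != t -> exists2 z, nrm (z - p) < e & twist g1 s z != twist g1 t z).
Proof.
have [D cD Dd] := @countable_dense R n.
have /choice[B BP] : forall u : Cn, exists jmb : 'I_n * nat * (nat -> nat -> C),
    nrm u < r / 8 -> X (p + u) != 0 ->
    [/\ jexp (fun t x => Phi X t (p + x *: u) ord0 jmb.1.1) jmb.2,
        forall k i, (0 < k)%N -> (i < jmb.1.2)%N -> jmb.2 k i = 0 & jmb.2 1%N jmb.1.2 != 0].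
  move=> u; have [[ur Xu]|h] := pselect (nrm u < r / 8 /\ X (p + u) != 0).
    have [j [m [b h]]] := flow_line_expansion XK XL L0 r0 dX K0 ur Xu.
    by exists (j, m, b).
  by exists (l, 0%N, fun _ _ => 0) => ur Xu; exfalso; apply: h.
pose S : set R[i] := \bigcup_(u in D)
  ([set u ord0 l] `|` (fun ki : nat * nat => (B u).2 ki.1 ki.2) @` [set: nat * nat]).
have cS : countable S.
  apply: bigcup_countable => // u _; rewrite -bigcup2E.
  apply: bigcup_countable => [|[|[|k]] _] //=; try exact: countableP.
  exact: countable_image.
have [g [Fs [SF g1 sFs mF [gF gT]]]] := independent_reals cS.
exists g, g1; split.
- move=> t t0 [U [oU Up alg]].
  have /choice[q qP] : forall j, exists q : Cn -> C, [/\ holpoly q, exists z, q z != 0 &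
      forall u, q (p + u) != 0 -> exists (d : nat) (P : {poly {poly C}}), [/\ P != 0, (size P <= d)%N &
      exists2 e : R, 0 < e & forall x : C, nrm x < e ->
        \sum_(k < d) (P`_k).[x] * (twist g1 t (p + x *: u) ord0 j : C) ^+ k = 0]].
    by move=> j; exact: alg_on_line oU Up (alg j).
  pose qq (i : option 'I_n) : Cn -> C :=
    if i is Some j then q j else fun z => Defs.coord z l + - Defs.coord p l.
  have [||u [Du ur Xu qu]] := @generic_direction D qq Dd.
  + case=> [j|]; first by case: (qP j).
    by apply: hp_add; [exact: hp_coord|exact: hp_const].
  + case=> [j|]; first by case: (qP j).
    exists (p + const_mx 1); rewrite /qq /Defs.coord !mxE addrAC subrr add0r; exact: oner_neq0.
  have [jb b0 b1] := BP u ur Xu; set j := (B u).1.1 in jb; set m := (B u).1.2 in b0 b1.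
  have [s sE sP] := @twist_series g g1 t u j _ jb.
  have [_ _ /(_ u (qu (Some j)))[d [P [P0 sP' rel]]]] := qP j.
  have vP : vanish P s by apply: asy_vanish sP' sP rel.
  have [c hc] := alg_series_fin_gen P0 vP.
  (* The parameter t joins the generators of the coefficients of the algebraic series; [u ord0 l]
     and the expansion coefficients already lie in [Fs 0]. *)
  apply: (@not_fin_gen _ Fs (fun N => (g N)%:C%C) (t%:C%C :: c)) => // F sF F0 Fc.
  have Fs_ i : F (s i) by apply: hc => // x xc; apply: Fc; rewrite inE xc orbT.
  have Ft : F t%:C%C by apply: Fc; rewrite inE eqxx.
  have Fu : F (u ord0 l) by apply/F0/SF; exists u => //; left.
  have Fb k i : F ((B u).2 k i) by apply/F0/SF; exists u => //; right; exists (k, i).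
  have Fy := @subst_gen _ F (B u).2 (ycoef g t (u ord0 l)) s m sF b0 (erefl _) b1 Fb Fs_ sE.
  have u0 : u ord0 l != 0.
    by have := qu None; rewrite /qq /Defs.coord !mxE [p ord0 l + _]addrC addrK.
  have tC : t%:C%C != 0 :> R[i] by rewrite (fmorph_eq0 (real_complex R)).
  move=> N; have -> : (g N)%:C%C = ycoef g t (u ord0 l) N.+1 / (t%:C%C * u ord0 l ^+ N.+1) :> R[i].
    apply: (canRL (mulfK _)); first by rewrite mulf_neq0 // expf_neq0.
    by rewrite /ycoef mulrCA.
  apply: (subM sF); first exact: Fy.
  by apply: (subV sF); apply: (subM sF) => //; exact: (subX sF).
- move=> e s t e0 st.
  pose qq (i : option 'I_n) : Cn -> C := fun z => Defs.coord z l + - Defs.coord p l.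
  have [||u [Du ur Xu qu]] := @generic_direction D qq Dd.
  + by move=> i; rewrite /qq; apply: hp_add; [exact: hp_coord|exact: hp_const].
  + by move=> i; exists (p + const_mx 1); rewrite /qq /Defs.coord !mxE addrAC subrr add0r; exact: oner_neq0.
  have u0 : u ord0 l != 0.
    by have := qu None; rewrite /qq /Defs.coord !mxE [p ord0 l + _]addrC addrK.
  have [jb b0 b1] := BP u ur Xu; set j := (B u).1.1 in jb; set m := (B u).1.2 in b0 b1.
  have [c1 cE1 cP1] := @twist_series g g1 s u j _ jb.
  have [c2 cE2 cP2] := @twist_series g g1 t u j _ jb.
  apply: contrapT => H.
  have un : 0 < nrm u + 1 by apply: ltr_wpDl; rewrite ?nrm_ge0.
  have cc i : c1 i = c2 i.
    have h : asy (fun x => twist g1 t (p + x *: u) ord0 j) (tr c1 i.+1) i.+1.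
      apply: asy_near (cP1 i.+1); exists (e / (nrm u + 1)); first exact: divr_gt0.
      move=> x; rewrite ltr_pdivlMr; last exact: un.
      move=> hx; have [->|ne] := eqVneq (twist g1 s (p + x *: u)) (twist g1 t (p + x *: u)).
        reflexivity.
      exfalso; apply: H; exists (p + x *: u); last exact: ne.
      rewrite addrAC subrr add0r nrmZ; apply: le_lt_trans hx.
      by apply: ler_wpM2l; rewrite ?nrm_ge0 // lerDl.
    by have := asy_uniq h (cP2 i.+1) (ltnSn i); rewrite !coef_tr ltnSn.
  (* In degree 1 + m the two series differ exactly by b 1 m times (s - t) g 0 u_l, because
     truncation at order 1 leaves the zero polynomial for both times. *)
  have := cc (1 + m)%N; rewrite (cE1 (1 + m).+1) // (cE2 (1 + m).+1) //.
  rewrite !(subst_coef (m := m) b0) //.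
  have -> : tr (ycoef g s (u ord0 l)) 1 = tr (ycoef g t (u ord0 l)) 1.
    by apply/polyP => -[|i]; rewrite !coef_tr.
  move=> /addrI /(mulfI b1); rewrite /ycoef.
  have gu : (g 0%N)%:C%C * u ord0 l ^+ 1 != 0 :> R[i].
    rewrite mulf_neq0 ?expf_neq0 // (fmorph_eq0 (real_complex R)).
    by have /andP[/lt0r_neq0] := g1 0%N.
  move=> /(mulIf gu) /complexI; exact/eqP.
Qed.

End TwistedFlow.

(** * Isolated numerical inequalities *)

Section Numerics.
Variable R : realType.
Implicit Types a b c d N : R.

Lemma near_id_estimate a b c A B N : A <= a * N -> B <= b * c -> a <= 1 / 4 ->
  b * c <= 1 / 4 * N -> 0 <= N -> A + B <= 1 / 2 * N.
Proof. by nra. Qed.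

Lemma small_radius a : a <= 1 / 32 -> a < 1 / 2 /\ 2 * a <= 1.
Proof. by lra. Qed.

Lemma eighth a b : 8 * a <= b -> a <= b / 8.
Proof. by lra. Qed.

Lemma eighth_le a b : 0 < b -> a <= b / 8 -> a <= b / 2.
Proof. by lra. Qed.

Lemma eighth_lt b : 0 < b -> b / 8 < b / 2 /\ b / 8 < b.
Proof. by lra. Qed.

Lemma quarter_le a : 8 * a <= 1 -> 2 * a <= 1 / 4.
Proof. by lra. Qed.

Lemma time_lip_bound a b c : a <= 128 * c -> 1024 * c <= b -> 2 * a <= 1 / 4 * b.
Proof. by lra. Qed.

End Numerics.

(** * Assembly: choice of the neighbourhood and of the parameter range *)

Theorem theorem7p8 (R : realType) (n : nat) (M : set 'rV[(R[i])^o]_n)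
    (p : 'rV[(R[i])^o]_n) :
  (0 < n)%N ->
  real_alg_generic_submanifold M ->
  M p ->
  in_leviflat_at M p ->
  (exists (U : set 'rV[(R[i])^o]_n) (X : 'rV[(R[i])^o]_n -> 'rV[(R[i])^o]_n),
      [/\ inf_CR_aut M p U X, nontrivial_at p X & induces_alg_foliation p X]) ->
  exists (eps : R) (U : set 'rV[(R[i])^o]_n)
         (H : R -> 'rV[(R[i])^o]_n -> 'rV[(R[i])^o]_n),
    [/\ 0 < eps, open U & U p] /\
    [/\ (forall t, `|t| < eps ->
           biholo_on U (H t) /\ (forall z, M z -> U z -> M (H t z))),
        (forall z, U z -> H 0 z = z),
        (forall z t, U z -> `|t| < eps -> (fun s => H s z) @ t --> H t z),
        (forall s t, `|s| < eps -> `|t| < eps -> s != t ->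
           exists z, U z /\ H s z != H t z) &
        (forall t, `|t| < eps -> t != 0 -> ~ alg_map_at p (H t))].
Proof.
move=> n0 Mgen Mp [V [oV Vp VM]] [U0 [X [[oU0 U0p hX _ tX] nt _]]].
have [Y [K [L [r0 [L0 r00 YK YL hr0]]]]] := extend_field oU0 U0p hX.
have K0 : 0 <= K by apply: le_trans (nrm_ge0 (Y p)) (YK p).
have [r1 r10 hr1] := generic_locally_closed (Mgen p Mp).
have [r2 r20 hr2] := (open_nrmP V).1 oV p Vp.
pose r := Num.min r0 (Num.min r1 r2).
have r_0 : 0 < r by rewrite !lt_min r00 r10.
have lr z : nrm (z - p) < r -> [/\ nrm (z - p) < r0, nrm (z - p) < r1 & nrm (z - p) < r2].
  by rewrite !lt_min => /andP[? /andP[]].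
have dY z : nrm (z - p) < r -> differentiable Y z by move=> /lr[/hr0[_ []]].
have Yn0 e : 0 < e -> exists2 z, nrm (z - p) < e & Y z != 0.
  move=> e0; apply: contrapT => H; apply: nt; exists [set z | nrm (z - p) < Num.min e r]; split.
  - exact: open_nrm_ball.
  - by rewrite /= subrr nrm0 lt_min e0.
  move=> z /=; rewrite lt_min => /andP[ze /lr[/hr0[_ [<- _]] _ _]].
  by have [//|ne] := eqVneq (Y z) 0; exfalso; apply: H; exists z.
have MY z : M z -> nrm (z - p) < r -> tangent_vec M z (Y z).
  by move=> Mz /lr[/hr0[Uz [-> _]] _ _]; exact: tX.
have Mcl z : nrm (z - p) < r ->
    (forall e : R, 0 < e -> exists2 w, M w & nrm (w - z) < e) -> M z.
  by move=> /lr[_ h _]; exact: hr1.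
have ln : (n.-1 < n)%N by rewrite prednK.
pose l : 'I_n := Ordinal ln.
have [g [g1 [nalg inj]]] := twist_nonalgebraic YK YL L0 r_0 dY K0 Yn0 l.
have [e1 e10 he1] := @time_scale _ (8 * L) 1 (mulr_ge0 (ler0n _ _) L0) ltr01.
have [e2 e20 he2] := @time_scale _ (8 * K) r (mulr_ge0 (ler0n _ _) K0) r_0.
have [e3 e30 he3] := @time_scale _ (1024 * K) 1 (mulr_ge0 (ler0n _ _) K0) ltr01.
(* For |t| < eps one has 8 |t| L <= 1, 8 |t| K <= r and 1024 |t| K <= 1. The first two make the
   polygons converge and keep them near [p]; the first and the third each bound one half of the
   Lipschitz constant of H_t - id. *)
pose eps := Num.min e1 (Num.min e2 e3).
have eps0 : 0 < eps by rewrite !lt_min e10 e20.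
(* The radius 1/32 is the domain of the Lipschitz bound for [gam], and r / 8 leaves room for the
   flow inside the ball of radius [r]. *)
pose rho := Num.min (1 / 32) (r / 8).
have rho0 : 0 < rho by rewrite lt_min !divr_gt0.
pose H := twist Y p l g1.
exists eps, [set z | nrm (z - p) < rho], H.
have U32 z : nrm (z - p) < rho -> nrm (z ord0 l - p ord0 l : R[i]^o) <= 1 / 32.
  move=> zr; apply: (@le_trans _ _ (nrm (z - p))).
    by have := nrm_coord (z - p) l; rewrite !mxE.
  by apply: ltW; apply: lt_le_trans zr _; rewrite ge_min lexx.
have Ur z : nrm (z - p) < rho -> nrm (z - p) < r / 8.
  by move=> zr; apply: lt_le_trans zr _; rewrite ge_min lexx orbT.
have gam1 z : nrm (z - p) < rho -> nrm (gam g1 (z ord0 l - p ord0 l)) <= 1.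
  move=> /U32 h; apply: le_trans (gam_le g1 _) _; first exact: ltW (small_radius h).1.
  apply: le_trans (_ : 2 * nrm (z ord0 l - p ord0 l : R[i]^o) <= 1) => //.
  exact: (small_radius h).2.
pose tau (t : R) (z : 'rV[R[i]^o]_n) : R[i]^o := t%:C%C * gam g1 (z ord0 l - p ord0 l).
have tauE t z : nrm (z - p) < rho -> nrm (tau t z) <= `|t|.
  move=> /gam1 h; rewrite nrmM nrm_real; by apply: ler_piMr.
have teps (t : R) : `|t| < eps -> [/\ 8 * `|t| * L <= 1, 8 * (K * `|t|) <= r & 1024 * (K * `|t|) <= 1].
  rewrite !lt_min => /andP[t1 /andP[t2 t3]].
  split.
  - by rewrite mulrAC mulrC; apply: he1; rewrite normr_ge0 (ltW t1).
  - by rewrite mulrA mulrC; apply: he2; rewrite normr_ge0 (ltW t2).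
  - by rewrite mulrA mulrC; apply: he3; rewrite normr_ge0 (ltW t3).
have tauc t z : `|t| < eps -> nrm (z - p) < rho ->
    8 * nrm (tau t z) * L <= 1 /\ 8 * (K * nrm (tau t z)) <= r.
  move=> /teps[h1 h2 _] /(tauE t) h; split.
    apply: le_trans h1; apply: ler_wpM2r => //; exact: ler_wpM2l.
  by apply: le_trans h2; apply: ler_wpM2l => //; exact: ler_wpM2l.
have tau2 t z : `|t| < eps -> nrm (z - p) < rho -> 2 * nrm (tau t z) * L <= 1.
  move=> te zr; have [h _] := tauc t z te zr; apply: le_trans h.
  by apply: ler_wpM2r => //; apply: ler_wpM2r; rewrite ?nrm_ge0 // ler_nat.
have HE t z : H t z = Phi Y (tau t z) z by [].
split; first by split=> //; [exact: open_nrm_ball|rewrite /= subrr nrm0].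
split.
- move=> t te; split.
    apply: near_id_biholo.
    + move=> z zr; have gap : 0 < rho - nrm (z - p) by rewrite subr_gt0.
      apply: (Phi_differentiable YK YL L0 r_0 dY K0 (g := tau t) (F := fun z => z) gap).
      move=> v vz; have vr : nrm (v - p) < rho.
        by apply: le_lt_trans (nrm_tri z _ _) _; rewrite -ltrBrDr.
      have [c1 c2] := tauc t v te vr; split.
      * have d1 : differentiable (fun z : 'rV[R[i]^o]_n => z ord0 l - p ord0 l : R[i]^o) v.
          apply: differentiable_subc; last exact: differentiable_cst.
          exact: (@differentiable_entry _ _ _ (fun z => z)).
        have d2 : differentiable (gam g1) (v ord0 l - p ord0 l).
          exact: gam_differentiable (small_radius (U32 v vr)).1.
        have := differentiable_mulc t%:C%C (differentiable_comp d1 d2).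
        by under eq_fun do rewrite mulrC.
      * exact: ex_diff.
      * exact: tau2.
      * exact: eighth_le r_0 (eighth c2).
      * exact: lt_trans (Ur v vr) (eighth_lt r_0).1.
    + move=> z w zr wr.
      (* The displacement varies first with the starting point at a fixed time, then with the time
         at a fixed starting point. Each part contributes at most 1/4 of |z - w|, which gives the
         constant 1/2 required for maps near the identity. *)
      have -> : H t z - z - (H t w - w) =
        (Phi Y (tau t z) z - z - (Phi Y (tau t z) w - w)) + (Phi Y (tau t z) w - Phi Y (tau t w) w).
        rewrite !HE; move: (Phi _ _ _) (Phi _ _ _) (Phi _ _ _) => a b c.
        by apply/rowP => k; rewrite !mxE; ring.
      apply: le_trans (nrmD _ _) _.
      have [c1 c2] := tauc t z te zr; have [_ _ c3] := teps t te.
      have A := Phi_lip YK YL L0 z w (tau2 t z te zr).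
      have B := Phi_time YK YL L0 w (tau2 t z te zr) (tau2 t w te wr).
      apply: near_id_estimate A B _ _ (nrm_ge0 _).
        by move: c1; rewrite -!mulrA; exact: quarter_le.
      have E : nrm (tau t z - tau t w) <= `|t| * (128 * nrm (z - w)).
        rewrite /tau -mulrBr nrmM nrm_real; apply: ler_wpM2l => //.
        apply: le_trans (gam_lip g1 (U32 z zr) (U32 w wr)) _; apply: ler_wpM2l => //.
        have -> : (z ord0 l - p ord0 l - (w ord0 l - p ord0 l) : R[i]^o) = (z - w) ord0 l.
          by rewrite !mxE opprB subrKA.
        exact: nrm_coord.
      rewrite -mulrA; apply: (@time_lip_bound _ _ _ (K * `|t| * nrm (z - w))).
        have -> : 128 * (K * `|t| * nrm (z - w)) = `|t| * (128 * nrm (z - w)) * K by ring.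
        exact: ler_wpM2r.
      by rewrite mulrA -[leRHS]mul1r; apply: ler_wpM2r; rewrite ?nrm_ge0.
  move=> z Mz zr; rewrite HE.
  have zV : V z by apply: hr2; case: (lr z (lt_trans (Ur z zr) (eighth_lt r_0).2)).
  have Imz : complex.Im (z ord0 l) = 0.
    by have := VM z Mz zV l (erefl _); rewrite -complexIm => /complexI.
  have Imp : complex.Im (p ord0 l) = 0.
    by have := VM p Mp Vp l (erefl _); rewrite -complexIm => /complexI.
  pose a := complex.Re (z ord0 l) - complex.Re (p ord0 l).
  have aE : (z ord0 l - p ord0 l : R[i]^o) = a%:C%C.
    by apply: complex_ext; rewrite /= ?ReD ?ReN ?ImD ?ImN ?Imz ?Imp ?subrr.
  have ga : complex.Im (gam g1 a%:C%C) = 0.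
    apply: gam_real; rewrite -nrm_real -aE; exact: ltW (small_radius (U32 z zr)).1.
  (* Both last coordinates are real and the series has real coefficients, so the time assigned to a
     point of [M] is real. *)
  have tE : tau t z = (t * complex.Re (gam g1 a%:C%C))%:C%C.
    rewrite /tau aE; apply: complex_ext; rewrite ?ReM ?ImM /= ?ga ?mulr0 ?mul0r ?subr0 ?addr0 //.
  have [c1 c2] := tauc t z te zr; rewrite tE nrm_real in c1 c2.
  rewrite tE; apply: (flow_invariant YK YL L0 r_0 dY K0 Mcl MY) => //.
  by apply: ltW; exact: Ur.
- by move=> z _; rewrite HE /tau mul0r (Phi0 YK YL L0).
- move=> z t zr te A /nbhs_nrmP[d d0 hd].
  have K1 : 0 < 2 * K + 1 by apply: ltr_wpDl => //; exact: mulr_ge0.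
  apply/nbhs_ballP; exists (Num.min (eps - `|t|) (d / (2 * K + 1))).
    by rewrite /= lt_min subr_gt0 te divr_gt0.
  move=> s; rewrite /ball /= lt_min ltr_pdivlMr // => /andP[st sd]; apply: hd.
  have se : `|s| < eps.
    rewrite -[s](subrK t); apply: le_lt_trans (ler_normD _ _) _.
    by rewrite distrC -ltrBrDr.
  rewrite !HE; apply: le_lt_trans (Phi_time YK YL L0 z (tau2 s z se zr) (tau2 t z te zr)) _.
  have h : nrm (tau s z - tau t z) <= `|s - t|.
    by rewrite /tau -mulrBl -rmorphB /= nrmM nrm_real ler_piMr // gam1.
  apply: (@le_lt_trans _ _ (2 * (`|s - t| * K))).
    by rewrite -mulrA; apply: ler_wpM2l => //; exact: ler_wpM2r.
  apply: le_lt_trans sd; rewrite distrC mulrCA; apply: ler_wpM2l => //.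
  by rewrite lerDl.
- move=> s t _ _ st; have [z zr ne] := inj rho s t rho0 st; by exists z.
- by move=> t _ t0; exact: nalg.
Qed.
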